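(* There exist absolute constants $c, C>0$ such that for every integer $r \ge 2$ and every real $\delta$ with $0 < \delta < \frac{1}{r}$ there exists $n_0=n_0(r,\delta)$ such that for every integer $n>n_0$, $$ c\cdot\frac{\log n}{(1/r-\delta)\,r\log(1/\delta)} \;\le\; b_n(r,\delta)\;\le\; C\cdot \frac{\log n}{(1/r-\delta)\,r\log(1/\delta)}\;, $$ that is, $b_n(r,\delta)=\Theta\left(\frac{\log n}{(1/r-\delta)r\log(1/\delta)}\right)$.
   Context: Graphs are finite and simple. For positive integers $k,b$, $K_{k}(b)$ (the $b$-blow-up of the complete graph $K_k$) is the graph consisting of $k$ disjoint vertex sets $V_1,\ldots,V_{k}$ of size $b$ each, where for every $i \neq j$ every vertex of $V_i$ is adjacent to every vertex of $V_j$. For an integer $r\ge 2$ and real $0<\delta<1/r$, $b_n(r,\delta)$ denotes the largest integer $b$ such that every $n$-vertex graph with at least $(1-1/r+\delta)n^2/2$ edges contains a copy of $K_{r+1}(b)$ as a (not necessarily induced) subgraph. The constants hidden in $\Theta$ are absolute (independent of $r$, $\delta$ and $n$). *)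

(* Defs.v *)
From HB Require Import structures.
From mathcomp Require Import all_boot all_order all_algebra.
From mathcomp Require Import all_classical all_reals all_analysis.

Set Implicit Arguments.
Unset Strict Implicit.
Unset Printing Implicit Defensive.

Import Order.TTheory GRing.Theory Num.Theory.

Local Open Scope ring_scope.

Record sgraph (T : finType) := SGraph {
  adj :> rel T;
  adj_sym : symmetric adj;
  adj_irr : irreflexive adj }.

Definition edges (T : finType) (G : sgraph T) : {set {set T}} :=
  [set [set p.1; p.2]%SET | p : T * T & G p.1 p.2]%SET.

Definition contains_copy (S T : finType) (H : sgraph S) (G : sgraph T) : Prop :=
  exists f : S -> T, injective f /\ forall u v, H u v -> G (f u) (f v).

(* The part of the vertex (i, x) is i, so each of the k parts has b vertices. *)
Definition blowup_adj (k b : nat) : rel ('I_k * 'I_b)%type :=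
  fun u v => u.1 != v.1.

Lemma blowup_adj_sym (k b : nat) : symmetric (@blowup_adj k b).
Proof. by move=> u v; rewrite /blowup_adj eq_sym. Qed.

Lemma blowup_adj_irr (k b : nat) : irreflexive (@blowup_adj k b).
Proof. by move=> u; rewrite /blowup_adj eqxx. Qed.

Definition blowup (k b : nat) : sgraph ('I_k * 'I_b)%type :=
  SGraph (@blowup_adj_sym k b) (@blowup_adj_irr k b).

Definition forces_blowup (R : realType) (n r : nat) (delta : R) (b : nat) : Prop :=
  forall G : sgraph 'I_n,
    (1 - r%:R^-1 + delta) * n%:R ^+ 2 / 2 <= #|edges G|%:R ->
    contains_copy (blowup r.+1 b) G.

(* b = b_n(r, delta).  This is a relation because the maximum need not exist:
   if n is so small that no n-vertex graph is dense enough, every b is forced. *)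
Definition is_blowup_number (R : realType) (n r : nat) (delta : R) (b : nat) : Prop :=
  [/\ (0 < b)%N, forces_blowup n r delta b
    & forall b' : nat, forces_blowup n r delta b' -> (b' <= b)%N].

(* Main.v *)
Require Import Defs.
From HB Require Import structures.
From mathcomp Require Import all_boot all_order all_algebra.
From mathcomp Require Import all_classical all_reals all_analysis.
From mathcomp Require Import ring lra zify.
From mathcomp Require Import fintype finfun bigop finset.

(** Put eps = 1 - r delta, so that a graph meets the hypothesis when at most the
    proportion eps / r of all ordered pairs are non-edges, and write
    X = ln n / (eps ln (1 / delta)).  The claim is that b_n is of order X.

    Upper bound.  Two random graphs without a large blow-up.  If delta is at least
    a fixed power of 1 / r, take random points in a grid with D coordinates and
    join two of them when they differ everywhere ([random_points]).  A blow-up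
    must distribute the M values of each coordinate among its r + 1 parts, which
    has probability at most (r + 1)^(M - (r + 1) b); with D of order ln n / ln r
    this beats the number of choices of its vertices once (r + 1) b >= 2 M, that is
    for b of order X.  If delta is smaller, take a complete r-partite graph and put
    a random graph of density about r^2 delta into one class ([random_class]).  A
    blow-up with r + 1 parts has two parts inside that class, and the usual bound
    for complete bipartite subgraphs of random graphs applies.

    Lower bound.  First, a set S minimising the density of non-edges minus a small
    multiple of ln |S| has linear size and all its vertices have degree about
    (1 - eps / r) |S| in S ([regular_core]).  The parts V_0, ..., V_r of the blow-up are
    built inside linear-sized reservoirs W_i in S, which are all equal to S if eps
    is small.  Given finished parts V_i of size at most B and a new slot e, there
    are linearly many v in W_e adjacent to the fraction x_i of V_i, where the
    product of the x_i is at least a number c with ln (1 / c) of order eps.  Passing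
    to a popular pattern, all the v kept have the same neighbours in slightly
    smaller parts V'_i.  The pattern is chosen as a random subset of the
    neighbourhood, so that one pays only for the missing vertices, a factor
    2k / c each, and there are at most B ln (1 / c) of these in total, since
    1 - x <= - ln x ([shrink_stage]).  So n^(1/2) choices for v remain when
    B eps ln (1 / delta) is a small multiple of ln n.  As the reservoir is much
    larger than all parts together, any part that has become too small may be
    thrown away and built anew.  The product of the sizes of the parts doubles each
    time, so after boundedly many rounds no part is too small ([rebuild_loop]).

    When eps is close to 1, counting non-neighbours gives r vertices of S only a
    proportion of order r delta of common neighbours, and c would be too small.
    The reservoirs are then chosen as a minimiser of an energy, which makes all
    pairs regular ([min_regular]) while the densities of non-edges from each
    reservoir to the others sum to less than 1 ([min_row]).  Hence nearly all tuples
    have about as many common neighbours as the product of the densities of edges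
    predicts ([bad_extend], [nbad_full]), and the other ones, the bad tuples, are
    carried along through the construction as a proportion of the box of all
    tuples.  The product is bounded below by an absolute constant if all densities
    are at least 1/2, and each reservoir is joined to at most one other with a
    smaller density.  Such a heavy pair may have a density of order r delta only.
    Its two parts are therefore rebuilt together, the first one larger than needed
    and then cut down once and for all, at the cost of a factor of order r delta
    for each of B vertices ([close_pair]). *)

Set Implicit Arguments.
Unset Strict Implicit.
Unset Printing Implicit Defensive.

Import Order.TTheory GRing.Theory Num.Theory.

Local Open Scope ring_scope.


(** * Popular subsets *)

Lemma leq_expn2r (m n d : nat) : (m <= n)%N -> (m ^ d <= n ^ d)%N.
Proof. by case: d => // d mn; rewrite leq_exp2r. Qed.

(** The quotient of the binomials is the product of (a + j) / (a + j - t) for j from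
    1 to d, with numerators at most a + d and denominators at least a - t + 1. *)
Lemma bin_ratio_compl (a t d : nat) : (t <= a)%N ->
  ('C(a + d, t) * (a - t).+1 ^ d <= 'C(a, t) * (a + d) ^ d)%N.
Proof.
move=> ta; elim: d => [|d IH]; first by rewrite addn0.
have key : ((a + d).+1 * 'C(a + d, t) = ((a + d).+1 - t) * 'C((a + d).+1, t))%N.
  by rewrite mul_bin_down.
have h1 : ('C((a + d).+1, t) * (a - t).+1 <= (a + d).+1 * 'C(a + d, t))%N.
  by rewrite key mulnC leq_mul2r; apply/orP; right; lia.
rewrite addnS !expnS.
apply: (@leq_trans ((a + d).+1 * ('C(a + d, t) * (a - t).+1 ^ d))%N).
  by rewrite !mulnA leq_mul2r h1 orbT.
apply: (@leq_trans ((a + d).+1 * ('C(a, t) * (a + d) ^ d))%N).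
  by rewrite leq_mul2l IH orbT.
rewrite mulnCA leq_mul2l leq_mul2l; apply/orP; right; apply/orP; right.
exact: leq_expn2r.
Qed.

Lemma bin_ratio_small (a m t : nat) : (t <= a)%N -> (a <= m)%N ->
  ('C(m, t) * (a - t) ^ t <= 'C(a, t) * m ^ t)%N.
Proof.
move=> ta am; have tf := fact_gt0 t.
rewrite -(leq_pmul2r tf) mulnAC bin_ffact mulnAC bin_ffact mulnC.
have ub x y : (x ^_ y <= x ^ y)%N.
  elim: y x => // y IH x; rewrite ffactnSr expnSr leq_mul ?leq_subr //.
have lb y x : (y <= x)%N -> ((x - y) ^ y <= x ^_ y)%N.
  move=> yx; rewrite ffact_prod -[X in (_ ^ X)%N]card_ord -prod_nat_const.
  by apply: leq_prod => i _; rewrite leq_sub2l // ltnW.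
by rewrite leq_mul ?lb // ub.
Qed.

Section Popular.
Variables (T : finType) (G : rel T).
Implicit Types (X A S : {set T}).

Definition nb (v : T) : {set T} := [set u | G v u].

(** Averaging over the t-subsets of A: the neighbourhood of each v of X contains
    the fraction C(a,t) / C(#|A|,t) of them. *)
Lemma popular_subset X A (a t : nat) :
  (forall v, v \in X -> #|nb v :&: A| = a) -> (t <= #|A|)%N ->
  exists S, [/\ S \subset A, #|S| = t &
   (#|X| * 'C(a, t) <= #|[set v in X | S \subset nb v]| * 'C(#|A|, t))%N].
Proof.
move=> Xa tA.
pose D := [set S : {set T} | (S \subset A) && (#|S| == t)].
have cD : #|D| = 'C(#|A|, t) by rewrite cards_draws.
pose F S := #|[set v in X | S \subset nb v]|.
have sumF : (\sum_(S in D) F S = #|X| * 'C(a, t))%N.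
  transitivity (\sum_(S in D) \sum_(v in X | S \subset nb v) 1)%N.
    by apply: eq_bigr => S _; rewrite sum1dep_card.
  rewrite (exchange_big_dep (mem X)) /=; last by move=> S v _ /andP[].
  rewrite -sum_nat_const; apply: eq_bigr => v vX.
  rewrite -(Xa v vX) -cards_draws sum1dep_card; apply: eq_card => S.
  by rewrite !inE vX subsetI; case: (S \subset A); case: (S \subset nb v);
     rewrite ?andbF ?andbT.
have [S0 S0D] : exists S, S \in D.
  apply/set0Pn; rewrite -card_gt0 cD bin_gt0 //.
case: (arg_maxnP F S0D) => S SD Smax.
have : S \in D by []; rewrite inE => /andP[SA /eqP St]; exists S; split => //.
rewrite -sumF -cD mulnC -sum_nat_const; apply: leq_sum => S' S'D.
exact: Smax.
Qed.

Lemma popular_value X A : X != set0 ->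
  exists a (Y : {set T}), [/\ Y \subset X, forall v, v \in Y -> #|nb v :&: A| = a,
     (#|X| <= #|Y| * #|A|.+1)%N & Y != set0].
Proof.
move=> X0.
pose F (i : 'I_#|A|.+1) := #|[set v in X | #|nb v :&: A| == i]|.
have sumF : (#|X| <= \sum_i F i)%N.
  rewrite -sum1_card (partition_big (fun v => inord #|nb v :&: A| : 'I_#|A|.+1) xpredT) //=.
  apply: leq_sum => i _; rewrite sum1dep_card; apply: subset_leq_card.
  apply/subsetP => v; rewrite !inE => /andP[-> /eqP <-] /=.
  by rewrite inordK // ltnS subset_leq_card // subsetIr.
case: (arg_maxnP F (erefl : xpredT (ord0 : 'I_#|A|.+1))) => i _ imax.
have le : (#|X| <= F i * #|A|.+1)%N.
  apply: leq_trans sumF _; rewrite mulnC.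
  rewrite -[X in (_ <= X * _)%N]card_ord -sum_nat_const.
  by apply: leq_sum => j _; apply: imax.
exists i, [set v in X | #|nb v :&: A| == i]; split => //.
- by apply/subsetP => v; rewrite inE => /andP[].
- by move=> v; rewrite inE => /andP[_ /eqP].
- apply/negP => /eqP e0; move: le; rewrite /F e0 cards0 mul0n leqn0.
  by rewrite cards_eq0 (negPf X0).
Qed.

(** Fixing the degree a into A costs a factor m + 1, where m is the size of A.
    Keeping all but the fraction 1/h of the a neighbours then costs a factor
    h m / a for each of the m - a missing elements, and nothing for the elements
    that are present. *)
Lemma shrink_one (h : nat) X A : (0 < h)%N -> X != set0 ->
  exists a (A' Y : {set T}), [/\ [/\ Y \subset X, Y != set0 & A' \subset A],
    #|A'| = (a - a %/ h)%N,
    (forall v, v \in Y -> #|nb v :&: A| = a /\ A' \subset nb v) &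
    (#|X| * a ^ (#|A| - a) <= #|Y| * (#|A|.+1 * (h * #|A|) ^ (#|A| - a)))%N].
Proof.
move=> h0 X0; have [a [Y [YX Ya Xle Y0]]] := popular_value A X0.
have [v0 v0Y] := set0Pn _ Y0.
have aA : (a <= #|A|)%N by rewrite -(Ya _ v0Y) subset_leq_card // subsetIr.
have ta : (a - a %/ h <= a)%N by rewrite leq_subr.
have [S [SA St Sle]] := popular_subset Ya (leq_trans ta aA).
exists a, S, [set v in Y | S \subset nb v]; split => //.
- split => //.
    by apply: subset_trans YX; apply/subsetP => v; rewrite inE => /andP[].
  rewrite -card_gt0; move: Sle; case: #|[set v in Y | S \subset nb v]| => // .
  by rewrite mul0n leqn0 muln_eq0 cards_eq0 (negPf Y0) -leqn0 leqNgt bin_gt0 ta.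
- by move=> v; rewrite inE => /andP[vY]; rewrite Ya.
set d := (#|A| - a)%N; set t := (a - a %/ h)%N in ta St Sle *.
have Ad : #|A| = (a + d)%N by rewrite subnKC.
set Z := #|[set v in Y | S \subset nb v]| in Sle *.
have := bin_ratio_compl d ta; rewrite -Ad => hb.
have Cp : (0 < 'C(a, t))%N by rewrite bin_gt0.
have step : (#|Y| * a ^ d <= Z * (h * #|A|) ^ d)%N.
  have ha : (a <= h * (a - t).+1)%N.
    rewrite /t subKn ?leq_div // mulnS.
    by have := divn_eq a h; have := ltn_pmod a h0; lia.
  rewrite -(leq_pmul2l Cp).
  apply: (@leq_trans ('C(#|A|, t) * Z * (h ^ d * (a - t).+1 ^ d))%N).
    rewrite -expnMn mulnA leq_mul //; first by rewrite mulnC [X in (_ <= X)%N]mulnC.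
    by apply: leq_expn2r.
  rewrite expnMn; move: hb; set p := ((a - t).+1 ^ d)%N; set q := (#|A| ^ d)%N.
  set u := (h ^ d)%N => hb.
  have -> : ('C(#|A|, t) * Z * (u * p) = Z * u * ('C(#|A|, t) * p))%N by ring.
  have -> : ('C(a, t) * (Z * (u * q)) = Z * u * ('C(a, t) * q))%N by ring.
  by rewrite leq_mul2l hb orbT.
apply: (@leq_trans (#|Y| * #|A|.+1 * a ^ d)%N); first by rewrite leq_mul2r Xle orbT.
by rewrite mulnAC mulnCA [X in (_ <= X)%N]mulnC [X in (_ <= X)%N]mulnC mulnC leq_mul2l step orbT.
Qed.

End Popular.

Section ShrinkAll.
Variables (T : finType) (G : rel T) (I : finType).
Implicit Types (X Y : {set T}) (V : I -> {set T}).

Lemma shrink_seq (h : nat) V X (l : seq I) : (0 < h)%N -> X != set0 -> uniq l ->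
  exists (a : I -> nat) V' Y,
    [/\ [/\ Y \subset X, Y != set0, forall i, V' i \subset V i &
          forall i, i \notin l -> V' i = V i],
      forall i, i \in l -> #|V' i| = (a i - a i %/ h)%N,
      (forall i v, i \in l -> v \in Y ->
         #|nb G v :&: V i| = a i /\ V' i \subset nb G v) &
      (#|X| * \prod_(i <- l) a i ^ (#|V i| - a i) <=
       #|Y| * \prod_(i <- l) (#|V i|.+1 * (h * #|V i|) ^ (#|V i| - a i)))%N].
Proof.
move=> h0; elim: l X => [|j l IH] X X0 /= => [_|/andP[jl ul]].
  by exists (fun=> 0%N), V, X; split => //; rewrite !big_nil.
have [a [V1 [Y [[YX Y0 V1V V1E] V1c V1n le]]]] := IH X X0 ul.
have [b [A [Z [[ZY Z0 AV] Ac Zn leZ]]]] := shrink_one G (V j) h0 Y0.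
exists (fun i => if i == j then b else a i), (fun i => if i == j then A else V1 i), Z.
split.
- split => //; first exact: subset_trans YX.
    by move=> i; case: eqP => [->|].
  by move=> i; rewrite inE negb_or => /andP[/negPf-> /V1E].
- move=> i; rewrite inE; case: eqP => [_ _ //|_ /= il]; exact: V1c.
- move=> i v; rewrite inE; case: eqP => [-> _|_ /= il] vZ; first exact: Zn.
  by apply: V1n => //; apply: (subsetP ZY).
- rewrite !big_cons eqxx.
  rewrite (eq_big_seq (fun i => a i ^ (#|V i| - a i))%N); last first.
    by move=> i il; case: eqP => // ij; rewrite ij (negPf jl) in il.
  rewrite [X in (_ <= _ * (_ * X))%N](eq_big_seq
    (fun i => #|V i|.+1 * (h * #|V i|) ^ (#|V i| - a i))%N); last first.
    by move=> i il; case: eqP => // ij; rewrite ij (negPf jl) in il.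
  set P1 := (\prod_(i <- l) _)%N in le *; set P2 := (\prod_(i <- l) _)%N in le *.
  apply: (@leq_trans (#|Y| * P2 * b ^ (#|V j| - b))%N).
    by rewrite mulnCA mulnC leq_mul2r le orbT.
  rewrite mulnAC [X in (_ <= X)%N]mulnA leq_mul2r; apply/orP; right.
  exact: leZ.
Qed.

End ShrinkAll.

Section ShrinkReal.
Variables (R : realType) (T : finType) (G : rel T) (k : nat).
Implicit Types (X Y : {set T}) (V : 'I_k -> {set T}) (C : {set 'I_k}).

Lemma prod_one_minus (I : finType) (P : pred I) (x : I -> R) :
  (forall i, P i -> 0 <= x i <= 1) ->
  1 - \sum_(i | P i) x i <= \prod_(i | P i) (1 - x i).
Proof.
move=> x01.
suff [] : 1 - \sum_(i | P i) x i <= \prod_(i | P i) (1 - x i) /\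
   (0 <= \prod_(i | P i) (1 - x i) <= 1) by [].
elim/big_rec2 : _ => [|i p s Pi [le /andP[p0 p1]]]; first by rewrite subr0 lexx ler01.
have /andP[a0 a1] := x01 i Pi; split; first by nra.
by apply/andP; split; nra.
Qed.

Lemma prod_le1_ge (I : finType) (P : pred I) (x : I -> R) i :
  (forall i, P i -> 0 <= x i <= 1) -> P i -> \prod_(i | P i) x i <= x i.
Proof.
move=> x01 Pi; rewrite (bigD1 i) //= ler_piMr //; first by case/andP: (x01 i Pi).
by apply: prodr_ile1 => j /andP[Pj _]; apply: x01.
Qed.

(** 1 - x <= - ln x, summed. *)
Lemma sum_one_minus_ln (I : finType) (P : pred I) (x : I -> R) c :
  0 < c -> (forall i, P i -> 0 <= x i <= 1) -> c <= \prod_(i | P i) x i ->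
  \sum_(i | P i) (1 - x i) <= ln c^-1.
Proof.
move=> c0 x01 cx.
have xp i : P i -> 0 < x i.
  by move=> Pi; apply: lt_le_trans c0 (le_trans cx (prod_le1_ge x01 Pi)).
have lnP : ln (\prod_(i | P i) x i) = \sum_(i | P i) ln (x i) /\ 0 < \prod_(i | P i) x i.
  elim/big_rec2 : _ => [|i y1 y2 Pi [<- y0]]; first by rewrite ln1.
  by rewrite lnM ?posrE ?xp // mulr_gt0 ?xp.
have -> : ln c^-1 = - ln c by rewrite lnV ?posrE.
apply: (@le_trans _ _ (- ln (\prod_(i | P i) x i))); last first.
  by rewrite lerN2 ler_ln ?posrE //; case: lnP.
case: lnP => -> _; rewrite -sumrN; apply: ler_sum => i Pi.
have := @le_ln1Dx R (x i - 1); rewrite (_ : 1 + (x i - 1) = x i); last by ring.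
by move=> /(_ _) le; have := xp i Pi => xi0; have := le ltac:(lra); lra.
Qed.

(** The fraction of the candidates that survives one stage: B + 1 possible degrees
    into each of k parts, and a factor 2k / c for each of at most B ln(1/c)
    missing neighbours. *)
Definition rho (B : nat) (c : R) : R :=
  (B.+1%:R ^+ k)^-1 * expR (- (B%:R * ln c^-1 * ln ((2 * k)%:R / c))).

(** Only the missing neighbours are paid for, so the cost is governed by their
    total number.  If v is adjacent to the fraction x_i of the part V i and the
    product of the x_i is at least c, then this number is the sum of
    (1 - x_i) |V i|, hence at most B times the sum of - ln x_i.  With h = 2k the
    roundings in all parts together lose only a factor 2. *)
Lemma shrink_stage (B : nat) (c : R) V X C : (0 < k)%N ->
  0 < c <= 1 -> X != set0 ->
  (forall i, i \in C -> (#|V i| <= B)%N /\ V i != set0) ->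
  (forall v, v \in X -> c * \prod_(i in C) #|V i|%:R <=
                        \prod_(i in C) #|nb G v :&: V i|%:R) ->
  exists V' Y, [/\ [/\ Y \subset X, Y != set0, forall i, V' i \subset V i &
      forall i, i \notin C -> V' i = V i],
    (forall i v, i \in C -> v \in Y -> V' i \subset nb G v),
    c / 2 * \prod_(i in C) #|V i|%:R <= \prod_(i in C) #|V' i|%:R :> R &
    #|X|%:R * rho B c <= #|Y|%:R].
Proof.
move=> k0 /andP[c0 c1] X0 VB Vn; pose h := (2 * k)%N.
have h0 : (0 < h)%N by rewrite muln_gt0.
have [a [V' [Y [[YX Y0 V'V V'E] V'c V'n le]]]] :=
  shrink_seq G V h0 X0 (enum_uniq (mem C)).
have [v vY] := set0Pn _ Y0.
have vX := subsetP YX _ vY.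
have aE i : i \in C -> #|nb G v :&: V i| = a i.
  by move=> iC; have [] := V'n i v _ vY; rewrite ?mem_enum.
have am i : i \in C -> (a i <= #|V i|)%N.
  by move=> iC; rewrite -aE // subset_leq_card // subsetIr.
have m0 i : i \in C -> (0 < #|V i|)%N by move=> iC; rewrite card_gt0; case: (VB i iC).
pose x i : R := (a i)%:R / #|V i|%:R.
have x01 i : i \in C -> 0 <= x i <= 1.
  move=> iC; rewrite /x divr_ge0 //= ler_pdivrMr ?ltr0n ?m0 // mul1r ler_nat.
  exact: am.
have cx : c <= \prod_(i in C) x i.
  rewrite /x big_split /= prodfV ler_pdivlMr; last first.
    by apply: prodr_gt0 => i iC; rewrite ltr0n m0.
  have := Vn v vX; rewrite [X in _ <= X -> _](eq_bigr (fun i => (a i)%:R)) //.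
  by move=> i iC; rewrite aE.
have aV i : i \in C -> (a i)%:R = x i * #|V i|%:R.
  by move=> iC; rewrite /x divfK // pnatr_eq0 -lt0n m0.
exists V', Y; split.
- by split => // i iC; apply: V'E; rewrite mem_enum.
- by move=> i u iC uY; case: (V'n i u _ uY); rewrite ?mem_enum.
- apply: (@le_trans _ _ (\prod_(i in C) ((a i)%:R * (1 - h%:R^-1)))); last first.
    apply: ler_prod => i iC; have hi : (h%:R : R)^-1 <= 1.
      by rewrite invf_le1 ?ltr0n // ler1n.
    rewrite V'c ?mem_enum // mulr_ge0 ?subr_ge0 //=.
    rewrite natrB ?leq_div // mulrBr mulr1 lerB // ler_pdivlMr ?ltr0n //.
    by rewrite -natrM ler_nat leq_divM.
  rewrite big_split /= [X in _ <= X * _](eq_bigr (fun i => x i * #|V i|%:R)); last by move=> i iC; apply: aV.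
  rewrite big_split /= [X in _ <= X]mulrAC ler_wpM2r ?prodr_ge0 //.
  apply: ler_pM; rewrite ?invr_ge0 ?(ltW c0) //.
  apply: le_trans (prod_one_minus _); last first.
    by move=> i _; rewrite invr_ge0 ler0n /= invf_le1 ?ltr0n // ler1n.
  rewrite sumr_const -[X in _ - X]mulr_natl.
  have : (#|C|%:R : R) <= k%:R by rewrite ler_nat -[X in (_ <= X)%N]card_ord max_card.
  have hk : (h%:R : R)^-1 = (k%:R)^-1 / 2 by rewrite /h natrM invfM mulrC.
  have kp : (0 : R) < k%:R by rewrite ltr0n.
  move=> Ck; rewrite hk mulrA; have : #|C|%:R / k%:R <= 1 :> R by rewrite ler_pdivrMr // mul1r.
  by lra.
pose E := (\sum_(i in C) (#|V i| - a i))%N.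
have EB : (E%:R : R) <= B%:R * ln c^-1.
  rewrite /E natr_sum; apply: (@le_trans _ _ (B%:R * \sum_(i in C) (1 - x i))).
    rewrite mulr_sumr; apply: ler_sum => i iC; rewrite natrB ?am // aV // -[X in X - _]mul1r -mulrBl mulrC.
    apply: ler_wpM2r; first by have /andP[] := x01 i iC; rewrite subr_ge0.
    by rewrite ler_nat; case: (VB i iC).
  by rewrite ler_wpM2l // sum_one_minus_ln.
have ch : 0 < c / h%:R by rewrite divr_gt0 ?ltr0n.
have hle : ((c / h%:R) ^+ E) * \prod_(i in C) (h * #|V i|)%:R ^+ (#|V i| - a i) <=
   \prod_(i in C) (a i)%:R ^+ (#|V i| - a i) :> R.
  rewrite /E -prodrXr -big_split /=; apply: ler_prod => i iC.
  have nn : 0 <= c / h%:R * (h * #|V i|)%:R by apply: mulr_ge0; rewrite ?ler0n ?(ltW ch).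
  rewrite -exprMn exprn_ge0 //=; apply: lerXn2r; rewrite ?nnegrE ?ler0n //.
  rewrite natrM mulrA divfK ?pnatr_eq0 -?lt0n // aV // ler_wpM2r //.
  exact: le_trans cx (prod_le1_ge x01 iC).
move: le; rewrite -(ler_nat R) !natrM !natr_prod !big_enum /=.
rewrite (eq_bigr (fun i => (a i)%:R ^+ (#|V i| - a i) : R)); last by move=> *; rewrite natrX.
rewrite [X in _ <= _ * X -> _](eq_bigr (fun i => #|V i|.+1%:R *
   (h * #|V i|)%:R ^+ (#|V i| - a i) : R)); last by move=> *; rewrite natrM natrX.
rewrite big_split /= => le.
set Q := \prod_(i in C) (h * #|V i|)%:R ^+ _ in le hle.
have Q0 : 0 < Q by apply: prodr_gt0 => i iC; rewrite exprn_gt0 // ltr0n muln_gt0 h0 m0.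
have PB : \prod_(i in C) #|V i|.+1%:R <= B.+1%:R ^+ k :> R.
  apply: (@le_trans _ _ (\prod_(i in C) B.+1%:R)).
    by apply: ler_prod => i iC; rewrite ler0n ler_nat ltnS; case: (VB i iC).
  rewrite prodr_const ler_weXn2l ?ler1n //.
  by rewrite -[X in (_ <= X)%N]card_ord max_card.
have Bp : 0 < B.+1%:R ^+ k :> R by rewrite exprn_gt0 // ltr0n.
have le2 : #|X|%:R * (c / h%:R) ^+ E <= #|Y|%:R * B.+1%:R ^+ k.
  rewrite -(ler_pM2r Q0) -[X in X <= _]mulrA.
  apply: le_trans (ler_wpM2l (ler0n _ _) hle) (le_trans le _).
  rewrite mulrA; apply: ler_wpM2r; first exact: ltW.
  by apply: ler_wpM2l; [exact: ler0n | exact: PB].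
rewrite /rho mulrCA -ler_pdivlMl ?invr_gt0 // invrK mulrC [X in _ <= X]mulrC.
apply: le_trans le2; rewrite mulrC ler_wpM2l //.
have -> : (c / h%:R) ^+ E = expR (E%:R * ln (c / h%:R)).
  by rewrite expRM_natl lnK // posrE.
rewrite ler_expR.
have -> : ln (c / h%:R) = - ln (h%:R / c) by rewrite -lnV ?posrE ?divr_gt0 ?ltr0n // invf_div.
rewrite mulrN lerN2 ler_wpM2r // ln_ge0 // ler_pdivlMr // mul1r.
by apply: le_trans c1 _; rewrite ler1n.
Qed.

End ShrinkReal.

(** * Boxes of tuples *)

Section Boxes.
Variables (R : realType) (T : finType) (k : nat).
Implicit Types (V : 'I_k -> {set T}) (y : {ffun 'I_k -> T}) (C : {set 'I_k}).
Implicit Type bad : pred {ffun 'I_k -> T}.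

Definition box V : {set {ffun 'I_k -> T}} :=
  [set y : {ffun 'I_k -> T} | [forall i, y i \in V i]].

Lemma boxP V y : reflect (forall i, y i \in V i) (y \in box V).
Proof. by rewrite inE; apply: forallP. Qed.

Lemma card_box V : #|box V| = (\prod_i #|V i|)%N.
Proof.
transitivity #|family (fun i => mem (V i))|.
  by apply: eq_card => y; rewrite inE; apply/forallP/familyP.
by rewrite card_family foldrE big_map big_enum.
Qed.

Definition upd V (e : 'I_k) (A : {set T}) := fun i => if i == e then A else V i.

Lemma upd_same V e A : upd V e A e = A.
Proof. by rewrite /upd eqxx. Qed.

Lemma upd_other V e A i : i != e -> upd V e A i = V i.
Proof. by rewrite /upd => /negPf ->. Qed.

Definition setf y (e : 'I_k) (v : T) : {ffun 'I_k -> T} :=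
  [ffun i => if i == e then v else y i].

Definition nbad bad V := #|[set y in box V | bad y]|.

Lemma card_box_upd V e A : (#|box (upd V e A)| * #|V e| = #|A| * #|box V|)%N.
Proof.
rewrite !card_box (bigD1 e) //= [in RHS](bigD1 e) //= upd_same.
rewrite (eq_bigr (fun i => #|V i|)); last by move=> i ie; rewrite upd_other.
by rewrite mulnAC -mulnA.
Qed.

(** Exchange the e-th coordinate of a bad tuple of the new box with an arbitrary
    element of V e: this injects the left side into the pairs counted on the
    right. *)
Lemma nbad_upd_le bad V e (W : {set T}) :
  (nbad bad (upd V e W) * #|V e| <=
   \sum_(y in box V) #|[set v in W | bad (setf y e v)]|)%N.
Proof.
set S := [set y in box (upd V e W) | bad y].
pose f (p : {ffun 'I_k -> T} * T) := (setf p.1 e p.2, p.1 e).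
have -> : (\sum_(y in box V) #|[set v in W | bad (setf y e v)]|)%N =
  #|[set p : {ffun 'I_k -> T} * T | (p.1 \in box V) && (p.2 \in [set v in W | bad (setf p.1 e v)])]|.
  rewrite -sum1dep_card; rewrite -(pair_big_dep (fun y => y \in box V) (fun y v => v \in [set v in W | bad (setf y e v)]) (fun _ _ => 1%N)) /=.
  by apply: eq_bigr => y _; rewrite sum1_card.
have inj : {in setX S (V e) &, injective f}.
  move=> [y x] [y' x'] /=; rewrite !inE /= => _ _ [/ffunP E yy'].
  have -> : x = x' by have := E e; rewrite !ffunE eqxx.
  congr (_, _); apply/ffunP => i; have := E i; rewrite !ffunE.
  by case: eqP => [->|].
rewrite -cardsX -(card_in_imset inj).
apply: subset_leq_card; apply/subsetP => q /imsetP[[y x]].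
rewrite !inE /= => /andP[/andP[/forallP yV bady] xV] ->; rewrite /f /=.
have -> : setf (setf y e x) e (y e) = y.
  by apply/ffunP => i; rewrite !ffunE; case: eqP => [->|].
rewrite bady andbT; apply/andP; split; last by have := yV e; rewrite upd_same.
apply/forallP => i; rewrite ffunE; case: eqP => [-> //|/eqP ie].
by have := yV i; rewrite upd_other.
Qed.

(** When slot e is reopened its old entry is forgotten, so only the tuples that
    were bad before, and the few bad one-coordinate changes of the others, can be
    bad now.  The proportion of bad tuples therefore grows by z only, however
    large the new set is. *)
Lemma nbad_upd bad V e (W : {set T}) (z b : R) : V e != set0 -> 0 <= z ->
  (forall y, y \in box V -> ~~ bad y ->
     #|[set v in W | bad (setf y e v)]|%:R <= z * #|W|%:R) ->
  (nbad bad V)%:R <= b * #|box V|%:R ->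
  (nbad bad (upd V e W))%:R <= (b + z) * #|box (upd V e W)|%:R.
Proof.
move=> V0 z0 Hz Hb; have Vp : (0 : R) < #|V e|%:R by rewrite ltr0n card_gt0.
rewrite -(ler_pM2r Vp) -mulrA -[X in _ <= _ * X]natrM card_box_upd.
apply: (@le_trans _ _ (\sum_(y in box V) #|[set v in W | bad (setf y e v)]|)%:R).
  by rewrite -natrM ler_nat nbad_upd_le.
apply: (@le_trans _ _ (\sum_(y in box V) ((bad y)%:R * #|W|%:R + z * #|W|%:R))).
  rewrite natr_sum; apply: ler_sum => y yV; case: (boolP (bad y)) => by_.
    rewrite mul1r ler_wpDr ?mulr_ge0 // ler_nat subset_leq_card //.
    by apply/subsetP => v; rewrite inE => /andP[].
  by rewrite mul0r add0r Hz.
rewrite big_split /= -mulr_suml sumr_const -natr_sum.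
have -> : (\sum_(i in box V) bad i)%N = nbad bad V.
  rewrite /nbad -sum1dep_card big_mkcondr /=.
  by apply: eq_bigr => y _; case: (bad y).
rewrite natrM mulrDl -[z * _ *+ _]mulr_natr.
have := ler_wpM2r (ler0n R #|W|) Hb; rewrite -!mulrA ![#|box V|%:R * _]mulrC.
by rewrite lerD2r.
Qed.

Definition slice bad V e v := #|[set y in box V | bad y && (y e == v)]|.

Lemma sum_slice bad V e : (\sum_(v in V e) slice bad V e v)%N = nbad bad V.
Proof.
rewrite /nbad -sum1_card (partition_big (fun y : {ffun 'I_k -> T} => y e) (mem (V e))) /=.
  apply: eq_bigr => v _; rewrite sum1dep_card; apply: eq_card => y.
  by rewrite !inE -andbA.
by move=> y; rewrite inE => /andP[/boxP].
Qed.

Lemma nbad_sub bad V V' e (s : R) : (forall i, V' i \subset V i) ->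
  (forall v, v \in V' e -> (slice bad V e v)%:R <= s) ->
  (nbad bad V')%:R <= #|V' e|%:R * s.
Proof.
move=> sV Hs; rewrite -(sum_slice bad V' e) natr_sum mulr_natl -sumr_const.
apply: ler_sum => v vV; apply: le_trans (Hs v vV); rewrite ler_nat.
apply: subset_leq_card; apply/subsetP => y; rewrite !inE => /andP[/forallP yV ->].
by rewrite andbT; apply/forallP => i; apply: (subsetP (sV i)).
Qed.

Definition restr (G : rel T) V C v := fun i => if i \in C then nb G v :&: V i else V i.

Lemma sum_restr (G : rel T) V C (W : {set T}) :
  (\sum_(v in W) #|box (restr G V C v)|)%N =
  (\sum_(y in box V) #|[set v in W | [forall i in C, G v (y i)]]|)%N.
Proof.
transitivity (\sum_(v in W) \sum_(y in box V | [forall i in C, G v (y i)]) 1)%N.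
  apply: eq_bigr => v _; rewrite sum1dep_card; apply: eq_card => y.
  rewrite !inE; apply/forallP/andP => [yr|[/forallP yV /forall_inP yC] i].
    split; first by apply/forallP => i; have := yr i; rewrite /restr; case: ifP => // _; rewrite inE => /andP[].
    by apply/forall_inP => i iC; have := yr i; rewrite /restr iC !inE => /andP[].
  by rewrite /restr; case: ifP => [iC|_ //]; rewrite !inE yC //= yV.
rewrite (exchange_big_dep (mem (box V))) /=; last by move=> v y _ /andP[].
by apply: eq_bigr => y yV; rewrite sum1dep_card; apply: eq_card => v; move: yV; rewrite !inE => ->.
Qed.

Lemma card_box_split V C : #|box V| = ((\prod_(i in C) #|V i|) * (\prod_(i | i \notin C) #|V i|))%N.
Proof. by rewrite card_box (bigID (mem C)). Qed.

Lemma card_box_restr (G : rel T) V C v : #|box (restr G V C v)| =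
  ((\prod_(i in C) #|nb G v :&: V i|) * (\prod_(i | i \notin C) #|V i|))%N.
Proof.
rewrite (card_box_split _ C); congr (_ * _)%N; apply: eq_bigr => i; rewrite /restr.
  by move=> ->.
by move=> /negPf ->.
Qed.

Lemma count_above (W : {set T}) (f : T -> R) (al : R) :
  (forall v, v \in W -> 0 <= f v <= 1) -> 0 <= al ->
  \sum_(v in W) f v <= #|[set v in W | al <= f v]|%:R + al * #|W|%:R.
Proof.
move=> f01 a0.
apply: (@le_trans _ _ (\sum_(v in W) ((al <= f v)%R%:R + al))).
  apply: ler_sum => v vW; have /andP[_ f1] := f01 v vW.
  by case: (boolP (al <= f v)) => [h|]; rewrite -?ltNge => *; rewrite ?mulr1n ?mulr0n; lra.
rewrite big_split /= sumr_const mulr_natr lerD2r -natr_sum ler_nat.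
by rewrite -sum1dep_card big_mkcondr /=; apply: leq_sum => v _; case: ifP.
Qed.

Lemma markov_count (W : {set T}) (f : T -> R) (t s : R) :
  (forall v, v \in W -> 0 <= f v) -> \sum_(v in W) f v <= s ->
  #|[set v in W | t < f v]|%:R * t <= s.
Proof.
move=> f0; apply: le_trans; rewrite -sum1dep_card natr_sum mulr_suml big_mkcondr /=.
by apply: ler_sum => v vW; case: ifP => h; rewrite ?mul1r ?f0 // ltW.
Qed.

End Boxes.

(** * Rebuilding the parts of a blow-up *)

Section Closing.
Variables (R : realType) (T : finType) (G : sgraph T) (k : nat).
Variables (W : 'I_k -> {set T}) (bad : pred {ffun 'I_k -> T}).
Implicit Types (V : 'I_k -> {set T}) (C : {set 'I_k}) (b : R).

(** Stage of the construction: the slots of C are closed, their sets V i span a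
    complete multipartite graph; the other slots are open and still hold the whole
    reservoir W i.  Some tuples of the box are bad (they have too few common
    neighbours), in proportion at most b. *)
Record state C V b : Prop := State {
  st_sub : forall i, V i \subset W i;
  st_open : forall i, i \notin C -> V i = W i;
  st_compl : forall i j x z, i \in C -> j \in C -> i != j ->
    x \in V i -> z \in V j -> G x z;
  st_ne : forall i, V i != set0;
  st_bad : (nbad bad V)%:R <= b * #|box V|%:R }.

Lemma state_box_gt0 C V b : state C V b -> 0 < #|box V|%:R :> R.
Proof.
move=> s; rewrite ltr0n card_box; apply: prodn_gt0 => i.
by rewrite card_gt0 (st_ne s).
Qed.

Lemma state_prod_gt0 C C' V b : state C V b -> 0 < \prod_(i in C') #|V i|%:R :> R.
Proof. by move=> s; apply: prodr_gt0 => i _; rewrite ltr0n card_gt0 (st_ne s). Qed.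

(** The proportion of the tuples of the box whose entries in C are neighbours
    of v; by independence of the coordinates, the product of the relative degrees
    of v into the V i, which is what one stage of shrinking asks for. *)
Definition frac V C v : R := #|box (restr G V C v)|%:R / #|box V|%:R.

Lemma frac01 C C' V b v : state C V b -> 0 <= frac V C' v <= 1.
Proof.
move=> s; rewrite /frac divr_ge0 //= ler_pdivrMr ?(state_box_gt0 s) // mul1r ler_nat.
apply: subset_leq_card; apply/subsetP => y; rewrite !inE => /forallP yr.
apply/forallP => i; have := yr i; rewrite /restr; case: ifP => // _.
by rewrite inE => /andP[].
Qed.

Lemma frac_prod C C' V b v : state C V b ->
  frac V C' v * \prod_(i in C') #|V i|%:R = \prod_(i in C') #|nb G v :&: V i|%:R.
Proof.
move=> s; rewrite /frac (card_box_split V C') card_box_restr !natrM -!natr_prod.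
have p1 : ((\prod_(i in C') #|V i|)%N)%:R != 0 :> R.
  by rewrite natr_prod gt_eqF // (state_prod_gt0 _ s).
have p2 : ((\prod_(i | i \notin C') #|V i|)%N)%:R != 0 :> R.
  rewrite pnatr_eq0 -lt0n; apply: prodn_cond_gt0 => i _.
  by rewrite card_gt0 (st_ne s).
by field; apply/andP.
Qed.

(** Double counting of the pairs of a vertex v of W e and a tuple: every tuple that
    is not bad has many common neighbours. *)
Lemma sum_frac C C' V b e (al : R) : state C V b -> 0 <= al ->
  (forall y, y \in box V -> ~~ bad y ->
     al * #|W e|%:R <= #|[set v in W e | [forall i in C', G v (y i)]]|%:R) ->
  (1 - b) * (al * #|W e|%:R) <= \sum_(v in W e) frac V C' v.
Proof.
move=> s a0 Hy; rewrite /frac -mulr_suml -natr_sum sum_restr natr_sum.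
rewrite ler_pdivlMr ?(state_box_gt0 s) //.
rewrite (bigID bad) /= ler_wpDl ?sumr_ge0 //.
apply: (@le_trans _ _ (\sum_(y in box V | ~~ bad y) al * #|W e|%:R)); last first.
  by apply: ler_sum => y /andP[yV yb]; apply: Hy.
rewrite sumr_const -[X in _ <= X]mulr_natl mulrAC ler_wpM2r ?mulr_ge0 //.
have -> : #|(fun y => (y \in box V) && ~~ bad y) : pred _|%:R = #|box V|%:R - (nbad bad V)%:R :> R.
  rewrite /nbad -(cardID bad (box V)) natrD.
  have -> : #|[predI box V & bad]| = #|[set y in box V | bad y]|.
    by apply: eq_card => y; rewrite !inE.
  rewrite addrAC subrr add0r; congr (_%:R).
  by apply: eq_card => y; rewrite -!topredE /= andbC.
by have := st_bad s; lra.
Qed.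

Lemma box_ratio C V V' e (r : R) : e \notin C ->
  (forall i, i \notin C -> i != e -> V' i = V i) ->
  r * \prod_(i in C) #|V i|%:R <= \prod_(i in C) #|V' i|%:R ->
  r * #|V' e|%:R * #|box V|%:R <= #|box V'|%:R * #|V e|%:R.
Proof.
move=> eC VE le.
have split3 U : #|box U| = ((\prod_(i in C) #|U i|) * (#|U e| * \prod_(i | (i \notin C) && (i != e)) #|U i|))%N.
  by rewrite (card_box_split U C) [X in (_ * X)%N](bigD1 e).
have PE : (\prod_(i | (i \notin C) && (i != e)) #|V' i| =
           \prod_(i | (i \notin C) && (i != e)) #|V i|)%N.
  by apply: eq_bigr => i /andP[iC ie]; rewrite VE.
rewrite !split3 PE !natrM !natr_prod; set P := \prod_(i | _ && _) _.
have P0 : 0 <= P by apply: prodr_ge0.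
have := ler_wpM2l (mulr_ge0 (mulr_ge0 (ler0n R #|V' e|) (ler0n R #|V e|)) P0) le.
by congr (_ <= _); ring.
Qed.

(** The slices at the new vertices contain few bad tuples, and passing from the
    old box to a sub-box that keeps the fraction r of the product of the closed
    parts multiplies their proportion by at most 1 / r. *)
Lemma close_state C V V' b e (A r : R) : state C V b -> e \notin C ->
  (forall i, i != e -> V' i \subset V i) -> V' e \subset W e -> V' e != set0 ->
  (forall i, i \notin C -> i != e -> V' i = V i) ->
  (forall i v, i \in C -> v \in V' e -> V' i \subset nb G v) ->
  0 < r -> 0 <= A * b ->
  r * \prod_(i in C) #|V i|%:R <= \prod_(i in C) #|V' i|%:R ->
  (forall v, v \in V' e -> (slice bad V e v)%:R * #|W e|%:R <= A * b * #|box V|%:R) ->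
  state (e |: C) V' (A * b / r).
Proof.
move=> s eC V'V V'W V'e0 V'E V'n r0 Ab0 le sl.
have eW : V e = W e by rewrite (st_open s).
have sub i : V' i \subset V i.
  by case: (eqVneq i e) => [->|/V'V //]; rewrite eW.
have V'0 i : V' i != set0.
  case: (eqVneq i e) => [-> //|ie].
  case: (boolP (i \in C)) => iC; last by rewrite V'E // (st_ne s).
  apply/negP => /eqP V'i0; move: le; rewrite [X in _ <= X](bigD1 i) //= V'i0 cards0 mul0r.
  by rewrite leNgt mulr_gt0 // (state_prod_gt0 _ s).
have Wp : 0 < #|W e|%:R :> R by rewrite ltr0n card_gt0 -eW (st_ne s).
split => //.
- by move=> i; apply: subset_trans (sub i) (st_sub s i).
- move=> i; rewrite in_setU1 negb_or => /andP[ie iC].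
  by rewrite V'E // (st_open s).
- move=> i j x z; rewrite !in_setU1 => /orP[/eqP->|iC] /orP[/eqP->|jC] ij xi zj.
  + by rewrite eqxx in ij.
  + by have := subsetP (V'n j x jC xi) z zj; rewrite inE.
  + by rewrite adj_sym; have := subsetP (V'n i z iC zj) x xi; rewrite inE.
  + exact: (st_compl s iC jC ij (subsetP (sub i) _ xi) (subsetP (sub j) _ zj)).
- have sl' v : v \in V' e -> (slice bad V e v)%:R <= A * b * #|box V|%:R / #|W e|%:R.
    by move=> vV; rewrite ler_pdivlMr // sl.
  apply: le_trans (nbad_sub sub sl') _.
  have := box_ratio eC V'E le; rewrite eW => rat.
  rewrite mulrA ler_pdivrMr // mulrAC -[X in _ <= X]mulrA [X in _ <= X]mulrAC.
  rewrite ler_pdivlMr //; have := ler_wpM2l Ab0 rat; congr (_ <= _); ring.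
Qed.

Lemma slice_markov C V b e (A : R) : state C V b -> e \notin C -> 0 < A -> 0 < b ->
  #|[set v in W e | ~~ ((slice bad V e v)%:R * #|W e|%:R <= A * b * #|box V|%:R)]|%:R
    <= A^-1 * #|W e|%:R.
Proof.
move=> s eC A0 b0; have eW : V e = W e by rewrite (st_open s).
have Np := state_box_gt0 s.
have le : \sum_(v in W e) (slice bad V e v)%:R * #|W e|%:R <= b * #|box V|%:R * #|W e|%:R.
  rewrite -mulr_suml -natr_sum -eW sum_slice ler_wpM2r //; exact: st_bad s.
have := @markov_count R T (W e) (fun v => (slice bad V e v)%:R * #|W e|%:R)
   (A * b * #|box V|%:R) _ _ le.
set S := [set v in W e | _]; set S' := [set v in W e | ~~ _].
have -> : S' = S by apply/setP => v; rewrite !inE ltNge.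
move=> /(_ (fun v _ => mulr_ge0 (ler0n _ _) (ler0n _ _))) h.
have bN : 0 < b * #|box V|%:R by rewrite mulr_gt0.
rewrite ler_pdivlMl // -(ler_pM2l bN); move: h; congr (_ <= _); ring.
Qed.

Lemma filter_card (S : {set T}) (P Q : pred T) :
  (#|[set v in S | P v]| <= #|[set v in S | P v && Q v]| + #|[set v in S | ~~ Q v]|)%N.
Proof.
rewrite -(cardsID [set v | Q v] [set v in S | P v]); apply: leq_add.
  by apply: subset_leq_card; apply/subsetP => v; rewrite !inE -andbA.
by apply: subset_leq_card; apply/subsetP => v; rewrite !inE => /andP[-> /andP[->]].
Qed.

Lemma subset_of_size (S : {set T}) m : (m <= #|S|)%N -> exists2 S' : {set T}, S' \subset S & #|S'| = m.
Proof.
move=> mS; have : (0 < 'C(#|S|, m))%N by rewrite bin_gt0.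
rewrite -cards_draws card_gt0 => /set0Pn[S']; rewrite inE => /andP[S'S /eqP S'm].
by exists S'.
Qed.

Variables (c1 c A : R) (B : nat).
Hypotheses (k0 : (0 < k)%N) (c0 : 0 < c) (c1le : c1 <= 1) (A0 : 0 < A).

Lemma c1_ge0 : 0 <= 4 / A -> 4 / A <= c1 - c -> 0 <= c1.
Proof. by move: c0; lra. Qed.

(** Closing an open slot: enough v in W e have frac at least c, almost all of them
    have a slice with few bad tuples, and after shrinking, the closed parts lie in
    the neighbourhood of every vertex that is kept. *)
Lemma close_one C V b e (Q : pred T) (m : nat) :
  4 / A <= c1 - c ->
  state C V b -> e \notin C -> (forall i, i \in C -> (#|V i| <= B)%N) ->
  0 < b -> b <= A^-1 ->
  (forall y, y \in box V -> ~~ bad y ->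
     c1 * #|W e|%:R <= #|[set v in W e | [forall i in C, G v (y i)]]|%:R) ->
  #|[set v in W e | ~~ Q v]|%:R <= A^-1 * #|W e|%:R ->
  (0 < m)%N -> m%:R <= A^-1 * #|W e|%:R * rho k B c ->
  exists V', [/\ state (e |: C) V' (A * b / (c / 2)), #|V' e| = m,
    (forall v, v \in V' e -> Q v),
    [/\ forall i, i != e -> V' i \subset V i & forall i, i \notin C -> i != e -> V' i = V i] &
    c / 2 * \prod_(i in C) #|V i|%:R <= \prod_(i in C) #|V' i|%:R].
Proof.
move=> cA s eC VB b0 bA Hy HQ m0 mle.
have eW : V e = W e by rewrite (st_open s).
have Wp : 0 < #|W e|%:R :> R by rewrite ltr0n card_gt0 -eW (st_ne s).
have Ai : 0 < A^-1 by rewrite invr_gt0.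
have c1p : 0 <= c1 by apply: c1_ge0 => //; lra.
pose P1 := [pred v | c <= frac V C v].
pose P2 := [pred v | (slice bad V e v)%:R * #|W e|%:R <= A * b * #|box V|%:R].
pose X := [set v in W e | (P1 v && P2 v) && Q v].
have cP1 : 3 * A^-1 * #|W e|%:R <= #|[set v in W e | P1 v]|%:R.
  have h1 := sum_frac s c1p Hy.
  have h2 := @count_above R T (W e) (frac V C) c (fun v _ => frac01 C v s) (ltW c0).
  have h3 : (1 - b) * (c1 * #|W e|%:R) <= #|[set v in W e | P1 v]|%:R + c * #|W e|%:R.
    exact: le_trans h1 h2.
  have h4 : b * c1 <= A^-1 by rewrite -[A^-1]mulr1; apply: ler_pM => //; exact: ltW.
  have : (3 * A^-1 + b * c1) * #|W e|%:R <= (c1 - c) * #|W e|%:R.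
    by apply: ler_wpM2r => //; lra.
  by nra.
have cX : A^-1 * #|W e|%:R <= #|X|%:R.
  have h1 := filter_card (W e) P1 P2; have h2 := filter_card (W e) [predI P1 & P2] Q.
  have h3 := slice_markov s eC A0 b0.
  have := leq_add h1 h2; rewrite -(ler_nat R) !natrD.
  have -> : #|[set v in W e | [predI P1 & P2] v]| = #|[set v in W e | P1 v && P2 v]| by [].
  by rewrite -/X; move: HQ cP1 h3 => /=; lra.
have X0 : X != set0.
  rewrite -card_gt0 -(ltr0n R); apply: lt_le_trans cX; exact: mulr_gt0.
have c1' : c <= 1 by apply: le_trans c1le; rewrite -subr_ge0; apply: le_trans cA; rewrite mulr_ge0 // ltW.
have Xin v : v \in X -> [/\ v \in W e, P1 v, P2 v & Q v].
  by rewrite inE => /andP[-> /andP[/andP[-> ->] ->]].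
have [V1 [Y [[YX Y0 V1V V1E] V1n V1c Yc]]] :
  exists V' (Y : {set T}), [/\ [/\ Y \subset X, Y != set0, forall i, V' i \subset V i &
      forall i, i \notin C -> V' i = V i],
    (forall i v, i \in C -> v \in Y -> V' i \subset nb G v),
    c / 2 * \prod_(i in C) #|V i|%:R <= \prod_(i in C) #|V' i|%:R :> R &
    #|X|%:R * rho k B c <= #|Y|%:R].
  apply: shrink_stage; rewrite ?c0 ?c1' //.
    by move=> i iC; split; [apply: VB | apply: (st_ne s)].
  move=> v /Xin[_ Pv _ _]; rewrite -(frac_prod C v s) ler_wpM2r //.
  exact/ltW/(state_prod_gt0 _ s).
have rho0 : 0 <= rho k B c by rewrite /rho mulr_ge0 ?invr_ge0 ?exprn_ge0 ?expR_ge0.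
have mY : (m <= #|Y|)%N.
  rewrite -(ler_nat R); apply: le_trans mle (le_trans _ Yc).
  exact: ler_wpM2r.
have [D DY Dm] := subset_of_size mY.
have DX v : v \in D -> v \in X by move=> vD; apply/(subsetP YX)/(subsetP DY).
exists (upd V1 e D).
have ue i : i != e -> upd V1 e D i = V1 i by exact: upd_other.
have inCe i : i \in C -> i != e by move=> iC; apply: contraNneq eC => <-.
have pE : \prod_(i in C) #|upd V1 e D i|%:R = \prod_(i in C) #|V1 i|%:R :> R.
  by apply: eq_bigr => i iC; rewrite ue ?inCe.
split; rewrite ?upd_same ?pE //.
- apply: (close_state (C := C) (V := V)) => //.
  + by move=> i ie; rewrite ue.
  + by rewrite upd_same; apply/subsetP => v /DX /Xin[].
  + by rewrite upd_same -card_gt0 Dm.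
  + by move=> i iC ie; rewrite ue // V1E.
  + by move=> i v iC; rewrite upd_same ue ?inCe // => /(subsetP DY); apply: V1n.
  + by rewrite divr_gt0.
  + by rewrite mulr_ge0 // ltW.
  + by rewrite pE.
  + by move=> v; rewrite upd_same => /DX /Xin[].
- by move=> v /DX /Xin[].
- by split => [i ie|i iC ie]; rewrite ue // V1E.
Qed.

Lemma sum_nb_swap (X Y : {set T}) :
  (\sum_(v in X) #|nb G v :&: Y| = \sum_(u in Y) #|nb G u :&: X|)%N.
Proof.
transitivity (\sum_(v in X) \sum_(u in Y | G v u) 1)%N.
  by apply: eq_bigr => v _; rewrite sum1dep_card; apply: eq_card => u; rewrite !inE andbC.
rewrite (exchange_big_dep (mem Y)) /=; last by move=> v u _ /andP[].
apply: eq_bigr => u uY; rewrite sum1dep_card; apply: eq_card => v.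
by move: uY; rewrite !inE [G v u]adj_sym => ->; rewrite andbC.
Qed.

Lemma frac_setD1 C C' V b g v : state C V b -> g \in C' ->
  frac V C' v = frac V (C' :\ g) v * (#|nb G v :&: V g|%:R / #|V g|%:R).
Proof.
move=> s gC; have p := state_prod_gt0 (C' :\ g) s.
have pg : 0 < #|V g|%:R :> R by rewrite ltr0n card_gt0 (st_ne s).
apply: (mulIf (lt0r_neq0 (mulr_gt0 pg p))).
have -> : #|V g|%:R * \prod_(i in C' :\ g) #|V i|%:R = \prod_(i in C') #|V i|%:R :> R.
  by rewrite (big_setD1 g gC).
rewrite (frac_prod C' v s) (big_setD1 g gC) /= -(frac_prod (C' :\ g) v s).
rewrite (big_setD1 g gC) /=; field; exact: lt0r_neq0.
Qed.

(** A heavy pair is joined by few edges only, and W e contains few common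
    neighbours of a tuple that has an entry in W g.  So the relative degree of the
    candidates v into V g, a number of order mu, is kept apart from the other
    ones: it does not count for c, and V g is built L times too large, to be cut
    down to B common neighbours of the candidates.  The bound 2 mu on the degrees
    of V g into W e makes the average of a over W e at most 2 mu, so that the
    candidates with frac below c on the other slots cannot carry the sum. *)
Lemma close_pair C V b e g (mu mu0 : R) (L : nat) :
  state C V b -> g \in C -> e \notin C ->
  (forall i, i \in C -> i != g -> (#|V i| <= B)%N) -> #|V g| = (L * B)%N -> (0 < B)%N ->
  0 < b -> b <= 4^-1 -> 0 < mu0 -> mu0 <= mu -> 0 < c1 -> 8 * c <= c1 ->
  8 / A <= c1 * mu0 -> 2 <= c1 * mu0 / 4 * L%:R ->
  (forall y, y \in box V -> ~~ bad y ->
     c1 * mu * #|W e|%:R <= #|[set v in W e | [forall i in C, G v (y i)]]|%:R) ->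
  (forall u, u \in V g -> #|nb G u :&: W e|%:R <= 2 * mu * #|W e|%:R) ->
  B%:R * (L * B).+1%:R <= A^-1 * #|W e|%:R * rho k B c * (c1 * mu0 / 8) ^+ B ->
  exists V', [/\ state (e |: C) V' (A * b / (c / 2 / L%:R)),
    #|V' e| = B /\ #|V' g| = B,
    [/\ forall i, i != e -> V' i \subset V i & forall i, i \notin C -> i != e -> V' i = V i] &
    c / 2 * \prod_(i in C :\ g) #|V i|%:R <= \prod_(i in C :\ g) #|V' i|%:R].
Proof.
move=> s gC eC VB Vg B0 b0 b4 m0 mm c1p c8 A8 L2 Hy Hu Hnum.
have eW : V e = W e by rewrite (st_open s).
have Wp : 0 < #|W e|%:R :> R by rewrite ltr0n card_gt0 -eW (st_ne s).
have Ai : 0 < A^-1 by rewrite invr_gt0.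
have L0 : (0 < L)%N.
  by rewrite lt0n; apply/negP => /eqP L0; move: L2; rewrite L0 mulr0; lra.
have Vgp : 0 < #|V g|%:R :> R by rewrite ltr0n card_gt0 (st_ne s).
set t1 := c1 * mu0 / 4 in L2.
have t10 : 0 < t1 by rewrite /t1 !mulr_gt0.
pose a v : R := #|nb G v :&: V g|%:R / #|V g|%:R.
have a01 v : 0 <= a v <= 1.
  by rewrite /a divr_ge0 //= ler_pdivrMr // mul1r ler_nat subset_leq_card // subsetIr.
pose D := C :\ g.
pose P1 := [pred v | (c <= frac V D v) && (t1 <= a v)].
pose P2 := [pred v | (slice bad V e v)%:R * #|W e|%:R <= A * b * #|box V|%:R].
pose X := [set v in W e | P1 v && P2 v].
have sum_a : \sum_(v in W e) a v <= 2 * mu * #|W e|%:R.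
  rewrite /a -mulr_suml ler_pdivrMr // -natr_sum sum_nb_swap natr_sum.
  apply: (le_trans (ler_sum _ Hu)); by rewrite sumr_const -[X in X <= _]mulr_natr.
have cP1 : 2 * A^-1 * #|W e|%:R <= #|[set v in W e | P1 v]|%:R.
  have c1mu : 0 <= c1 * mu by rewrite mulr_ge0 ?(ltW c1p) // (le_trans (ltW m0)).
  have h1 := sum_frac s c1mu Hy.
  have h2 : \sum_(v in W e) frac V C v <=
     \sum_(v in W e) ((P1 v)%:R + c * a v + t1).
    apply: ler_sum => v _; rewrite (frac_setD1 v s gC) -/(a v) -/D /P1 /=.
    have /andP[f0 f1] := frac01 D v s; have /andP[h0 h1'] := a01 v.
    have fa : frac V D v * a v <= 1 by rewrite mulr_ile1.
    have ca : 0 <= c * a v by rewrite mulr_ge0 // ltW.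
    case: (leP c (frac V D v)) => hc; last first.
      have : frac V D v * a v <= c * a v by rewrite ler_wpM2r // ltW.
      by rewrite /= mulr0n; move: t10; lra.
    case: (leP t1 (a v)) => ht; first by rewrite /= mulr1n; move: t10; lra.
    have : frac V D v * a v <= a v by rewrite ler_piMl.
    by rewrite /= mulr0n; lra.
  have h3 := le_trans h1 h2; move: h3; rewrite !big_split /= -mulr_sumr sumr_const -natr_sum.
  have -> : (\sum_(i in W e) P1 i)%N = #|[set v in W e | P1 v]|.
    by rewrite -sum1dep_card big_mkcondr /=; apply: eq_bigr => v _; case: (P1 v).
  rewrite -[t1 *+ _]mulr_natr => h3.
  have h4 : c * \sum_(v in W e) a v <= c1 * mu / 4 * #|W e|%:R.
    apply: le_trans (ler_wpM2l (ltW c0) sum_a) _.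
    rewrite !mulrA ler_pM2r //.
    have : 8 * c * mu <= c1 * mu by rewrite ler_pM2r // (lt_le_trans m0).
    by lra.
  have h5 : t1 <= c1 * mu / 4 by rewrite /t1 ler_pM2r // ler_pM2l.
  have h6 : c1 * mu0 <= c1 * mu by rewrite ler_pM2l.
  have h7 : 3 / 4 * (c1 * mu * #|W e|%:R) <= (1 - b) * (c1 * mu * #|W e|%:R).
    by apply: ler_wpM2r; [rewrite mulr_ge0 | lra].
  have h8 : t1 * #|W e|%:R <= c1 * mu / 4 * #|W e|%:R by rewrite ler_pM2r.
  have h9 : 8 * A^-1 * #|W e|%:R <= c1 * mu * #|W e|%:R.
    by rewrite ler_pM2r //; apply: le_trans A8 h6.
  have : 2 * A^-1 * #|W e|%:R = 4^-1 * (8 * A^-1 * #|W e|%:R) by field; exact: lt0r_neq0.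
  by move=> ->; move: h3 h4 h7 h8 h9; lra.
have cX : A^-1 * #|W e|%:R <= #|X|%:R.
  have h1 := filter_card (W e) P1 P2; have h3 := slice_markov s eC A0 b0.
  by move: h1; rewrite -(ler_nat R) natrD -/X; move: cP1 h3 => /=; lra.
have X0 : X != set0.
  rewrite -card_gt0 -(ltr0n R); apply: lt_le_trans cX; exact: mulr_gt0.
have c1' : c <= 1 by move: c8 c1le c1p; lra.
have Xin v : v \in X -> [/\ v \in W e, c <= frac V D v, t1 <= a v & P2 v].
  by rewrite inE => /andP[-> /andP[/andP[-> ->] ->]].
have inD i : i \in D -> i \in C /\ i != g by rewrite !inE => /andP[].
have [V1 [Y [[YX Y0 V1V V1E] V1n V1c Yc]]] :
  exists V' (Y : {set T}), [/\ [/\ Y \subset X, Y != set0, forall i, V' i \subset V i &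
      forall i, i \notin D -> V' i = V i],
    (forall i v, i \in D -> v \in Y -> V' i \subset nb G v),
    c / 2 * \prod_(i in D) #|V i|%:R <= \prod_(i in D) #|V' i|%:R :> R &
    #|X|%:R * rho k B c <= #|Y|%:R].
  apply: shrink_stage; rewrite ?c0 ?c1' //.
    by move=> i /inD[iC ig]; split; [apply: VB | apply: (st_ne s)].
  move=> v /Xin[_ Pv _ _]; rewrite -(frac_prod D v s) ler_wpM2r //.
  exact/ltW/(state_prod_gt0 _ s).
have [av [Y1 [Y1Y Y1a Y1c Y10]]] := popular_value G (V g) Y0.
have aL : t1 * (L * B)%:R <= av%:R.
  have [v vY1] := set0Pn _ Y10; have /Xin[_ _ + _] := subsetP YX _ (subsetP Y1Y _ vY1).
  by rewrite /a Y1a // Vg ler_pdivlMr // -Vg.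
have B2 : (2 * B)%:R <= av%:R :> R.
  by apply: le_trans aL; rewrite !natrM mulrA ler_wpM2r.
have Bav : (B <= av)%N by move: B2; rewrite ler_nat => /(leq_trans _); apply; rewrite leq_pmull.
have avm : (av <= L * B)%N.
  by have [v vY1] := set0Pn _ Y10; rewrite -(Y1a v) // -Vg subset_leq_card // subsetIr.
have BLB : (B <= #|V g|)%N by rewrite Vg leq_pmull.
have [S [SV SB Sc]] := popular_subset Y1a BLB.
pose Z := [set v in Y1 | S \subset nb G v].
have Zc : (#|Y1| * (av - B) ^ B <= #|Z| * (L * B) ^ B)%N.
  have Cp : (0 < 'C(av, B))%N by rewrite bin_gt0.
  rewrite -(leq_pmul2r Cp); have := bin_ratio_small Bav avm; rewrite -Vg => hr.
  apply: (@leq_trans (#|Z| * 'C(#|V g|, B) * (av - B) ^ B)%N).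
    by rewrite mulnAC leq_mul2r Sc orbT.
  rewrite -mulnA -[X in (_ <= X)%N]mulnA leq_mul2l; apply/orP; right.
  by apply: leq_trans hr _; rewrite mulnC.
have Zc2 : #|Y1|%:R * (c1 * mu0 / 8) ^+ B <= #|Z|%:R.
  have LBp : 0 < ((L * B)%:R : R) ^+ B by rewrite exprn_gt0 // -Vg.
  rewrite -(ler_pM2r LBp) -[X in X <= _]mulrA -exprMn.
  apply: (@le_trans _ _ (#|Y1|%:R * (av - B)%:R ^+ B)); last first.
    by rewrite -!natrX -!natrM ler_nat.
  rewrite ler_wpM2l // lerXn2r ?nnegrE ?mulr_ge0 ?ler0n ?(ltW c1p) ?(ltW m0) ?invr_ge0 //.
  have -> : c1 * mu0 / 8 = t1 / 2 by rewrite /t1; field.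
  by rewrite natrB //; move: B2 aL; rewrite [(2 * B)%:R]natrM; lra.
have BZ : (B <= #|Z|)%N.
  rewrite -(ler_nat R).
  have LB1 : 0 < (L * B).+1%:R :> R by rewrite ltr0n.
  rewrite -(ler_pM2r LB1); apply: le_trans Hnum _.
  have hp : 0 <= (c1 * mu0 / 8) ^+ B by rewrite exprn_ge0 // !mulr_ge0 ?(ltW c1p) ?(ltW m0).
  have h0 : 0 <= rho k B c by rewrite /rho mulr_ge0 ?invr_ge0 ?exprn_ge0 ?expR_ge0.
  apply: (@le_trans _ _ (#|Y|%:R * (c1 * mu0 / 8) ^+ B)).
    rewrite ler_wpM2r //; apply: le_trans Yc; exact: ler_wpM2r.
  apply: le_trans (ler_wpM2r _ Zc2); last by [].
  rewrite [X in _ <= X]mulrAC ler_wpM2r // -natrM ler_nat -Vg; exact: Y1c.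
have [E EZ Em] := subset_of_size BZ.
have EY1 v : v \in E -> v \in Y1 /\ S \subset nb G v.
  by move=> /(subsetP EZ); rewrite inE => /andP[].
have EX v : v \in E -> v \in X.
  by move=> /EY1[vY _]; apply/(subsetP YX)/(subsetP Y1Y).
pose V2 := upd (upd V1 g S) e E.
have ge : g != e by apply: contraNneq eC => <-.
have V2e : V2 e = E by rewrite /V2 upd_same.
have V2g : V2 g = S by rewrite /V2 upd_other // upd_same.
have V2o i : i != e -> i != g -> V2 i = V1 i by move=> ie ig; rewrite /V2 !upd_other.
have inCe i : i \in C -> i != e by move=> iC; apply: contraNneq eC => <-.
have V2D i : i \in D -> V2 i = V1 i by move=> /inD[iC ig]; rewrite V2o ?inCe.
have pE : \prod_(i in D) #|V2 i|%:R = \prod_(i in D) #|V1 i|%:R :> R.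
  by apply: eq_bigr => i iD; rewrite V2D.
have V2V i : i != e -> V2 i \subset V i.
  by move=> ie; case: (eqVneq i g) => [->|ig]; rewrite ?V2g // V2o.
have V2E i : i \notin C -> i != e -> V2 i = V i.
  move=> iC ie; have ig : i != g by apply: contraNneq iC => ->.
  by rewrite V2o // V1E // !inE negb_and iC orbT.
have pC : c / 2 / L%:R * \prod_(i in C) #|V i|%:R <= \prod_(i in C) #|V2 i|%:R.
  rewrite !(big_setD1 g gC) /= -/D V2g SB Vg natrM pE.
  have Ln : L%:R != 0 :> R by rewrite pnatr_eq0 -lt0n.
  rewrite [X in X <= _](_ : _ = B%:R * (c / 2 * \prod_(i in D) #|V i|%:R)); last by field.
  exact: ler_wpM2l.
exists V2; split.
- apply: (close_state (C := C) (V := V)) => //.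
  + by rewrite V2e; apply/subsetP => v /EX /Xin[].
  + by rewrite V2e -card_gt0 Em.
  + move=> i v iC; rewrite V2e => vE; case: (eqVneq i g) => [->|ig].
      by rewrite V2g; case: (EY1 _ vE).
    have iD : i \in D by rewrite !inE ig.
    by rewrite V2D //; apply: V1n => //; apply: (subsetP Y1Y); case: (EY1 _ vE).
  + by rewrite !divr_gt0 ?ltr0n.
  + by rewrite mulr_ge0 // ltW.
  + by move=> v; rewrite V2e => /EX /Xin[].
- by rewrite V2e V2g.
- by split.
- by rewrite -/D pE.
Qed.

End Closing.

(** The reservoirs W carry an involution pi that pairs up the slots with a sparse
    connection; a slot e with pi e = e has no such partner.  Every tuple that is
    not bad has at least the fraction c1 of common neighbours in a light slot, and
    c1 * mu in a heavy one. *)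
Section Loop.
Variables (R : realType) (T : finType) (G : sgraph T) (k : nat).
Variables (W : 'I_k -> {set T}) (bad : pred {ffun 'I_k -> T}).
Variables (pi : 'I_k -> 'I_k) (mu : 'I_k -> R) (mu0 c1 c A zeta : R) (B L : nat).
Implicit Types (V : 'I_k -> {set T}) (C : {set 'I_k}) (b : R).

Hypotheses (k0 : (0 < k)%N) (c0 : 0 < c) (c1le : c1 <= 1) (A0 : 0 < A).
Hypotheses (cA : 4 / A <= c1 - c) (B0 : (0 < B)%N) (L0 : (0 < L)%N).
Hypotheses (z0 : 0 <= zeta) (piK : involutive pi).

Hypothesis bad_rare : forall y e, y \in box W -> ~~ bad y ->
  #|[set v in W e | bad (setf y e v)]|%:R <= zeta * #|W e|%:R.
Hypothesis light_nbrs : forall y e C, y \in box W -> ~~ bad y ->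
  e \notin C -> pi e \notin C ->
  c1 * #|W e|%:R <= #|[set v in W e | [forall i in C, G v (y i)]]|%:R.
Hypothesis heavy_nbrs : forall y e C, pi e != e -> y \in box W -> ~~ bad y ->
  e \notin C ->
  c1 * mu e * #|W e|%:R <= #|[set v in W e | [forall i in C, G v (y i)]]|%:R.
Hypothesis heavy_deg : forall e, pi e != e ->
  #|[set u in W (pi e) | ~~ (#|nb G u :&: W e|%:R <= 2 * mu e * #|W e|%:R)]|%:R
    <= A^-1 * #|W (pi e)|%:R.
Hypothesis heavy_const : forall e, pi e != e ->
  [/\ mu0 <= mu e, 0 < mu0, 8 * c <= c1, 8 / A <= c1 * mu0 & 2 <= c1 * mu0 / 4 * L%:R].
Hypothesis room_light : forall e, (L * B)%:R <= A^-1 * #|W e|%:R * rho k B c.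
Hypothesis room_heavy : forall e, pi e != e ->
  B%:R * (L * B).+1%:R <= A^-1 * #|W e|%:R * rho k B c * (c1 * mu0 / 8) ^+ B.

Notation state := (state G W bad).

Lemma state_le C V b b' : b <= b' -> state C V b -> state C V b'.
Proof.
move=> bb [s1 s2 s3 s4 s5]; split => //.
by apply: le_trans s5 _; rewrite ler_wpM2r.
Qed.

Lemma box_sub C V b y : state C V b -> y \in box V -> y \in box W.
Proof.
by move=> s /boxP yV; apply/boxP => i; apply: (subsetP (st_sub s i)).
Qed.

Lemma open_slot C V b e : state C V b -> state (C :\ e) (upd V e (W e)) (b + zeta).
Proof.
move=> s; split.
- move=> i; case: (eqVneq i e) => [->|ie]; first by rewrite upd_same.
  by rewrite upd_other //; exact: (st_sub s).
- move=> i; rewrite !inE negb_and negbK; case: (eqVneq i e) => [->|ie] /=.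
    by rewrite upd_same.
  by rewrite upd_other //; exact: (st_open s).
- move=> i j x z; rewrite !inE => /andP[ie iC] /andP[je jC] ij.
  by rewrite !upd_other //; apply: (st_compl s).
- move=> i; case: (eqVneq i e) => [->|ie]; last by rewrite upd_other //; exact: (st_ne s).
  by rewrite upd_same; apply: subset_neq0 (st_sub s e) (st_ne s e).
- apply: nbad_upd (st_ne s e) z0 _ (st_bad s) => y yV yb.
  by apply: bad_rare => //; apply: box_sub yV; exact: s.
Qed.

(** Twice tau is (c / 2)^2, the factor that the other parts may lose when a pair of
    slots is rebuilt. *)
Definition tau : R := c ^+ 2 / 8.
(** A factor by which the proportion of bad tuples may grow when a slot or a pair of
    slots is rebuilt. *)
Definition Kb : R := 3 * (2 * A / c) ^+ 2 * L%:R.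

(** An open slot counts as a part that is just too small, so that rebuilding it
    also doubles the product of the weights. *)
Definition wt C V i : R := if i \in C then #|V i|%:R else tau * B%:R.

Lemma tau_gt0 : 0 < tau. Proof. by rewrite /tau divr_gt0 ?exprn_gt0. Qed.

Lemma c_le1 : c <= 1.
Proof.
apply: le_trans c1le; rewrite -subr_ge0; apply: le_trans cA.
by rewrite mulr_ge0 // invr_ge0 ltW.
Qed.

Lemma tau_lt1 : tau < 1.
Proof. by rewrite /tau; have := c_le1; have := c0; nra. Qed.

Lemma A_ge4 : 4 <= A.
Proof.
have : 4 / A <= 1 by apply: le_trans cA _; move: c0 c1le; lra.
by rewrite ler_pdivrMr // mul1r.
Qed.

Lemma Kb_ge : 3 <= Kb /\ 3 * (2 * A / c) <= Kb.
Proof.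
have K1 : 1 <= 2 * A / c by rewrite ler_pdivlMr // mul1r; have := c_le1; have := A_ge4; lra.
have L1 : 1 <= L%:R :> R by rewrite ler1n.
have K2 : 2 * A / c <= (2 * A / c) ^+ 2 by rewrite expr2 ler_peMl //; lra.
have : (2 * A / c) ^+ 2 <= (2 * A / c) ^+ 2 * L%:R.
  by rewrite ler_peMr // exprn_ge0 //; lra.
by rewrite /Kb -mulrA; split; lra.
Qed.

Lemma wt_prod C C' V V' (E : {set 'I_k}) (r : R) :
  (forall i, i \notin E -> (i \in C') = (i \in C)) -> 0 <= r ->
  r * \prod_(i in C :\: E) #|V i|%:R <= \prod_(i in C :\: E) #|V' i|%:R ->
  r * \prod_(i | i \notin E) wt C V i <= \prod_(i | i \notin E) wt C' V' i.
Proof.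
move=> CC' r0 le; rewrite (bigID (mem C)) [X in _ <= X](bigID (mem C)) /=.
have F (U : 'I_k -> {set T}) (D : {set 'I_k}) : (forall i, i \notin E -> (i \in D) = (i \in C)) ->
    \prod_(i | (i \notin E) && (i \in C)) wt D U i = \prod_(i in C :\: E) #|U i|%:R.
  move=> DC; apply: eq_big => [i|i /andP[iE iC]]; first by rewrite !inE.
  by rewrite /wt DC ?iC.
rewrite !F // mulrA.
have -> : \prod_(i | (i \notin E) && (i \notin C)) wt C' V' i =
          \prod_(i | (i \notin E) && (i \notin C)) wt C V i.
  by apply: eq_bigr => i /andP[iE iC]; rewrite /wt CC' // (negPf iC).
apply: ler_wpM2r => //; apply: prodr_ge0 => i _; rewrite /wt.
by case: ifP => // _; rewrite mulr_ge0 // ltW // tau_gt0.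
Qed.

Lemma wt_ge0 C V i : 0 <= wt C V i.
Proof. by rewrite /wt; case: ifP => // _; rewrite mulr_ge0 // ltW // tau_gt0. Qed.

Definition beta0 : R := Order.min A^-1 4^-1.

(** The new part has size B in place of tau * B at most, and the others shrink by a
    factor c / 2 in total; tau is so small that the product of the weights still
    doubles. *)
Lemma rebuild_single C V b e : pi e = e ->
  state C V b -> (forall i, i \in C -> (#|V i| <= B)%N) -> 0 < b -> zeta <= b ->
  Kb * b <= beta0 -> (e \notin C) || (#|V e|%:R < tau * B%:R) ->
  exists C' V', [/\ state C' V' (Kb * b), (forall i, i \in C' -> (#|V' i| <= B)%N) &
    2 * \prod_i wt C V i <= \prod_i wt C' V' i].
Proof.
move=> pe s VB b0 zb Kbb small; have [K3 K3'] := Kb_ge.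
have bA : 3 * b <= A^-1.
  apply: (@le_trans _ _ (Kb * b)); first by rewrite ler_wpM2r // ltW.
  by apply: le_trans Kbb _; rewrite /beta0 ge_min lexx.
have s1 := state_le (_ : b + zeta <= 3 * b) (open_slot e s).
have {}s1 : state (C :\ e) (upd V e (W e)) (3 * b) by apply: s1; move: b0 zb; lra.
have e1 : e \notin C :\ e by rewrite !inE eqxx.
have V1B i : i \in C :\ e -> (#|upd V e (W e) i| <= B)%N.
  by rewrite !inE => /andP[ie iC]; rewrite upd_other // VB.
have b3 : 0 < 3 * b by rewrite mulr_gt0.
have Bm : B%:R <= A^-1 * #|W e|%:R * rho k B c.
  by apply: le_trans (room_light e); rewrite ler_nat leq_pmull.
have Hy y : y \in box (upd V e (W e)) -> ~~ bad y ->
     c1 * #|W e|%:R <= #|[set v in W e | [forall i in C :\ e, G v (y i)]]|%:R.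
  by move=> yV yb; apply: light_nbrs; rewrite ?pe // (box_sub s1).
have HQ : #|[set v in W e | ~~ xpredT v]|%:R <= A^-1 * #|W e|%:R.
  rewrite (_ : [set v in W e | _] = set0) ?cards0 ?mulr_ge0 ?invr_ge0 ?(ltW A0) //.
  by apply/setP => v; rewrite !inE andbF.
have [V' [s' V'e _ [V'V V'E] V'p]] :=
  close_one k0 c0 c1le A0 cA s1 e1 V1B b3 bA Hy HQ B0 Bm.
exists (e |: C :\ e), V'; split.
- apply: state_le s'; have -> : A * (3 * b) / (c / 2) = 3 * (2 * A / c) * b.
    by field; exact: lt0r_neq0.
  by rewrite ler_wpM2r // ltW.
- move=> i; rewrite in_setU1 => /orP[/eqP->|iC]; first by rewrite V'e.
  apply: leq_trans (V1B i iC); apply: subset_leq_card; apply: V'V.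
  by apply: contraTneq iC => ->; rewrite !inE eqxx.
- have p : c / 2 * \prod_(i in C :\: [set e]) #|V i|%:R <= \prod_(i in C :\: [set e]) #|V' i|%:R :> R.
    apply: le_trans V'p; rewrite le_eqVlt; apply/orP; left; apply/eqP; congr (_ * _).
    by apply: eq_bigr => i; rewrite !inE => /andP[ie _]; rewrite upd_other.
  have CC' i : i \notin [set e] -> (i \in e |: C :\ e) = (i \in C).
    by rewrite !inE => /negPf->.
  have c2 : 0 <= c / 2 by move: c0; lra.
  have := wt_prod CC' c2 p; set P := \prod_(i | _) wt C V i; set P' := \prod_(i | _) wt _ V' i.
  move=> PP'.
  have P0 : 0 <= P by apply: prodr_ge0 => i _; exact: wt_ge0.
  have E (w : 'I_k -> R) : \prod_i w i = w e * \prod_(i | i \notin [set e]) w i.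
    by rewrite (bigD1 e) //=; congr (_ * _); apply: eq_bigl => i; rewrite inE.
  rewrite !E -/P -/P'.
  have we : wt C V e <= tau * B%:R.
    by rewrite /wt; case: ifP small => [_ /= /ltW|].
  have we' : wt (e |: C :\ e) V' e = B%:R by rewrite /wt in_setU1 eqxx V'e.
  rewrite we'.
  have h1 : 2 * (wt C V e * P) <= 2 * (tau * B%:R * P).
    by rewrite ler_pM2l // ler_wpM2r.
  apply: le_trans h1 _; apply: le_trans (ler_wpM2l (ler0n _ _) PP').
  rewrite [X in X <= _](_ : _ = (2 * tau) * (B%:R * P)); last by ring.
  rewrite [X in _ <= X](_ : _ = (c / 2) * (B%:R * P)); last by ring.
  rewrite ler_wpM2r ?mulr_ge0 //; rewrite /tau; have := c_le1; have := c0; nra.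
Qed.

(** Both slots of a heavy pair are reopened.  Slot g = pi e is closed first and
    slot e second, so that V g can be chosen with small degrees into W e and
    L times too large. *)
Lemma rebuild_pair C V b e : pi e != e ->
  state C V b -> (forall i, i \in C -> (#|V i| <= B)%N) -> 0 < b -> zeta <= b ->
  Kb * b <= beta0 -> (e \notin C) || (#|V e|%:R < tau * B%:R) ->
  exists C' V', [/\ state C' V' (Kb * b), (forall i, i \in C' -> (#|V' i| <= B)%N) &
    2 * \prod_i wt C V i <= \prod_i wt C' V' i].
Proof.
move=> pe s VB b0 zb Kbb small; have [K3 K3'] := Kb_ge; set g := pi e in pe.
have [mm m0 c8 A8 L2] := heavy_const pe.
have pg : pi g = e by rewrite /g piK.
have bK x : x <= Kb -> x * b <= A^-1 /\ x * b <= 4^-1.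
  move=> xK; have : x * b <= Kb * b by rewrite ler_wpM2r // ltW.
  by move=> /le_trans /(_ Kbb); rewrite /beta0 le_min => /andP[].
have [bA b4] := bK _ K3; have [bA' b4'] := bK _ K3'.
have s1 := open_slot g (open_slot e s).
set V1 := upd (upd V e (W e)) g (W g) in s1; set C1 := C :\ e :\ g in s1.
have {}s1 : state C1 V1 (3 * b) by apply: state_le s1; move: b0 zb; lra.
have g1 : g \notin C1 by rewrite !inE eqxx.
have e1 : e \notin C1 by rewrite !inE eqxx andbF.
have inC1 i : i \in C1 -> [/\ i != e, i != g & i \in C].
  by rewrite !inE => /andP[-> /andP[-> ->]].
have V1o i : i \in C1 -> V1 i = V i by move=> /inC1[ie ig _]; rewrite /V1 !upd_other.
have V1B i : i \in C1 -> (#|V1 i| <= B)%N.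
  by move=> iC; rewrite V1o // VB //; case: (inC1 _ iC).
have b3 : 0 < 3 * b by rewrite mulr_gt0.
have Hy y : y \in box V1 -> ~~ bad y ->
     c1 * #|W g|%:R <= #|[set v in W g | [forall i in C1, G v (y i)]]|%:R.
  by move=> yV yb; apply: light_nbrs; rewrite ?pg // (box_sub s1).
have LB0 : (0 < L * B)%N by rewrite muln_gt0 L0.
have [V2 [s2 V2g V2Q [V2V V2E] V2p]] :=
  close_one (Q := [pred u | #|nb G u :&: W e|%:R <= 2 * mu e * #|W e|%:R])
    k0 c0 c1le A0 cA s1 g1 V1B b3 bA Hy (heavy_deg pe) LB0 (room_light g).
have b2E : A * (3 * b) / (c / 2) = 3 * (2 * A / c) * b.
  by field; exact: lt0r_neq0.
rewrite b2E in s2; set b2 := 3 * (2 * A / c) * b in s2.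
have b20 : 0 < b2 by rewrite /b2 !mulr_gt0 ?invr_gt0.
have gC2 : g \in g |: C1 by rewrite setU11.
have eC2 : e \notin g |: C1 by rewrite in_setU1 negb_or e1 eq_sym pe.
have V2B i : i \in g |: C1 -> i != g -> (#|V2 i| <= B)%N.
  rewrite in_setU1 => /orP[/eqP->|iC ig]; first by rewrite eqxx.
  by apply: leq_trans (V1B i iC); apply: subset_leq_card; apply: V2V.
have Hy2 y : y \in box V2 -> ~~ bad y ->
   c1 * mu e * #|W e|%:R <= #|[set v in W e | [forall i in g |: C1, G v (y i)]]|%:R.
  by move=> yV yb; apply: heavy_nbrs; rewrite ?(box_sub s2).
have c1p : 0 < c1 by move: c8 c0; lra.
have [V3 [s3 [V3e V3g] [V3V V3E] V3p]] :=
  close_pair k0 c0 c1le A0 s2 gC2 eC2 V2B V2g B0 b20 b4' m0 mm c1p c8 A8 L2 Hy2 V2Q (room_heavy pe).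
have D1 : (g |: C1) :\ g = C1 by rewrite setU1K.
rewrite D1 in V3p.
exists (e |: (g |: C1)), V3; split.
- apply: state_le s3; rewrite /b2 /Kb le_eqVlt; apply/orP; left; apply/eqP; field.
  by rewrite lt0r_neq0 //= pnatr_eq0 -lt0n.
- move=> i; rewrite in_setU1 => /orP[/eqP->|iC]; first by rewrite V3e.
  case: (eqVneq i g) => [->|ig]; first by rewrite V3g.
  apply: leq_trans (V2B i iC ig); apply: subset_leq_card; apply: V3V.
  by apply: contraNneq eC2 => <-.
- pose E := [set e; g].
  have CE : C :\: E = C1 by apply/setP => i; rewrite !inE negb_or; case: (i == e); case: (i == g).
  have p : (c / 2) ^+ 2 * \prod_(i in C :\: E) #|V i|%:R <= \prod_(i in C :\: E) #|V3 i|%:R :> R.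
    rewrite CE; apply: le_trans V3p; rewrite expr2 -mulrA ler_wpM2l ?divr_ge0 ?(ltW c0) //.
    apply: le_trans V2p; rewrite ler_wpM2l ?divr_ge0 ?(ltW c0) //.
    rewrite le_eqVlt; apply/orP; left; apply/eqP.
    by apply: eq_bigr => i iC; rewrite V1o.
  have CC' i : i \notin E -> (i \in e |: (g |: C1)) = (i \in C).
    by rewrite !inE negb_or => /andP[/negPf-> /negPf->].
  have c2 : 0 <= (c / 2) ^+ 2 by rewrite exprn_ge0 // divr_ge0 // ltW.
  have := wt_prod CC' c2 p; set P := \prod_(i | _) wt C V i; set P' := \prod_(i | _) wt _ V3 i.
  move=> PP'.
  have P0 : 0 <= P by apply: prodr_ge0 => i _; exact: wt_ge0.
  have EE (w : 'I_k -> R) : \prod_i w i = w e * w g * \prod_(i | i \notin E) w i.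
    rewrite (bigD1 e) //= (bigD1 g) //= mulrA; congr (_ * _); apply: eq_bigl => i.
    by rewrite !inE negb_or.
  rewrite !EE -/P -/P'.
  have we : wt C V e <= tau * B%:R.
    by rewrite /wt; case: ifP small => [_ /= /ltW|].
  have wg : wt C V g <= B%:R.
    rewrite /wt; case: ifP => gC; first by rewrite ler_nat VB.
    by rewrite ler_piMl // ltW // tau_lt1.
  have -> : wt (e |: (g |: C1)) V3 e = B%:R by rewrite /wt in_setU1 eqxx V3e.
  have -> : wt (e |: (g |: C1)) V3 g = B%:R by rewrite /wt !in_setU1 eqxx orbT V3g.
  have h0 : wt C V e * wt C V g <= tau * B%:R * B%:R.
    by apply: ler_pM; rewrite ?wt_ge0.
  have h1 : 2 * (wt C V e * wt C V g * P) <= 2 * (tau * B%:R * B%:R * P).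
    by rewrite ler_pM2l // ler_wpM2r.
  apply: le_trans h1 _.
  apply: le_trans (ler_wpM2l (mulr_ge0 (ler0n _ _) (ler0n _ _)) PP').
  rewrite [X in X <= _](_ : _ = (2 * tau) * (B%:R * B%:R * P)); last by ring.
  rewrite [X in _ <= X](_ : _ = (c / 2) ^+ 2 * (B%:R * B%:R * P)); last by ring.
  rewrite ler_wpM2r ?mulr_ge0 //; rewrite /tau; have := c0; nra.
Qed.

(** As long as some part is smaller than tau * B it can be rebuilt.  The product of
    the weights doubles each time and never exceeds B ^ k, so the process stops
    after j rounds at the latest; the proportion of bad tuples grows by a constant
    factor per round, and j depends on k and c only. *)
Lemma rebuild_loop j C V b :
  state C V b -> (forall i, i \in C -> (#|V i| <= B)%N) -> 0 < b -> zeta <= b ->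
  Kb ^+ j * b <= beta0 -> B%:R ^+ k <= 2 ^+ j * \prod_i wt C V i ->
  exists V' : 'I_k -> {set T}, (forall i, tau * B%:R <= #|V' i|%:R) /\
    (forall i j x z, i != j -> x \in V' i -> z \in V' j -> G x z).
Proof.
have [K3 _] := Kb_ge.
elim: j C V b => [|j IH] C V b s VB b0 zb Kbb pot.
  all: case: (boolP [forall i, (i \in C) && (tau * B%:R <= #|V i|%:R)]) => [/forallP fin|].
  1,3: exists V; split => [i|i i' x z ii']; first by case/andP: (fin i).
  1,2: by apply: (st_compl s) => //; [case/andP: (fin i) | case/andP: (fin i')].
all: rewrite negb_forall => /existsP[e]; rewrite negb_and -ltNge => small.
  exfalso; move: pot; rewrite expr0 mul1r leNgt => /negP; apply.
  have BR : 0 < B%:R :> R by rewrite ltr0n.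
  rewrite -[k in _ ^+ k]card_ord -prodr_const (bigD1 e) //= [X in _ < X](bigD1 e) //=.
  have we : wt C V e < B%:R.
    have tB : tau * B%:R < B%:R by rewrite gtr_pMl // tau_lt1.
    rewrite /wt; case: ifP small => [_ /= h|//]; exact: lt_trans h tB.
  apply: (@le_lt_trans _ _ (wt C V e * \prod_(i < k | i != e) B%:R)).
    rewrite ler_wpM2l ?wt_ge0 //; apply: ler_prod => i _; rewrite wt_ge0 /= /wt.
    case: ifP => iC; first by rewrite ler_nat VB.
    by rewrite ler_piMl // ltW // tau_lt1.
  by rewrite ltr_pM2r // prodr_gt0.
have K1 : 1 <= Kb ^+ j by apply: exprn_ege1; move: K3; lra.
have Kb1 : Kb * b <= beta0.
  apply: le_trans Kbb; rewrite exprS -mulrA [Kb ^+ j * b]mulrC mulrA ler_peMr //.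
  by rewrite mulr_ge0 // ?(ltW b0) //; move: K3; lra.
have [C' [V' [s' VB' pot']]] : exists C' V', [/\ state C' V' (Kb * b),
    (forall i, i \in C' -> (#|V' i| <= B)%N) &
    2 * \prod_i wt C V i <= \prod_i wt C' V' i].
  by case: (eqVneq (pi e) e) => pe; [apply: (rebuild_single pe s) | apply: (rebuild_pair pe s)].
apply: (IH C' V' (Kb * b)) => //.
- by rewrite mulr_gt0 //; move: K3; lra.
- by apply: le_trans zb _; rewrite ler_peMl ?(ltW b0) //; move: K3; lra.
- by rewrite mulrA -exprSr.
- apply: le_trans pot _; rewrite exprSr -mulrA ler_wpM2l ?exprn_ge0 //.
Qed.

Lemma blowup_of_box (M : nat) (b : R) :
  (forall i, W i != set0) -> (nbad bad W)%:R <= b * #|box W|%:R ->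
  0 < b -> zeta <= b -> Kb ^+ M * b <= beta0 -> 1 <= 2 ^+ M * tau ^+ k ->
  exists V : 'I_k -> {set T}, (forall i, tau * B%:R <= #|V i|%:R) /\
    (forall i j x z, i != j -> x \in V i -> z \in V j -> G x z).
Proof.
move=> W0 Wb b0 zb Kbb MM.
have s : state finset.set0 W b by split => // i j x z; rewrite inE.
apply: (rebuild_loop s) Kbb _ => //; first by move=> i; rewrite inE.
rewrite (eq_bigr (fun=> tau * B%:R)); last by move=> i _; rewrite /wt inE.
rewrite prodr_const card_ord exprMn mulrA ler_peMl //.
Qed.

End Loop.

(** * Minimisers of density minus entropy *)

Section Density.
Variables (R : realType) (T : finType) (G : sgraph T).
Implicit Types (X Y Z S : {set T}).

(** Ordered pairs of non-adjacent vertices; for X = Y the diagonal is included. *)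
Definition coedges X Y := (\sum_(x in X) \sum_(y in Y) ~~ G x y)%N.

Definition codeg Y x := (\sum_(y in Y) ~~ G x y)%N.

Lemma coedgesC X Y : coedges X Y = coedges Y X.
Proof.
rewrite /coedges exchange_big; apply: eq_bigr => y _; apply: eq_bigr => x _.
by rewrite adj_sym.
Qed.

Lemma codegE Y x : codeg Y x = #|[set y in Y | ~~ G x y]|.
Proof.
by rewrite -sum1dep_card big_mkcondr /=; apply: eq_bigr => y _; case: (G x y).
Qed.

Lemma codeg_nb Y x : (codeg Y x + #|nb G x :&: Y| = #|Y|)%N.
Proof.
rewrite codegE -(cardsID (nb G x) Y) addnC; congr (_ + _)%N.
  by rewrite setIC.
by apply: eq_card => y; rewrite !inE andbC.
Qed.

Lemma coedges_le X Y : (coedges X Y <= #|X| * #|Y|)%N.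
Proof.
rewrite -sum_nat_const; apply: leq_sum => x _; rewrite -/(codeg Y x).
by rewrite -(codeg_nb Y x) leq_addr.
Qed.

Lemma coedgesD1 S v : v \in S ->
  (coedges S S + 1 = coedges (S :\ v) (S :\ v) + 2 * codeg S v)%N.
Proof.
move=> vS; rewrite {1}/coedges (big_setD1 v vS) /= -/(codeg S v).
have -> : (\sum_(x in S :\ v) \sum_(y in S) ~~ G x y =
   codeg (S :\ v) v + coedges (S :\ v) (S :\ v))%N.
  rewrite /codeg /coedges -big_split /=; apply: eq_bigr => x _.
  by rewrite (big_setD1 v vS) /= adj_sym.
have -> : codeg S v = (1 + codeg (S :\ v) v)%N.
  by rewrite /codeg (big_setD1 v vS) /= adj_irr.
by lia.
Qed.

Lemma ln_nat_le (m n : nat) : (0 < m)%N -> (m <= n)%N -> ln m%:R <= ln n%:R :> R.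
Proof.
move=> m0 mn; rewrite ler_ln ?posrE ?ltr0n ?ler_nat //; exact: leq_trans mn.
Qed.

(** Minimising the co-edge density minus a small multiple of the entropy ln |S|
    costs only a constant factor of the vertices, and at a minimiser no vertex
    can be removed with profit. *)
Lemma regular_core (kap q : R) : 0 < kap -> kap <= 2^-1 -> 0 <= q <= 1 ->
  (0 < #|T|)%N -> (coedges [set: T] [set: T])%:R <= q * #|T|%:R ^+ 2 ->
  1 <= kap * (#|T|%:R * expR (- kap^-1)) ->
  exists S : {set T}, #|T|%:R * expR (- kap^-1) <= #|S|%:R /\
    forall v, v \in S -> (codeg S v)%:R <= (q + kap) * #|S|%:R.
Proof.
move=> k0 k2 /andP[q0 q1] T0 dens big.
pose F (S : {set T}) : R := (coedges S S)%:R / #|S|%:R ^+ 2 - kap * ln #|S|%:R.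
have TP : [pred S : {set T} | S != set0] [set: T] by rewrite /= -card_gt0 cardsT.
have := @arg_minP _ R _ [set: T] [pred S : {set T} | S != set0] F TP.
case=> S /= S0 Smin.
have n0 : 0 < #|T|%:R :> R by rewrite ltr0n.
pose s : R := #|S|%:R.
have s0 : 0 < s by rewrite /s ltr0n card_gt0.
have FT : F S <= q - kap * ln #|T|%:R.
  apply: le_trans (Smin _ TP) _; rewrite /F cardsT lerD2r ler_pdivrMr ?exprn_gt0 //.
have sn : ln s <= ln #|T|%:R :> R by apply: ln_nat_le; rewrite ?card_gt0 // max_card.
set m : R := (coedges S S)%:R / s ^+ 2.
have m0 : 0 <= m by rewrite divr_ge0 // exprn_ge0.
have FS : F S = m - kap * ln s by [].
(* |S| <= |T|, so the entropy term only helps. *)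
have mq : m <= q.
  have : kap * ln s <= kap * ln #|T|%:R by rewrite ler_pM2l.
  by move: FT; rewrite FS; lra.
have Sbig : #|T|%:R * expR (- kap^-1) <= s.
  rewrite -[#|T|%:R]lnK ?posrE // -expRD -[s]lnK ?posrE // ler_expR.
  have : kap * (ln #|T|%:R - ln s) <= 1 by move: FT; rewrite FS mulrBr; lra.
  by rewrite mulrC -ler_pdivlMr // div1r; lra.
exists S; split => // v vS.
have ks : 1 <= kap * s by apply: le_trans big _; rewrite ler_pM2l.
have s2 : 2 <= s.
  have : kap * s <= 2^-1 * s by rewrite ler_pM2r.
  by lra.
have cS : #|S :\ v|%:R = s - 1 :> R.
  by rewrite /s (cardsD1 v S) vS natrD addrC addKr.
have Sv0 : S :\ v != set0 by rewrite -card_gt0 -(ltr0n R) cS; lra.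
have := Smin _ Sv0; rewrite FS /F cS.
set m' := (coedges (S :\ v) (S :\ v))%:R => le.
have mE : m * s ^+ 2 = (coedges S S)%:R by rewrite /m divfK // expf_neq0 // lt0r_neq0.
have eqd : m * s ^+ 2 + 1 = m' + 2 * (codeg S v)%:R.
  by rewrite mE -[1]/1%:R -natrM -!natrD (coedgesD1 vS).
have s10 : 0 < s - 1 by lra.
have lnle : ln s - ln (s - 1) <= (s - 1)^-1.
  rewrite -ln_div ?posrE //; have -> : s / (s - 1) = 1 + (s - 1)^-1 by field; lra.
  by apply: le_ln1Dx; apply: lt_le_trans (ltrN10 _) _; rewrite invr_ge0 ltW.
have le2 : m * (s - 1) ^+ 2 <= m' + kap * (s - 1).
  have h : m <= m' / (s - 1) ^+ 2 + kap * (s - 1)^-1.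
    have : kap * (ln s - ln (s - 1)) <= kap * (s - 1)^-1 by rewrite ler_pM2l.
    by rewrite mulrBr; move: le; lra.
  have := ler_wpM2r (exprn_ge0 2 (ltW s10)) h.
  rewrite mulrDl divfK; last by rewrite expf_neq0 // lt0r_neq0.
  suff -> : kap / (s - 1) * (s - 1) ^+ 2 = kap * (s - 1) by [].
  by field; exact: lt0r_neq0.
have ms : m * s <= q * s by rewrite ler_pM2r.
by move: le2 eqd; rewrite !expr2; lra.
Qed.

End Density.

(** * Regular tuples of vertex sets *)

Section Regular.
Variables (R : realType) (T : finType) (G : sgraph T) (k : nat) (lam kap : R).
Hypotheses (lam0 : 0 < lam) (lam1 : lam <= 1) (kap0 : 0 < kap).
Implicit Types (V : 'I_k -> {set T}) (X Y Z S : {set T}).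

Definition dens X Y : R := (coedges G X Y)%:R / (#|X|%:R * #|Y|%:R).

Lemma densC X Y : dens X Y = dens Y X.
Proof. by rewrite /dens coedgesC mulrC [X in _ = X]mulrC [_%:R * _]mulrC. Qed.

Lemma dens01 X Y : 0 <= dens X Y <= 1.
Proof.
rewrite /dens divr_ge0 ?mulr_ge0 //= -natrM.
have [->|h] := posnP (#|X| * #|Y|)%N; first by rewrite invr0 mulr0 ler01.
by rewrite ler_pdivrMr ?ltr0n // mul1r ler_nat coedges_le.
Qed.

Lemma dens_split X Y Z : Y \subset X -> X != set0 ->
  #|Y|%:R / #|X|%:R * dens Y Z + #|X :\: Y|%:R / #|X|%:R * dens (X :\: Y) Z = dens X Z.
Proof.
move=> YX X0; have Xp : #|X|%:R != 0 :> R by rewrite pnatr_eq0 cards_eq0.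
have E (U : {set T}) : #|U|%:R / #|X|%:R * dens U Z = (coedges G U Z)%:R / (#|X|%:R * #|Z|%:R).
  have [U0|U0] := eqVneq U set0.
    by rewrite U0 cards0 !mul0r /coedges big_set0 mul0r.
  have Up : #|U|%:R != 0 :> R by rewrite pnatr_eq0 cards_eq0.
  rewrite /dens; have [->|Zp] := eqVneq (#|Z|%:R : R) 0; first by rewrite !mulr0 invr0 !mulr0.
  by field; rewrite Xp Up Zp.
rewrite !E -mulrDl -natrD /dens; congr (_%:R / _).
by rewrite /coedges [in RHS](big_setID Y) /= (setIidPr YX).
Qed.

(** A slightly concave functional of the density: splitting a set can only
    decrease its average, and decreases it in proportion to the variance. *)
Definition pot (x : R) : R := x - lam * x ^+ 2.

Lemma pot_bounds x : 0 <= x <= 1 -> 0 <= pot x <= 1 /\ x - lam <= pot x <= x.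
Proof.
move=> /andP[x0 x1]; rewrite /pot.
have h0 : 0 <= lam * x ^+ 2 by rewrite mulr_ge0 ?exprn_ge0 // ltW.
have h1 : lam * x ^+ 2 <= lam by rewrite ler_piMr ?(ltW lam0) // exprn_ile1.
have h2 : lam * x ^+ 2 <= x.
  apply: (@le_trans _ _ (1 * x ^+ 2)); first by rewrite ler_wpM2r ?exprn_ge0.
  by rewrite mul1r expr2 ler_piMr.
by split; apply/andP; split; lra.
Qed.

(** The term - kap ln |V p| prevents a minimiser from being small, and dominates
    the cost of restricting a set to a part of it. *)
Definition energy V : R :=
  \sum_p \sum_(q | q != p) pot (dens (V p) (V q)) - kap * \sum_p ln #|V p|%:R.

Definition rest (i : 'I_k) V : R :=
  \sum_(p | p != i) \sum_(q | (q != p) && (q != i)) pot (dens (V p) (V q))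
  - kap * \sum_(p | p != i) ln #|V p|%:R.

Lemma energy_rest i V : energy V =
  2 * \sum_(j | j != i) pot (dens (V i) (V j)) - kap * ln #|V i|%:R + rest i V.
Proof.
rewrite /energy /rest (bigD1 i) //= [X in _ - kap * X](bigD1 i) //=.
have -> : \sum_(p < k | p != i) \sum_(q < k | q != p) pot (dens (V p) (V q)) =
  \sum_(p | p != i) pot (dens (V i) (V p)) +
  \sum_(p | p != i) \sum_(q | (q != p) && (q != i)) pot (dens (V p) (V q)).
  rewrite -big_split /=; apply: eq_bigr => p pi.
  by rewrite (bigD1 i) 1?eq_sym //= densC.
by ring.
Qed.

Lemma rest_upd i V Z : rest i (upd V i Z) = rest i V.
Proof.
rewrite /rest; congr (_ - kap * _); last by apply: eq_bigr => p pi; rewrite upd_other.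
apply: eq_bigr => p pi; apply: eq_bigr => q /andP[_ qi]; by rewrite !upd_other.
Qed.

Lemma energy_upd i V Z : energy (upd V i Z) =
  2 * \sum_(j | j != i) pot (dens Z (V j)) - kap * ln #|Z|%:R + rest i V.
Proof.
rewrite (energy_rest i) rest_upd upd_same; congr (2 * _ - _ + _).
by apply: eq_bigr => j ji; rewrite upd_other.
Qed.

Lemma xlnx_ge (a : R) : 0 < a -> -1 <= a * ln a.
Proof.
move=> a0; have ai : 0 < a^-1 by rewrite invr_gt0.
have a1 : -1 < a^-1 - 1 by lra.
have := le_ln1Dx a1; rewrite addrC subrK lnV ?posrE //.
by move=> h'; have := ler_wpM2l (ltW a0) h'; rewrite mulrBr divff ?lt0r_neq0 // mulrN; lra.
Qed.

Lemma pot_split (a a' x x' : R) : 0 <= a -> 0 <= a' -> a + a' = 1 ->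
  a * pot x + a' * pot x' <= pot (a * x + a' * x') - lam * a * (x - (a * x + a' * x')) ^+ 2.
Proof.
move=> a0 a1 aa; set d := a * x + a' * x'.
have -> : a * pot x + a' * pot x' = pot d - lam * a * (x - d) ^+ 2 - lam * a' * (x' - d) ^+ 2.
  have -> : a' = 1 - a by lra.
  have -> : d = a * x + (1 - a) * x' by rewrite /d; have -> : a' = 1 - a by lra.
  by rewrite /pot; ring.
have : 0 <= lam * a' * (x' - d) ^+ 2.
  by rewrite mulr_ge0 ?sqr_ge0 // mulr_ge0 // ltW.
by lra.
Qed.

(** Average the energy over the two halves Y and V i minus Y, weighted by their
    sizes.  Linear terms are unchanged, the concave part of pot gains the variance
    of the density towards V e, and the entropy loses at most 2 kap because
    a ln a >= -1.  The other half is bounded below by m0. *)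
Lemma split_one V i e Y (m0 : R) : (forall j, V j != set0) -> Y \subset V i -> Y != set0 ->
  e != i -> (forall Z, Z \subset V i -> Z != set0 -> m0 <= energy (upd V i Z)) ->
  #|Y|%:R / #|V i|%:R * (energy (upd V i Y) - m0) <=
  energy V - m0 + 2 * kap
  - 2 * lam * (#|Y|%:R / #|V i|%:R) * (dens Y (V e) - dens (V i) (V e)) ^+ 2.
Proof.
move=> V0 YV Y0 ei Hm.
have vp : 0 < #|V i|%:R :> R by rewrite ltr0n card_gt0.
have yp : 0 < #|Y|%:R :> R by rewrite ltr0n card_gt0.
have [Y'0|Y'0] := eqVneq (V i :\: Y) set0.
  have YE : Y = V i by apply/eqP; rewrite eqEsubset YV -setD_eq0 Y'0 eqxx.
  have -> : energy (upd V i Y) = energy V by rewrite energy_upd YE -energy_rest.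
  rewrite YE divff ?lt0r_neq0 // subrr expr2 !mulr0 mul1r; move: kap0; lra.
set Y' := V i :\: Y in Y'0; set a := #|Y|%:R / #|V i|%:R; pose a' : R := #|Y'|%:R / #|V i|%:R.
have yp' : 0 < #|Y'|%:R :> R by rewrite ltr0n card_gt0.
have a0 : 0 < a by rewrite divr_gt0.
have a'0 : 0 < a' by rewrite divr_gt0.
have aa : a + a' = 1.
  rewrite /a /a' -mulrDl -natrD -(setIidPr YV) -/Y'.
  by rewrite (setIidPr YV) -[in (_ + _)%N](setIidPr YV) cardsID divff // lt0r_neq0.
have := Hm Y' (subsetDl _ _) Y'0; set x' := energy (upd V i Y') => Hx'.
set x := energy (upd V i Y).
suff : a * x + a' * x' <= energy V + 2 * kap
   - 2 * lam * a * (dens Y (V e) - dens (V i) (V e)) ^+ 2.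
  have : a' * m0 <= a' * x' by rewrite ler_pM2l.
  have -> : a' = 1 - a by move: aa; lra.
  by move=> h1 h2; rewrite mulrBr; lra.
rewrite /x /x' !energy_upd (energy_rest i V).
pose D := \sum_(j | j != i) pot (dens (V i) (V j)).
have h1 : a * (\sum_(j | j != i) pot (dens Y (V j))) +
   a' * (\sum_(j | j != i) pot (dens Y' (V j))) <=
   D - lam * a * (dens Y (V e) - dens (V i) (V e)) ^+ 2.
  rewrite !mulr_sumr -big_split /= (bigD1 e) //= /D [X in _ <= X - _](bigD1 e) //=.
  have t j : a * pot (dens Y (V j)) + a' * pot (dens Y' (V j)) <=
      pot (dens (V i) (V j)) - lam * a * (dens Y (V j) - dens (V i) (V j)) ^+ 2.
    have := pot_split (dens Y (V j)) (dens Y' (V j)) (ltW a0) (ltW a'0) aa.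
    by rewrite /a /a' dens_split.
  have t' j : a * pot (dens Y (V j)) + a' * pot (dens Y' (V j)) <= pot (dens (V i) (V j)).
    by apply: le_trans (t j) _; rewrite gerBl mulr_ge0 ?sqr_ge0 // mulr_ge0 // ltW.
  by rewrite [X in _ <= X]addrAC; apply: lerD; [exact: t | apply: ler_sum => j _; exact: t'].
have lnE (U : {set T}) : U != set0 -> ln #|U|%:R = ln (#|U|%:R / #|V i|%:R) + ln #|V i|%:R :> R.
  by move=> U0; rewrite ln_div ?posrE ?ltr0n ?card_gt0 // subrK.
rewrite (lnE Y Y0) (lnE Y' Y'0) -/a -/a' -/D.
set l := ln #|V i|%:R; set s := \sum_(j | _) _ in h1 *; set s' := \sum_(j | _) _ in h1 *.
have l1 := ler_wpM2l (ltW kap0) (xlnx_ge a0); have l2 := ler_wpM2l (ltW kap0) (xlnx_ge a'0).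
have -> : a * (2 * s - kap * (ln a + l) + rest i V) + a' * (2 * s' - kap * (ln a' + l) + rest i V) =
   2 * (a * s + a' * s') - kap * (a * ln a) - kap * (a' * ln a') + (a + a') * (rest i V - kap * l).
  by ring.
by rewrite aa; lra.
Qed.

Section Minimiser.
Variables (W : 'I_k -> {set T}) (S : {set T}).
Hypotheses (W0 : forall i, W i != set0) (WS : forall i, W i \subset S).
Hypothesis Wmin : forall V, (forall i, V i != set0) -> (forall i, V i \subset S) ->
  energy W <= energy V.

Lemma min_upd i Z : Z != set0 -> Z \subset S -> energy W <= energy (upd W i Z).
Proof.
by move=> Z0 ZS; apply: Wmin => j; case: (eqVneq j i) => [->|ji]; rewrite ?upd_same ?upd_other.
Qed.

(** Two successive splittings, of W i at Y and then of W e at X: the first shows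
    that the density from Y to W e is close to that of the pair and that the
    energy at Y is close to the minimum, the second that the density from Y to X is
    close to that from Y to W e. *)
Lemma min_regular (eps : R) i e X Y : 0 < eps <= 1 -> kap = lam * eps ^+ 4 / 8 ->
  i != e -> Y \subset W i -> X \subset W e ->
  eps * #|W i|%:R <= #|Y|%:R -> eps * #|W e|%:R <= #|X|%:R ->
  `|dens Y X - dens (W i) (W e)| < eps.
Proof.
move=> /andP[e0 e1] kE ie YW XW cY cX.
have wi : 0 < #|W i|%:R :> R by rewrite ltr0n card_gt0.
have we : 0 < #|W e|%:R :> R by rewrite ltr0n card_gt0.
have Y0 : Y != set0 by rewrite -card_gt0 -(ltr0n R); apply: lt_le_trans cY; exact: mulr_gt0.
have X0 : X != set0 by rewrite -card_gt0 -(ltr0n R); apply: lt_le_trans cX; exact: mulr_gt0.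
have ei : e != i by rewrite eq_sym.
have HW Z : Z \subset W i -> Z != set0 -> energy W <= energy (upd W i Z).
  by move=> ZW Z0; apply: min_upd => //; exact: fintype.subset_trans ZW (WS i).
have h1 := split_one W0 YW Y0 ei HW.
pose V := upd W i Y.
have V0 j : V j != set0 by rewrite /V; case: (eqVneq j i) => [->|ji]; rewrite ?upd_same ?upd_other.
have VS j : V j \subset S.
  rewrite /V; case: (eqVneq j i) => [->|ji]; rewrite ?upd_same ?upd_other //.
  exact: fintype.subset_trans YW (WS i).
have Ve : V e = W e by rewrite /V upd_other.
have Vi : V i = Y by rewrite /V upd_same.
have XV : X \subset V e by rewrite Ve.
have U0 Z : Z \subset V e -> Z != set0 -> forall j, upd V e Z j != set0.
  by move=> ZV Z0 j; case: (eqVneq j e) => [->|je]; rewrite ?upd_same ?upd_other.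
have US Z : Z \subset V e -> Z != set0 -> forall j, upd V e Z j \subset S.
  move=> ZV Z0 j; case: (eqVneq j e) => [->|je]; rewrite ?upd_same ?upd_other //.
  exact: fintype.subset_trans ZV (VS e).
have HV Z : Z \subset V e -> Z != set0 -> energy W <= energy (upd V e Z).
  by move=> ZV Z0; apply: Wmin => j; [exact: U0 | exact: US].
have := split_one V0 XV X0 ie HV.
rewrite Ve Vi [dens X Y]densC [dens (W e) Y]densC => h2.
have h3 : energy W <= energy (upd V e X) by exact: HV.
move: h1 h2; rewrite -/V; set a := #|Y|%:R / _; set b := #|X|%:R / _.
have ae : eps <= a by rewrite ler_pdivlMr.
have be : eps <= b by rewrite ler_pdivlMr.
set p := dens Y (W e); set q := dens Y X; set d := dens (W i) (W e) => h1 h2.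
set u := energy V - energy W in h1 h2 *.
have {}h1 : a * (u + 2 * lam * (p - d) ^+ 2) <= 2 * kap.
  rewrite (_ : _ * _ = a * u + 2 * lam * a * (p - d) ^+ 2); last by ring.
  by move: h1; rewrite -/u; lra.
have u0 : 0 <= u by rewrite subr_ge0; apply: Wmin.
have lam2 : 0 <= 2 * lam by rewrite mulr_ge0 // ltW.
have s1 := sqr_ge0 (p - d); have s2 := sqr_ge0 (q - p).
have {}h1 : eps * (u + 2 * lam * (p - d) ^+ 2) <= 2 * kap.
  by apply: le_trans h1; rewrite ler_wpM2r // addr_ge0 // mulr_ge0.
have {}h2 : b * (2 * lam * (q - p) ^+ 2) <= u + 2 * kap.
  have : 0 <= b * (energy (upd V e X) - energy W).
    by rewrite mulr_ge0 ?subr_ge0 // (le_trans (ltW e0)).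
  by lra.
have {}h2 : eps * (2 * lam * (q - p) ^+ 2) <= u + 2 * kap.
  by apply: le_trans h2; rewrite ler_wpM2r // mulr_ge0.
have h4 : lam * (eps ^+ 2 * ((q - p) ^+ 2 + (p - d) ^+ 2)) <= 2 * kap.
  have t1 := ler_wpM2l (ltW e0) h2.
  have t2 : eps * (eps * (2 * lam * (p - d) ^+ 2)) <= eps * (2 * lam * (p - d) ^+ 2).
    by rewrite ler_piMl // mulr_ge0 ?(ltW e0) // mulr_ge0.
  have t3 : eps * kap <= kap by rewrite ler_piMl // ltW.
  by move: t1 t2 h1; rewrite !expr2; lra.
have h5 : (q - p) ^+ 2 + (p - d) ^+ 2 <= eps ^+ 2 / 4.
  have e4 : 0 < eps ^+ 2 by rewrite exprn_gt0.
  rewrite -(ler_pM2l e4) -(ler_pM2l lam0); apply: le_trans h4 _; rewrite kE.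
  by rewrite (_ : eps ^+ 4 = eps ^+ 2 * eps ^+ 2); [lra | rewrite -exprD].
have h6 : (q - d) ^+ 2 < eps ^+ 2.
  have : (q - d) ^+ 2 <= 2 * ((q - p) ^+ 2 + (p - d) ^+ 2).
    by have := sqr_ge0 (q - p - (p - d)); rewrite !expr2; lra.
  have : 0 < eps ^+ 2 by rewrite exprn_gt0.
  by lra.
by move: h6; rewrite -[X in X < _]real_normK ?num_real // ltr_pXn2r ?nnegrE ?(ltW e0).
Qed.

(** Replacing W i by the whole of S does not decrease the energy, and in S every
    vertex has small co-degree. *)
Lemma min_row (rr : R) i : (0 < #|S|)%N -> 
  (forall v, v \in S -> (codeg G S v)%:R <= rr * #|S|%:R) ->
  \sum_(j | j != i) dens (W i) (W j) <= k.-1%:R * (rr + lam).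
Proof.
move=> S0 Hr; have Sp : 0 < #|S|%:R :> R by rewrite ltr0n.
have SN : S != set0 by rewrite -card_gt0.
have := @min_upd i S SN (fintype.subxx S); rewrite energy_upd (energy_rest i) => h.
have h2 : \sum_(j | j != i) pot (dens (W i) (W j)) <= \sum_(j | j != i) pot (dens S (W j)).
  have : ln #|W i|%:R <= ln #|S|%:R :> R.
    by apply: ln_nat_le; rewrite ?card_gt0 // subset_leq_card.
  by move=> /(ler_wpM2l (ltW kap0)); lra.
have dS j : dens S (W j) <= rr.
  have wj : 0 < #|W j|%:R :> R by rewrite ltr0n card_gt0.
  rewrite densC /dens ler_pdivrMr ?mulr_gt0 // /coedges natr_sum.
  apply: (@le_trans _ _ (\sum_(v in W j) (rr * #|S|%:R))).
    by apply: ler_sum => v vW; apply: Hr; apply: (subsetP (WS j)).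
  by rewrite sumr_const -[X in X <= _]mulr_natl mulrCA lexx.
have pS j : pot (dens S (W j)) <= rr.
  by apply: le_trans (dS j); have [_ /andP[]] := pot_bounds (dens01 S (W j)).
have c : #|[pred j | j != i]| = k.-1.
  by have := cardC1 i; rewrite card_ord => <-; apply: eq_card => j; rewrite !inE.
apply: (@le_trans _ _ (\sum_(j | j != i) (pot (dens (W i) (W j)) + lam))).
  apply: ler_sum => j _; have [_ /andP[]] := pot_bounds (dens01 (W i) (W j)); lra.
rewrite big_split /= sumr_const c mulrDr -[X in _ + X <= _]mulr_natl lerD2r; apply: le_trans h2 _.
apply: (@le_trans _ _ (\sum_(j | j != i) rr)); first by apply: ler_sum => j _; exact: pS.
by rewrite sumr_const c -[X in X <= _]mulr_natl lexx.
Qed.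

Lemma min_size i : #|S|%:R * expR (- (k%:R ^+ 2 / kap)) <= #|W i|%:R.
Proof.
have wp j : (0 < #|W j|)%N by rewrite card_gt0.
have wl j : ln #|W j|%:R <= ln #|S|%:R :> R by apply: ln_nat_le; rewrite ?subset_leq_card.
have SN : S != set0.
  by rewrite -card_gt0; apply: leq_trans (wp i) _; rewrite subset_leq_card.
have := Wmin (fun=> SN) (fun=> fintype.subxx S); rewrite /energy => h.
have h1 : 0 <= \sum_p \sum_(q < k | q != p) pot (dens (W p) (W q)).
  apply: sumr_ge0 => p _; apply: sumr_ge0 => q _.
  by have [/andP[]] := pot_bounds (dens01 (W p) (W q)).
have h2 : \sum_(p < k) \sum_(q < k | q != p) pot (dens S S) <= k%:R ^+ 2.
  have [/andP[p0 p1] _] := pot_bounds (dens01 S S).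
  apply: (@le_trans _ _ (\sum_(p < k) \sum_(q < k) 1)); last first.
    rewrite (eq_bigr (fun=> k%:R)); last by move=> p _; rewrite sumr_const card_ord.
    by rewrite sumr_const card_ord -[X in X <= _]mulr_natl expr2 lexx.
  apply: ler_sum => p _; rewrite big_mkcond /=; apply: ler_sum => q _.
  by case: ifP => _; rewrite ?ler01.
have h3 : kap * (ln #|S|%:R - ln #|W i|%:R) <= k%:R ^+ 2.
  apply: (@le_trans _ _ (kap * \sum_(p < k) (ln #|S|%:R - ln #|W p|%:R))).
    rewrite ler_pM2l // (bigD1 i) //= lerDl sumr_ge0 // => j _; by rewrite subr_ge0.
  by rewrite big_split /= sumrN mulrBr; move: h h1 h2; lra.
have sp : 0 < #|S|%:R :> R by rewrite ltr0n card_gt0.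
have wip : 0 < #|W i|%:R :> R by rewrite ltr0n.
rewrite -[#|S|%:R]lnK ?posrE // -expRD -[X in _ <= X]lnK ?posrE // ler_expR.
by move: h3; rewrite mulrC -ler_pdivlMr //; lra.
Qed.

End Minimiser.

Lemma energy_min S : S != set0 -> exists W : 'I_k -> {set T},
  [/\ forall i, W i != set0, forall i, W i \subset S &
   forall V, (forall i, V i != set0) -> (forall i, V i \subset S) -> energy W <= energy V].
Proof.
move=> S0; pose P := [pred V : {ffun 'I_k -> {set T}} | [forall i, (V i != set0) && (V i \subset S)]].
have P0 : P [ffun=> S] by apply/forallP => i; rewrite ffunE S0 fintype.subxx.
case: (@arg_minP _ R _ [ffun=> S] P (fun V : {ffun 'I_k -> {set T}} => energy V) P0) => W /forallP WP Wmin.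
exists W; split => [i|i|V V0 VS]; [by case/andP: (WP i) | by case/andP: (WP i) |].
have E : energy [ffun i => V i] = energy V.
  by rewrite /energy; congr (_ - kap * _); apply: eq_bigr => p _; rewrite ?ffunE //;
     apply: eq_bigr => q _; rewrite !ffunE.
by rewrite -E; apply: Wmin; apply/forallP => i; rewrite ffunE V0 VS.
Qed.

End Regular.

(** * Tuples with few common neighbours *)

Lemma card_bigcup_le (T I : finType) (P : pred I) (F : I -> {set T}) :
  (#|\bigcup_(i | P i) F i| <= \sum_(i | P i) #|F i|)%N.
Proof.
elim/big_rec2: _ => [|i m X _ le]; first by rewrite cards0.
apply: leq_trans (leq_of_leqif (leq_card_setU _ _)) _.
by rewrite leq_add2l.
Qed.

Section BadTuples.
Variables (R : realType) (T : finType) (G : sgraph T) (k : nat).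
Variables (W : 'I_k -> {set T}) (eps mu0 : R).
Implicit Types (I J C : {set 'I_k}) (y : {ffun 'I_k -> T}).

Local Notation d i e := (dens R G (W i) (W e)).

Hypotheses (W0 : forall i, W i != set0) (eps0 : 0 < eps) (mu00 : 0 < mu0).
Hypothesis reg : forall i e (X Y : {set T}), i != e -> Y \subset W i -> X \subset W e ->
  eps * #|W i|%:R <= #|Y|%:R -> eps * #|W e|%:R <= #|X|%:R ->
  `|dens R G Y X - d i e| < eps.
Hypothesis row : forall e, \sum_(j | j != e) d e j <= 1 - mu0.
Hypotheses (keps : k%:R * eps <= 1) (eps4 : eps <= 4^-1) (eps_mu : eps <= expR (- 8) / 2 * mu0).

(** The proportion of a large subset of W e that nearly every vertex of W i is
    guaranteed to be adjacent to. *)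
Definition keep (i e : 'I_k) : R := 1 - d i e - eps.

Lemma d_ge0 i e : 0 <= d i e. Proof. by case/andP: (dens01 R G (W i) (W e)). Qed.

Lemma row_sub e (P : pred 'I_k) : (forall i, P i -> i != e) ->
  \sum_(i | P i) d i e <= 1 - mu0.
Proof.
move=> Pe; apply: le_trans (row e); rewrite [X in _ <= X](bigID P) /=.
apply: (@le_trans _ _ (\sum_(i | (i != e) && P i) d e i)); last first.
  by rewrite lerDl sumr_ge0 // => i _; apply: d_ge0.
rewrite le_eqVlt; apply/orP; left; apply/eqP; apply: eq_big => i.
  by case: (boolP (P i)) => [/Pe ->|]; rewrite ?andbF.
by rewrite densC.
Qed.

Lemma d_le i e : i != e -> d i e <= 1 - mu0.
Proof.
move=> ie; have : \sum_(j | pred1 i j) d j e <= 1 - mu0.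
  by apply: (@row_sub e (pred1 i)) => j; rewrite inE => /eqP ->.
by rewrite big_pred1_eq.
Qed.

Lemma mu0_le1 (i e : 'I_k) : i != e -> mu0 <= 1.
Proof. by move=> /d_le; have := d_ge0 i e; lra. Qed.

Lemma eps_half (i e : 'I_k) : i != e -> eps <= mu0 / 2.
Proof.
by move=> ie; apply: le_trans eps_mu _; rewrite mulrAC ler_pM2r // ger_pMl // expR_le1; lra.
Qed.

Lemma keep01 i e : i != e -> 0 <= keep i e <= 1.
Proof.
move=> ie; have := d_le ie; have := eps_half ie; have := d_ge0 i e.
by rewrite /keep; move: eps0 mu00 => *; apply/andP; split; lra.
Qed.

(** 1 - g >= exp(- 4 g) for g <= 3/4, and the sum of the g is at most 2 because a
    row of densities sums to less than 1. *)
Lemma prod_light e I : e \notin I -> (forall i, i \in I -> d i e <= 2^-1) ->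
  expR (- 8) <= \prod_(i in I) keep i e.
Proof.
move=> eI light.
have Ie i : i \in I -> i != e by move=> iI; apply: contraNneq eI => <-.
apply: (@le_trans _ _ (\prod_(i in I) expR (- (4 * (d i e + eps))))); last first.
  apply: ler_prod => i iI; rewrite expR_ge0 /=; set g := d i e + eps.
  have g0 : 0 <= g by rewrite addr_ge0 ?d_ge0 // ltW.
  have g1 : g <= 3 / 4 by have := light i iI; rewrite /g; move: eps4; lra.
  have -> : keep i e = 1 - g by rewrite /keep /g; ring.
  have h := expR_ge1Dx (4 * g); have ep := expR_gt0 (4 * g).
  rewrite expRN -[X in X <= _]mul1r ler_pdivrMr //.
  have h2 : (1 - g) * (1 + 4 * g) <= (1 - g) * expR (4 * g) by rewrite ler_wpM2l //; lra.
  apply: le_trans h2; rewrite -subr_ge0.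
  by rewrite (_ : _ - _ = g * (3 - 4 * g)); [rewrite mulr_ge0 //; lra | ring].
have -> : \prod_(i in I) expR (- (4 * (d i e + eps))) =
    expR (- (4 * \sum_(i in I) (d i e + eps))) :> R.
  by rewrite mulr_sumr -sumrN expR_sum.
rewrite ler_expR lerN2 big_split /= sumr_const.
have h1 := row_sub Ie; have : eps *+ #|I| <= 1.
  rewrite -mulr_natl; apply: le_trans keps; rewrite ler_wpM2r ?(ltW eps0) // ler_nat.
  by rewrite -[X in (_ <= X)%N]card_ord max_card.
by move: mu00 => *; lra.
Qed.

(** A row of densities sums to less than 1, so at most one entry exceeds 1/2. *)
Definition heavy (e : 'I_k) : pred 'I_k := [pred i | (i != e) && (2^-1 < d i e)].

Definition partner (e : 'I_k) : 'I_k := if [pick i | heavy e i] is Some i then i else e.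

Lemma heavy_uniq e i j : heavy e i -> heavy e j -> i = j.
Proof.
move=> /andP[ie hi] /andP[je hj]; apply/eqP/negPn/negP => ij.
have h : \sum_(a | pred2 i j a) d a e <= 1 - mu0 by apply: (@row_sub e (pred2 i j)) => a; rewrite inE => /pred2P[] ->.
rewrite (bigD1 i) /= ?eqxx // (bigD1 j) /= in h; last by rewrite eqxx orbT eq_sym.
have : 0 <= \sum_(a < k | ((a == i) || (a == j)) && (a != i) && (a != j)) d a e.
  by apply: sumr_ge0 => *; apply: d_ge0.
by move: h hi hj mu00; lra.
Qed.

Lemma heavy_partner e i : heavy e i -> partner e = i.
Proof.
move=> hi; rewrite /partner; case: pickP => [j hj|/(_ i)]; last by rewrite hi.
exact: heavy_uniq hj hi.
Qed.

Lemma partnerP e : partner e != e -> heavy e (partner e).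
Proof.
rewrite {1}/partner; case: pickP => [i hi _|_]; last by rewrite eqxx.
by rewrite (heavy_partner hi).
Qed.

Lemma partnerK : involutive partner.
Proof.
move=> e; have [pe|pe] := eqVneq (partner e) e; first by rewrite !pe.
apply: heavy_partner; have /andP[_ h] := partnerP pe.
by rewrite /heavy /= eq_sym pe densC.
Qed.

Lemma light_le e i : i != e -> partner e != i -> d i e <= 2^-1.
Proof.
move=> ie; apply: contraNle => hi; apply/eqP; apply: heavy_partner.
by rewrite /heavy /= ie hi.
Qed.

Definition mu e : R := 1 - d (partner e) e.

Lemma mu_ge e : partner e != e -> mu0 <= mu e.
Proof. by move=> /d_le; rewrite /mu; lra. Qed.

Lemma prod_heavy e I : partner e != e -> e \notin I ->
  expR (- 8) / 2 * mu e <= \prod_(i in I) keep i e.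
Proof.
move=> pe eI; set p := partner e.
have Ie i : i \in I -> i != e by move=> iI; apply: contraNneq eI => <-.
have m1 : mu e <= 1 by rewrite /mu; have := d_ge0 (partner e) e; lra.
have m0 := mu_ge pe; have E0 : 0 < expR (- 8) :> R := expR_gt0 _.
have hp : e \notin I :\ p by rewrite !inE negb_and eI orbT.
have := prod_light hp; set q := \prod_(i in _) _ => /(_ _) h.
have {}h : expR (- 8) <= q.
  apply: h => i; rewrite !inE => /andP[ip iI]; apply: light_le; first exact: Ie.
  by rewrite eq_sym.
have [pI|pI] := boolP (p \in I); last first.
  have -> : \prod_(i in I) keep i e = q.
    by apply: eq_bigl => i; rewrite !inE; case: eqP => [->|]; rewrite ?(negPf pI).
  apply: le_trans h; rewrite -mulrA ler_piMr ?(ltW E0) //; move: m0 mu00; lra.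
rewrite (big_setD1 p pI) /= -/q.
have hk : mu e / 2 <= keep p e.
  by have := eps_half pe; rewrite /keep -/(mu e) -/p; move: m0; rewrite /mu -/p; lra.
rewrite (_ : _ * mu e = mu e / 2 * expR (- 8)); last by ring.
by apply: ler_pM => //; rewrite ?(ltW E0) // divr_ge0 //; move: m0 mu00; lra.
Qed.

Lemma prod_keep e I : e \notin I -> eps <= \prod_(i in I) keep i e.
Proof.
move=> eI; have [pe|pe] := eqVneq (partner e) e.
  apply: (@le_trans _ _ (expR (- 8))); last first.
    apply: prod_light => // i iI; have ie : i != e by apply: contraNneq eI => <-.
    by apply: light_le; rewrite // pe eq_sym.
  have [/existsP[j je]|] := boolP [exists j, j != e].
    apply: le_trans eps_mu _; have := mu0_le1 je; have E0 : 0 < expR (- 8) :> R := expR_gt0 _.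
    by move=> m1; rewrite -mulrA ler_piMr ?(ltW E0) //; move: m1; lra.
  rewrite negb_exists => /forallP one; have m1 : mu0 <= 1.
    by have := row e; rewrite big_pred0 ?subr_ge0 // => j; apply/negbTE/one.
  apply: le_trans eps_mu _; have E0 : 0 < expR (- 8) :> R := expR_gt0 _.
  by rewrite -mulrA ler_piMr ?(ltW E0) //; move: m1; lra.
apply: le_trans (prod_heavy pe eI); apply: le_trans eps_mu _.
by rewrite ler_wpM2l ?(mu_ge pe) // divr_ge0 // expR_ge0.
Qed.

Definition common e I y : {set T} := [set v in W e | [forall i in I, G v (y i)]].

(** A tuple is bad if the common neighbourhood of some of its entries is smaller
    than regularity predicts.  Restricting the entries to J allows to add the
    coordinates one at a time. *)
Definition poor e I y : bool :=
  (e \notin I) && (#|common e I y|%:R < \prod_(i in I) keep i e * #|W e|%:R).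

Definition bad J y : bool := [exists e, [exists I : {set 'I_k}, (I \subset J) && poor e I y]].

Lemma good_common J y e I : ~~ bad J y -> I \subset J -> e \notin I ->
  \prod_(i in I) keep i e * #|W e|%:R <= #|common e I y|%:R.
Proof.
move=> nb IJ eI; rewrite leNgt; apply: contraNN nb => lt.
by apply/existsP; exists e; apply/existsP; exists I; rewrite IJ /poor eI.
Qed.

Lemma common_setf e I y j v : j \notin I -> common e I (setf y j v) = common e I y.
Proof.
move=> jI; apply/setP => u; rewrite !inE; congr (_ && _).
apply: eq_forallb_in => i iI; rewrite ffunE; case: eqP => // ij.
by rewrite ij (negPf jI) in iI.
Qed.

Lemma common_setfD1 e I y j v : j \in I ->
  common e I (setf y j v) = nb G v :&: common e (I :\ j) y.
Proof.
move=> jI; apply/setP => u; rewrite !inE.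
have -> : [forall i in I, G u (setf y j v i)] = G v u && [forall i in I :\ j, G u (y i)].
  rewrite adj_sym; apply/forall_inP/andP => [h|[h1 /forall_inP h2] i iI].
    split; first by have := h j jI; rewrite ffunE eqxx.
    apply/forall_inP => i; rewrite !inE => /andP[ij iI].
    by have := h i iI; rewrite ffunE (negPf ij).
  by rewrite ffunE; case: eqP => // /eqP ij; apply: h2; rewrite !inE ij.
by rewrite andbCA.
Qed.

Lemma sum_nb_coedges (X Y : {set T}) :
  (coedges G Y X + \sum_(v in Y) #|nb G v :&: X| = #|Y| * #|X|)%N.
Proof.
rewrite /coedges -big_split /= -sum_nat_const; apply: eq_bigr => v _.
by rewrite -/(codeg G X v) codeg_nb.
Qed.

(** By regularity only few vertices of W j see less than the expected part of a
    large common neighbourhood. *)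
Lemma few_low e j (X : {set T}) : j != e -> X \subset W e -> eps * #|W e|%:R <= #|X|%:R ->
  #|[set v in W j | #|nb G v :&: X|%:R < keep j e * #|X|%:R]|%:R <= eps * #|W j|%:R.
Proof.
move=> je XW cX; set Y := [set v in W j | _].
have Xp : 0 < #|X|%:R :> R.
  by apply: lt_le_trans cX; rewrite mulr_gt0 // ltr0n card_gt0.
rewrite leNgt; apply/negP => cY.
have YW : Y \subset W j by apply/subsetP => v; rewrite inE => /andP[].
have := reg je YW XW (ltW cY) cX; rewrite ltr_norml => /andP[_].
have Yp : 0 < #|Y|%:R :> R.
  by apply: lt_trans cY; rewrite mulr_gt0 // ltr0n card_gt0.
have XYp : 0 < #|Y|%:R * #|X|%:R :> R by rewrite mulr_gt0.
rewrite ltrBlDr /dens ltr_pdivrMr //; apply/negP; rewrite -leNgt.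
have h : \sum_(v in Y) #|nb G v :&: X|%:R <= \sum_(v in Y) (keep j e * #|X|%:R).
  by apply: ler_sum => v; rewrite inE => /andP[_ /ltW].
move: h; rewrite sumr_const -[X in _ <= X -> _]mulr_natl -natr_sum.
have := congr1 (fun n : nat => n%:R : R) (sum_nb_coedges X Y); rewrite natrD natrM /keep /dens.
set s := (\sum_(_ in _) _)%N; set D := _ / _ => E h.
by rewrite -subr_ge0; move: h; rewrite -subr_ge0 -(addrK s%:R (coedges G Y X)%:R) E; lra.
Qed.

Definition zeta : R := k%:R * 2 ^+ k * eps.

(** If y is not bad but becomes bad when its entry e0 is set to v, then v has too
    few neighbours in the common neighbourhood of the entries I minus e0 in some
    W e.  That set is large, as y is not bad, so regularity leaves few such v
    for each of the at most k 2^k pairs (e, I). *)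
Lemma bad_extend J y e0 : y \in box W -> ~~ bad J y ->
  #|[set v in W e0 | bad (e0 |: J) (setf y e0 v)]|%:R <= zeta * #|W e0|%:R.
Proof.
move=> yW ngood.
pose low (eI : 'I_k * {set 'I_k}) : {set T} :=
  if (e0 != eI.1) && (eI.1 \notin eI.2) && (eI.2 \subset J) then
  [set v in W e0 | #|nb G v :&: common eI.1 eI.2 y|%:R < keep e0 eI.1 * #|common eI.1 eI.2 y|%:R]
  else finset.set0.
have sub : [set v in W e0 | bad (e0 |: J) (setf y e0 v)] \subset \bigcup_eI low eI.
  apply/subsetP => v; rewrite inE => /andP[vW /existsP[e /existsP[I /andP[IJ /andP[eI lt]]]]].
  have [jI|jI] := boolP (e0 \in I); last first.
    exfalso; move: lt; rewrite common_setf //; apply/negP; rewrite -leNgt.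
    apply: (good_common ngood) => //; apply/subsetP => i iI.
    have := subsetP IJ i iI; rewrite in_setU1 => /orP[/eqP ii|//].
    by rewrite ii (negPf jI) in iI.
  have IJ' : I :\ e0 \subset J.
    by apply/subsetP => i; rewrite !inE => /andP[ie iI]; have := subsetP IJ i iI; rewrite !inE (negPf ie).
  have ee : e0 != e by apply: contraNneq eI => <-.
  have eI' : e \notin I :\ e0 by rewrite !inE negb_and eI orbT.
  apply/bigcupP; exists (e, I :\ e0) => //.
  rewrite /low /= ee eI' IJ' /= inE vW /=.
  move: lt; rewrite common_setfD1 // (big_setD1 e0 jI) /= => /lt_le_trans; apply.
  have /andP[k0 _] := keep01 ee.
  by rewrite -mulrA ler_wpM2l //; apply: (good_common ngood).
have lowc eI : #|low eI|%:R <= eps * #|W e0|%:R.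
  rewrite /low; case: ifP => [/andP[/andP[h1 h2] h3]|_]; last by rewrite cards0 mulr_ge0 // ltW.
  apply: few_low => //; first by apply/subsetP => v; rewrite inE => /andP[].
  apply: le_trans (good_common ngood h3 h2); rewrite ler_wpM2r //; exact: prod_keep.
apply: (@le_trans _ _ #|\bigcup_eI low eI|%:R); first by rewrite ler_nat subset_leq_card.
apply: (@le_trans _ _ (\sum_eI #|low eI|)%:R).
  by rewrite ler_nat card_bigcup_le.
rewrite natr_sum; apply: (@le_trans _ _ (\sum_(eI : 'I_k * {set 'I_k}) (eps * #|W e0|%:R))).
  by apply: ler_sum => *; apply: lowc.
rewrite sumr_const card_prod card_ord -cardsT -powersetT card_powerset cardsT card_ord.
rewrite -[X in X <= _]mulr_natl natrM natrX /zeta !mulrA //.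
Qed.

Lemma bad_setf J y j v : j \notin J -> bad J (setf y j v) = bad J y.
Proof.
move=> jJ; apply: eq_existsb => e; apply: eq_existsb => I.
case: (boolP (I \subset J)) => //= IJ; congr (_ && _); rewrite common_setf //.
by apply: contraNN jJ => /(subsetP IJ).
Qed.

Lemma nbad_extend J e : e \notin J ->
  (nbad (bad (e |: J)) W)%:R <= (nbad (bad J) W)%:R + zeta * #|box W|%:R.
Proof.
move=> eJ; pose bad' : pred {ffun 'I_k -> T} := fun y => bad (e |: J) y && ~~ bad J y.
have h1 : (nbad (bad (e |: J)) W <= nbad (bad J) W + nbad bad' W)%N.
  apply: leq_trans (leq_of_leqif (leq_card_setU _ _)); apply: subset_leq_card.
  apply/subsetP => y; rewrite !inE /bad' => /andP[-> ->] /=.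
  by case: (bad J y).
have Wp : 0 < #|W e|%:R :> R by rewrite ltr0n card_gt0.
have z0 : 0 <= zeta by rewrite /zeta mulr_ge0 ?(ltW eps0) // mulr_ge0 // exprn_ge0.
have h2 : (nbad bad' W)%:R <= zeta * #|box W|%:R.
  have updE : box (upd W e (W e)) = box W.
    apply/setP => y; rewrite !inE; apply: eq_forallb => i.
    by case: (eqVneq i e) => [->|ie]; rewrite ?upd_same ?upd_other.
  have := nbad_upd_le bad' W e (W e); rewrite /nbad updE -/(nbad bad' W) -(ler_nat R) natrM.
  move=> h; rewrite -(ler_pM2r Wp); apply: le_trans h _.
  rewrite natr_sum mulrAC [X in _ <= X]mulr_natr -sumr_const.
  apply: ler_sum => y yW; have [by_|by_] := boolP (bad J y).
    rewrite (_ : [set v in W e | _] = set0); first by rewrite cards0 (mulr_ge0 z0).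
    by apply/setP => v; rewrite !inE /bad' (bad_setf _ _ eJ) by_ !andbF.
  apply: le_trans (bad_extend e yW by_); rewrite ler_nat subset_leq_card //.
  by apply/subsetP => v; rewrite !inE /bad' => /andP[-> /andP[]].
by apply: le_trans (_ : (nbad (bad J) W)%:R + (nbad bad' W)%:R <= _); rewrite ?lerD2l // -natrD ler_nat.
Qed.

(** Add the coordinates to J one by one, starting from the empty set, for which no
    tuple is bad. *)
Lemma nbad_full : (nbad (bad [set: 'I_k]) W)%:R <= k%:R * zeta * #|box W|%:R.
Proof.
suff h j : (j <= k)%N ->
    (nbad (bad [set i : 'I_k | (i < j)%N]) W)%:R <= j%:R * zeta * #|box W|%:R.
  rewrite (_ : [set: 'I_k] = [set i : 'I_k | (i < k)%N]); first exact: h.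
  by apply/setP => i; rewrite !inE ltn_ord.
elim: j => [_|j IH jk].
  rewrite !mul0r (_ : nbad _ _ = 0%N) //; apply/eqP; rewrite cards_eq0; apply/eqP/setP => y.
  rewrite !inE; apply/negbTE; rewrite negb_and; apply/orP; right.
  apply/existsP => -[e /existsP[I /andP[I0 /andP[_]]]].
  have -> : I = finset.set0.
    apply/eqP; rewrite -subset0; apply: fintype.subset_trans I0 _.
    by apply/subsetP => i; rewrite inE.
  rewrite big_set0 mul1r ltr_nat ltnNge => /negP; apply; apply: subset_leq_card.
  apply/subsetP => v vW; rewrite inE vW; apply/forall_inP => i; rewrite inE //.
pose e := Ordinal jk.
have -> : [set i : 'I_k | (i < j.+1)%N] = e |: [set i : 'I_k | (i < j)%N].
  apply/setP => i; rewrite !inE ltnS leq_eqVlt; congr (_ || _).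
have eJ : e \notin [set i : 'I_k | (i < j)%N] by rewrite inE ltnn.
apply: le_trans (nbad_extend eJ) _; have := IH (ltnW jk).
by rewrite -natr1 !mulrDl mul1r; lra.
Qed.

Lemma keep_light_nbrs y e C : y \in box W -> ~~ bad [set: 'I_k] y ->
  e \notin C -> partner e \notin C ->
  expR (- 8) / 2 * #|W e|%:R <= #|common e C y|%:R :> R.
Proof.
move=> _ good eC pC; apply: le_trans (good_common good (subsetT C) eC).
rewrite ler_wpM2r //; apply: (@le_trans _ _ (expR (- 8))).
  by have := expR_gt0 (- 8 : R); lra.
apply: prod_light => // i iC; apply: light_le; first by apply: contraNneq eC => <-.
by apply: contraNneq pC => ->.
Qed.

Lemma keep_heavy_nbrs y e C : partner e != e -> y \in box W -> ~~ bad [set: 'I_k] y ->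
  e \notin C ->
  expR (- 8) / 2 * mu e * #|W e|%:R <= #|common e C y|%:R.
Proof.
move=> pe _ good eC; apply: le_trans (good_common good (subsetT C) eC).
by rewrite ler_wpM2r //; apply: prod_heavy.
Qed.

(** The vertices of too large degree would form a set whose density to W e is off
    by more than regularity allows. *)
Lemma few_high e : partner e != e ->
  #|[set u in W (partner e) | ~~ (#|nb G u :&: W e|%:R <= 2 * mu e * #|W e|%:R)]|%:R
    <= eps * #|W (partner e)|%:R.
Proof.
move=> pe; set p := partner e; set Y := [set u in W p | _].
have wp i : 0 < #|W i|%:R :> R by rewrite ltr0n card_gt0.
rewrite leNgt; apply/negP => cY.
have YW : Y \subset W p by apply/subsetP => v; rewrite inE => /andP[].
have Yp : 0 < #|Y|%:R :> R by apply: lt_trans cY; rewrite mulr_gt0.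
have e1 : eps * #|W e|%:R <= #|W e|%:R by rewrite ler_piMl //; move: eps4; lra.
have := reg pe YW (fintype.subxx _) (ltW cY) e1; rewrite ltr_norml => /andP[+ _].
rewrite ltrBrDl [dens R G Y _]/dens ltr_pdivlMr ?mulr_gt0 //; apply/negP; rewrite -leNgt -/p.
have h : \sum_(v in Y) (2 * mu e * #|W e|%:R) <= \sum_(v in Y) #|nb G v :&: W e|%:R.
  by apply: ler_sum => v; rewrite inE -ltNge => /andP[_ /ltW].
move: h; rewrite sumr_const -[X in X <= _ -> _]mulr_natl -natr_sum.
have := congr1 (fun n : nat => n%:R : R) (sum_nb_coedges (W e) Y); rewrite natrD natrM.
set s := (\sum_(_ in _) _)%N => E h.
have ee : eps <= mu e.
  by apply: le_trans (eps_half pe) _; have := mu_ge pe; move: mu00; lra.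
have h2 : #|Y|%:R * ((2 * mu e) * #|W e|%:R) >= #|Y|%:R * ((mu e + eps) * #|W e|%:R).
  by rewrite ler_pM2l // ler_pM2r //; move: ee; lra.
have -> : (coedges G Y (W e))%:R = #|Y|%:R * #|W e|%:R - s%:R :> R by rewrite -E addrK.
have -> : dens R G (W p) (W e) = 1 - mu e by rewrite /mu; ring.
by move: h h2; lra.
Qed.

End BadTuples.

(** * Blow-ups in a set where all degrees are large *)

Section Core.
Variables (R : realType) (T : finType) (G : sgraph T) (k : nat).
Implicit Types (S : {set T}).

Definition complete_parts (s : R) := exists V : 'I_k -> {set T},
  (forall i, s <= #|V i|%:R) /\ (forall i j x z, i != j -> x \in V i -> z \in V j -> G x z).

Lemma pow2_ge (t : R) : 0 < t -> exists M : nat, 1 <= 2 ^+ M * t.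
Proof.
move=> t0; exists (Num.truncn t^-1).+1; rewrite -ler_pdivrMr // mul1r.
apply: (@le_trans _ _ (Num.truncn t^-1).+1%:R); first by rewrite ltW // truncnS_gt.
by rewrite -natrX ler_nat; apply: ltnW; apply: ltn_expl.
Qed.

Lemma common_large S (C : {set 'I_k}) (y : {ffun 'I_k -> T}) (x : R) :
  (forall i, i \in C -> (codeg G S (y i))%:R <= x * #|S|%:R) ->
  (1 - #|C|%:R * x) * #|S|%:R <= #|[set v in S | [forall i in C, G v (y i)]]|%:R.
Proof.
move=> Hc; set N := [set v in S | _].
have : (#|S| <= #|N| + \sum_(i in C) codeg G S (y i))%N.
  rewrite -(cardsID N S) leq_add //; first by rewrite subset_leq_card // subsetIr.
  rewrite (eq_bigr (fun i => #|[set v in S | ~~ G (y i) v]|)); last by move=> i _; rewrite codegE.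
  apply: leq_trans (card_bigcup_le _ _); apply: subset_leq_card; apply/subsetP => v.
  rewrite !inE negb_and => /andP[+ vS]; rewrite vS /= negb_forall => /existsP[i].
  rewrite negb_imply => /andP[iC gv]; apply/bigcupP; exists i => //.
  by rewrite inE vS adj_sym.
rewrite -(ler_nat R) natrD natr_sum => h.
have h2 : \sum_(i in C) (codeg G S (y i))%:R <= #|C|%:R * (x * #|S|%:R).
  apply: le_trans (ler_sum _ Hc) _; by rewrite sumr_const -[X in X <= _]mulr_natl lexx.
by lra.
Qed.

(** When every vertex of S is adjacent to almost all of S, the whole of S can
    serve as the reservoir of every part, and any r vertices have most of S as
    common neighbours: there are neither bad tuples nor heavy pairs. *)
Lemma parts_near_complete S (x rr : R) (B : nat) : (0 < k)%N -> S != set0 ->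
  0 < x -> x <= 4^-1 -> (forall v, v \in S -> (codeg G S v)%:R <= rr * #|S|%:R) ->
  0 <= rr -> k.-1%:R * rr <= x -> (0 < B)%N ->
  B%:R <= x / 4 * #|S|%:R * rho k B (1 - 2 * x) ->
  complete_parts (tau (1 - 2 * x) * B%:R).
Proof.
move=> k0 S0 x0 x4 Hr rr0 kr B0 room; pose c := 1 - 2 * x.
have c0 : 0 < c by rewrite /c; lra.
pose A := 4 / x; have A0 : 0 < A by rewrite divr_gt0.
have AE : A^-1 = x / 4 by rewrite /A invf_div.
have [M HM] := pow2_ge (exprn_gt0 k (tau_gt0 c0)).
have Kp : 0 < Kb c A 1.
  by rewrite /Kb mulr_gt0 // mulr_gt0 // exprn_gt0 // divr_gt0 // mulr_gt0.
have bp : 0 < beta0 A by rewrite /beta0 lt_min !invr_gt0 A0 ltr0n.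
have KM : 0 < Kb c A 1 ^+ M by rewrite exprn_gt0.
pose b := beta0 A / Kb c A 1 ^+ M.
have b0 : 0 < b by rewrite divr_gt0.
apply: (@blowup_of_box R T G k (fun=> S) xpred0 id (fun=> 1) 1 (1 - x) c A 0 B 1 _ _ _ _ _ _ _ _ _ _ _ _ _ _ _ _ M b) => //.
- by lra.
- by rewrite AE /c; lra.
- move=> y e _ _; rewrite (_ : [set v in S | _] = set0) ?cards0 ?mul0r //.
  by apply/setP => v; rewrite !inE andbF.
- move=> y e C /boxP yS _ eC _.
  apply: le_trans (common_large (x := rr) (y := y) (C := C) _); last by move=> i _; apply: Hr.
  rewrite ler_wpM2r // lerD2l lerN2; apply: le_trans kr; rewrite ler_wpM2r // ler_nat.
  rewrite -ltnS prednK //; have : (#|C| < #|'I_k|)%N.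
    by apply: proper_card; apply/properP; split; [apply/subsetP | exists e].
  by rewrite card_ord.
- by move=> y e C; rewrite eqxx.
- by move=> e; rewrite eqxx.
- by move=> e; rewrite eqxx.
- by move=> e; rewrite mul1n AE.
- by move=> e; rewrite eqxx.
- have -> : nbad (k := k) xpred0 (fun=> S) = 0%N.
    by rewrite /nbad; apply: eq_card0 => y; rewrite !inE andbF.
  by rewrite mulr_ge0 // ltW.
- exact: ltW.
- by rewrite /b mulrC divfK // lt0r_neq0.
Qed.

End Core.

(** One eighth of the constant exp(- 8) / 2, which bounds the proportion of common
    neighbours in a light slot from below. *)
Definition c_dense (R : realType) : R := expR (- 8) / 16.

(** Here counting non-neighbours gives k - 1 vertices of S only the proportion
    theta / 2 of common neighbours, too little if theta is small.  With the sets
    of a regular tuple as reservoirs, the proportions behave like products, and for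
    nearly all tuples they are at least an absolute constant in every light slot.
    The parameters are chosen in
    the order A, L, M, b, eps, kap: the number M of rounds is bounded first, and
    regularity is made fine enough for the bad tuples to stay rare throughout. *)
Lemma parts_dense (R : realType) (k : nat) (theta : R) : (0 < k)%N -> 0 < theta -> theta <= 1 ->
  exists eta L : R, [/\ 0 < eta, 0 < L &
  forall (T : finType) (G : sgraph T) (S : {set T}) (rr : R) (B : nat), S != set0 ->
  (forall v, v \in S -> (codeg G S v)%:R <= rr * #|S|%:R) ->
  k.-1%:R * rr <= 1 - theta / 2 -> (0 < B)%N ->
  L * B%:R ^+ 2 <= eta * #|S|%:R * rho k B (c_dense R) * (c_dense R * theta / 4) ^+ B ->
  complete_parts G k (tau (c_dense R) * B%:R)].
Proof.
move=> k0 th0 th1; pose c1 : R := expR (- 8) / 2; pose c := c_dense R; pose mu0 := theta / 4.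
have E0 : 0 < expR (- 8) :> R := expR_gt0 _.
have E1 : expR (- 8) <= 1 :> R by rewrite expR_le1; lra.
have c10 : 0 < c1 by rewrite /c1; lra.
have c11 : c1 <= 1 by rewrite /c1; lra.
have c8 : 8 * c = c1 by rewrite /c /c_dense /c1; lra.
have c0 : 0 < c by lra.
have m0 : 0 < mu0 by rewrite /mu0; lra.
have m1 : mu0 <= 4^-1 by rewrite /mu0; lra.
have cm : 0 < c1 * mu0 by rewrite mulr_gt0.
pose A := 8 / (c1 * mu0); have A0 : 0 < A by rewrite divr_gt0.
have AE : A^-1 = c1 * mu0 / 8 by rewrite /A invf_div.
have h81 : c1 * mu0 / 8 <= 1 by nra.
have AM : A^-1 <= c1 * mu0 by rewrite AE; lra.
have A8 : 8 / A <= c1 * mu0 by rewrite AE; lra.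
pose L := (Num.truncn A).+1; have LA : A < L%:R by rewrite truncnS_gt.
have L2 : 2 <= c1 * mu0 / 4 * L%:R.
  have : A * (c1 * mu0) <= L%:R * (c1 * mu0) by rewrite ler_wpM2r // ltW.
  by rewrite /A divfK ?lt0r_neq0 //; lra.
have [M HM] := pow2_ge (exprn_gt0 k (tau_gt0 c0)).
have bp : 0 < beta0 A by rewrite /beta0 lt_min !invr_gt0 A0 ltr0n.
have A4 : 4 / A <= c1 - c.
  rewrite AE; have : c1 * mu0 <= c1 * 4^-1 by rewrite ler_pM2l.
  by lra.
have [K3 _] : 3 <= Kb c A L /\ 3 * (2 * A / c) <= Kb c A L by apply: (Kb_ge c0 c11 A0 A4).
have KM : 1 <= Kb c A L ^+ M by apply: exprn_ege1; lra.
pose b := beta0 A / Kb c A L ^+ M.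
have b0 : 0 < b by rewrite divr_gt0 ?(lt_le_trans _ KM).
have bb : b <= beta0 A by rewrite ler_pdivrMr ?(lt_le_trans _ KM) // ler_peMr // ltW.
have bA : b <= A^-1 by apply: le_trans bb _; rewrite /beta0 ge_min lexx.
have b4 : b <= 4^-1 by apply: le_trans bb _; rewrite /beta0 ge_min lexx orbT.
have b1 : b <= 1 by lra.
have kp : 1 <= k%:R :> R by rewrite ler1n.
have k2 : 1 <= 2 ^+ k :> R by apply: exprn_ege1; lra.
pose eps := b / (k%:R ^+ 2 * 2 ^+ k).
have kk0 : 0 < k%:R ^+ 2 * 2 ^+ k :> R by rewrite mulr_gt0 ?exprn_gt0 // (lt_le_trans _ kp).
have e0 : 0 < eps by rewrite divr_gt0.
have epsE : k%:R ^+ 2 * 2 ^+ k * eps = b by rewrite /eps mulrC divfK // lt0r_neq0.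
have kE : k%:R * eps <= b.
  rewrite -epsE ler_pM2r // expr2 -mulrA ler_peMr //; nra.
have eb : eps <= b by apply: le_trans kE; rewrite ler_peMl // ltW.
have e1 := le_trans eb b1.
pose lam := theta / (4 * k%:R); have lam0 : 0 < lam by rewrite divr_gt0 // mulr_gt0 // (lt_le_trans _ kp).
have lamk : k%:R * lam = theta / 4 by rewrite /lam; field; lra.
have lam1 : lam <= 1 by nra.
pose kap := lam * eps ^+ 4 / 8; have kap0 : 0 < kap by rewrite /kap divr_gt0 // mulr_gt0 // exprn_gt0.
exists (A^-1 * expR (- (k%:R ^+ 2 / kap))), (1 + L%:R); split.
- by rewrite mulr_gt0 ?invr_gt0 ?expR_gt0.
- by rewrite addr_gt0 // ltr0n.
move=> T G S rr B S0 Hr kr B0 room.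
have [W [W0 WS Wmin]] := energy_min G k lam kap S0.
have Ssz : (0 < #|S|)%N by rewrite card_gt0.
have row e : \sum_(j | j != e) dens R G (W e) (W j) <= 1 - mu0.
  apply: le_trans (min_row lam0 lam1 kap0 W0 WS Wmin e Ssz Hr) _.
  rewrite mulrDr; have : k.-1%:R * lam <= k%:R * lam by rewrite ler_pM2r // ler_nat leq_pred.
  by rewrite /mu0; lra.
have reg i e (X Y : {set T}) : i != e -> Y \subset W i -> X \subset W e ->
  eps * #|W i|%:R <= #|Y|%:R -> eps * #|W e|%:R <= #|X|%:R ->
  `|dens R G Y X - dens R G (W i) (W e)| < eps.
  by move=> *; apply: (min_regular lam0 kap0 W0 WS Wmin) => //; rewrite e0 e1.
have keps := le_trans kE b1.
have eps4 := le_trans eb b4.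
have eps_mu : eps <= expR (- 8) / 2 * mu0.
  exact: le_trans eb (le_trans bA AM).
have B1 : 1 <= B%:R :> R by rewrite ler1n.
have Wsz e : #|S|%:R * expR (- (k%:R ^+ 2 / kap)) <= #|W e|%:R.
  exact: (min_size lam0 lam1 kap0 W0 WS Wmin).
have rho0 : 0 <= rho k B c by rewrite /rho mulr_ge0 ?invr_ge0 ?exprn_ge0 ?expR_ge0.
have h0 : 0 <= c1 * mu0 / 8 by rewrite -AE invr_ge0 ltW.
have hE : c_dense R * theta / 4 = c1 * mu0 / 8 by rewrite -c8 /mu0 -/c; field.
have room2 e : (1 + L%:R) * B%:R ^+ 2 <= A^-1 * #|W e|%:R * rho k B c * (c1 * mu0 / 8) ^+ B.
  apply: le_trans room _; rewrite hE -/c ler_wpM2r ?exprn_ge0 // ler_wpM2r //.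
  by rewrite -mulrA ler_wpM2l ?invr_ge0 ?(ltW A0) // mulrC Wsz.
have h1 : (c1 * mu0 / 8) ^+ B <= 1.
  exact: exprn_ile1.
have zE : k%:R * zeta k eps = b by rewrite -epsE /zeta; ring.
have z0 : 0 <= zeta k eps by rewrite /zeta mulr_ge0 ?(ltW e0) // mulr_ge0 // exprn_ge0.
apply: (@blowup_of_box R T G k W (bad G W eps [set: 'I_k]) (partner R G W)
   (mu R G W) mu0 c1 c A (zeta k eps) B L _ _ _ _ _ _ _ _ _ _ _ _ _ _ _ _ M b) => //.
- exact: (partnerK m0 row).
- move=> y e yW good.
  have := bad_extend W0 e0 m0 reg row keps eps4 eps_mu e yW good.
  by rewrite (_ : e |: [set: 'I_k] = [set: 'I_k]) //; apply/setP => i; rewrite !inE orbT.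
- by move=> y e C yW good eC pC; exact: (keep_light_nbrs e0 m0 row keps eps4 yW good eC pC).
- by move=> y e C pe yW good eC; exact: (keep_heavy_nbrs e0 m0 row keps eps4 eps_mu pe yW good eC).
- move=> e pe; apply: le_trans (few_high W0 e0 m0 reg row eps4 eps_mu pe) _.
  by rewrite ler_wpM2r // (le_trans eb bA).
- by move=> e pe; split; [exact: (mu_ge row) | exact: m0 | rewrite c8 | exact: A8 | exact: L2].
- move=> e; apply: le_trans (_ : (1 + L%:R) * B%:R ^+ 2 <= _).
    rewrite natrM mulrDl expr2; apply: ler_wpDl; first by rewrite mul1r mulr_ge0.
    by rewrite ler_wpM2l // ler_peMl.
  apply: le_trans (room2 e) _; rewrite ler_piMr // mulr_ge0 // mulr_ge0 // invr_ge0 ltW //.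
- move=> e _; apply: le_trans (room2 e).
  by rewrite -natr1 natrM mulrDr mulr1 mulrDl mul1r expr2 addrC mulrCA lerD2r ler_peMr.
- by have := nbad_full W0 e0 m0 reg row keps eps4 eps_mu; rewrite zE.
- by rewrite -zE ler_peMl.
- by rewrite /b mulrC divfK // lt0r_neq0 // (lt_le_trans _ KM).
Qed.


(** * The lower bound *)

Section Edges.
Variables (T : finType) (G : sgraph T).

Lemma set2_eq (a b u v : T) : a != b -> u != v ->
  ([set a; b] == [set u; v]) = ((a, b) == (u, v)) || ((a, b) == (v, u)).
Proof.
move=> ab uv; apply/eqP/orP => [E|[/eqP[-> ->]//|/eqP[-> ->]]]; last by rewrite setUC.
have : a \in [set u; v] by rewrite -E !inE eqxx.
have : b \in [set u; v] by rewrite -E !inE eqxx orbT.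
rewrite !inE => /orP[/eqP bE|/eqP bE] /orP[/eqP aE|/eqP aE]; rewrite aE bE ?eqxx; auto.
- by rewrite aE bE eqxx in ab.
- by rewrite aE bE eqxx in ab.
Qed.

Lemma card_edges : (#|[set p : T * T | G p.1 p.2]| = 2 * #|edges G|)%N.
Proof.
pose f (p : T * T) := [set p.1; p.2].
rewrite -sum1_card (partition_big f (mem (edges G))) /=; last first.
  by move=> p; rewrite inE => pG; apply: imset_f; rewrite inE.
rewrite mulnC -sum_nat_const; apply: eq_bigr => e /imsetP[[u v]]; rewrite inE /= => uv ->.
have uv' : u != v by apply: contraTneq uv => ->; rewrite adj_irr.
transitivity #|[set (u, v); (v, u)]|; last by rewrite cards2 xpair_eqE (negPf uv').
rewrite sum1dep_card; apply: eq_card => -[a b]; rewrite !inE /f /=; have [->|ab] := eqVneq a b.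
  rewrite adj_irr /= !xpair_eqE; apply/esym/negbTE; rewrite negb_or.
  by apply/andP; split; apply/negP => /andP[/eqP e1 /eqP e2]; rewrite -e1 -e2 eqxx in uv'.
rewrite (set2_eq ab uv') andb_idl // => /orP[] /eqP[-> ->] //.
by rewrite adj_sym.
Qed.

Lemma coedges_edges : (coedges G [set: T] [set: T] + 2 * #|edges G| = #|T| ^ 2)%N.
Proof.
have := sum_nb_coedges G [set: T] [set: T]; rewrite cardsT mulnn => <-; congr (_ + _)%N.
rewrite -card_edges -sum1dep_card.
rewrite -(pair_big_dep xpredT (fun u v => G u v) (fun _ _ => 1%N)) /=.
apply: eq_big => v; first by rewrite inE.
by move=> _; rewrite setIT sum1dep_card.
Qed.

End Edges.

Section Numerics.
Variable R : realType.
Implicit Types (x c h : R).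

Lemma polylog_le (K : R) (m : nat) : 0 <= K ->
  exists x0, 0 <= x0 /\ forall x, x0 <= x -> K * (1 + x) ^+ m <= expR (x / 2).
Proof.
move=> K0; pose a : R := 4 * m.+1%:R; have a4 : 4 <= a by rewrite /a ler_peMr // ler1n.
have a0 : 0 < a by lra.
have am0 : 0 <= K * a ^+ m by rewrite mulr_ge0 // exprn_ge0 // ltW.
exists (4 * (K * a ^+ m)); split; first by rewrite mulr_ge0.
move=> x x0; have xp : 0 <= x by apply: le_trans x0; rewrite mulr_ge0.
have h1 : (1 + x) ^+ m <= a ^+ m * expR (x / 4).
  apply: (@le_trans _ _ ((a * expR (x / a)) ^+ m)).
    rewrite lerXn2r ?nnegrE ?mulr_ge0 ?expR_ge0 ?(ltW a0) ?addr_ge0 //.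
    have := ler_wpM2l (ltW a0) (expR_ge1Dx (x / a)); apply: le_trans.
    by rewrite mulrDr mulr1 mulrCA divff ?lt0r_neq0 // mulr1; lra.
  rewrite exprMn ler_wpM2l ?exprn_ge0 ?(ltW a0) // -expRM_natl ler_expR.
  rewrite mulrA ler_pdivrMr // mulrAC ler_pdivlMr // mulrC mulrA [X in _ <= X]mulrC ler_wpM2r //.
  by rewrite /a ler_wpM2l // ler_nat.
apply: (@le_trans _ _ (K * a ^+ m * expR (x / 4))).
  by rewrite -mulrA ler_wpM2l.
have -> : x / 2 = x / 4 + x / 4 by field.
rewrite expRD ler_wpM2r ?expR_ge0 //; have := expR_ge1Dx (x / 4); lra.
Qed.

(** With x = ln n: as long as the rate of loss times B is at most x / 2, the
    candidates left are a proportion n^(-1/2) up to powers of B, which is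
    a power of x, so that n^(1/2) beats all constants. *)
Lemma room_enough (k : nat) (c h eta sig L Q : R) :
  0 < h -> 0 < eta -> 0 < sig -> 0 <= L -> 0 <= Q ->
  exists x0, 0 <= x0 /\ forall x (B : nat) (s : R), x0 <= x -> B%:R <= Q * x ->
    sig * expR x <= s ->
    B%:R * (ln c^-1 * ln ((2 * k)%:R / c) + ln h^-1) <= x / 2 ->
    L * B%:R ^+ 2 <= eta * s * rho k B c * h ^+ B.
Proof.
move=> h0 e0 s0 L0 Q0.
have K0 : 0 <= L / (eta * sig) * (Q + 1) ^+ (k + 2).
  by rewrite mulr_ge0 ?divr_ge0 ?mulr_ge0 ?(ltW e0) ?(ltW s0) // exprn_ge0 // addr_ge0.
have [x0 [x00 Hx]] := polylog_le (k + 2) K0; exists x0; split => // x B s xx BQ sx cost.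
have xp : 0 <= x by apply: le_trans xx.
have hE : h ^+ B = expR (- (B%:R * ln h^-1)).
  by rewrite lnV ?posrE // mulrN opprK -[h in LHS]lnK ?posrE // -expRM_natl.
have Bp : 0 < B.+1%:R :> R by rewrite ltr0n.
have Bk : 0 < B.+1%:R ^+ k :> R by rewrite exprn_gt0.
have -> : eta * s * rho k B c * h ^+ B =
    eta * s * (B.+1%:R ^+ k)^-1 * expR (- (B%:R * (ln c^-1 * ln ((2 * k)%:R / c) + ln h^-1))).
  by rewrite /rho hE mulrDr opprD expRD !mulrA.
apply: (@le_trans _ _ (eta * (sig * expR x) * (B.+1%:R ^+ k)^-1 * expR (- (x / 2)))); last first.
  apply: ler_pM; rewrite ?mulr_ge0 ?expR_ge0 ?invr_ge0 ?(ltW Bk) ?(ltW e0) ?(ltW s0) //.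
    by rewrite ler_pM2r ?invr_gt0 // ler_pM2l.
  by rewrite ler_expR lerN2.
have -> : eta * (sig * expR x) * (B.+1%:R ^+ k)^-1 * expR (- (x / 2)) =
   eta * sig * expR (x / 2) / B.+1%:R ^+ k.
  have -> : expR x = expR (x / 2) * expR (x / 2) by rewrite -expRD; congr expR; field.
  by rewrite expRN; field; rewrite !lt0r_neq0 ?expR_gt0.
rewrite ler_pdivlMr // -ler_pdivrMl ?mulr_gt0 //; apply: le_trans (Hx x xx).
have B1 : B.+1%:R <= (Q + 1) * (1 + x) by rewrite -natr1; move: BQ; nra.
have -> : (eta * sig)^-1 * (L * B%:R ^+ 2 * B.+1%:R ^+ k) =
   L / (eta * sig) * (B%:R ^+ 2 * B.+1%:R ^+ k) by ring.
rewrite -[X in _ <= X]mulrA -exprMn ler_wpM2l ?divr_ge0 ?mulr_ge0 ?(ltW e0) ?(ltW s0) //.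
apply: (@le_trans _ _ (B.+1%:R ^+ (k + 2))).
  rewrite exprD mulrC ler_wpM2l ?(ltW Bk) // lerXn2r ?nnegrE //.
  by rewrite ler_nat.
by rewrite lerXn2r ?nnegrE ?mulr_ge0 ?addr_ge0.
Qed.

Lemma truncn_half x : 1 <= x -> x / 2 <= (Num.truncn x)%:R.
Proof.
move=> x1; have x0 : 0 <= x by lra.
have := truncnS_gt x; have : 1 <= (Num.truncn x)%:R :> R.
  by rewrite ler1n truncn_gt0.
by rewrite -natr1; lra.
Qed.

Lemma ln2_ge : 2^-1 <= ln 2 :> R.
Proof.
have h : -1 < - 2^-1 :> R by lra.
have := le_ln1Dx h; have -> : 1 + - 2^-1 = 2^-1 :> R by lra.
by rewrite lnV ?posrE //; lra.
Qed.

End Numerics.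

(** Parts of a complete multipartite subgraph are disjoint because G has no loops. *)
Lemma copy_of_parts (R : realType) (T : finType) (G : sgraph T) (k b : nat) (s : R) :
  complete_parts G k s -> b%:R <= s -> contains_copy (blowup k b) G.
Proof.
move=> [V [Vs VG]] bs.
have Vb i : (b <= #|V i|)%N by rewrite -(ler_nat R); apply: le_trans (Vs i).
pose f (p : 'I_k * 'I_b) := enum_val (widen_ord (Vb p.1) p.2).
have fV p : f p \in V p.1 by apply: enum_valP.
exists f; split => [[i x] [j y] fE|p q pq]; last by apply: VG pq (fV p) (fV q).
have ij : i = j.
  apply/eqP; apply: contraT => ij.
  by have := VG i j _ _ ij (fV (i, x)) (fV (j, y)); rewrite fE adj_irr.
move: fE; rewrite -{j}ij /f /= => /enum_val_inj h; congr (_, _).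
by apply: val_inj; have := congr1 val h.
Qed.

Lemma double_succ_le_cube (r : nat) : (2 <= r)%N -> (2 * r.+1 <= r ^ 3)%N.
Proof.
move=> r2; apply: (@leq_trans (2 ^ 2 * r)%N); first by lia.
by rewrite (expnSr r) leq_mul2r (leq_expn2r 2 r2) orbT.
Qed.

Section Lower.
Variable R : realType.

Lemma c_dense_bounds : 0 < c_dense R /\ c_dense R <= 16^-1.
Proof.
have E0 : 0 < expR (- 8) :> R := expR_gt0 _.
have E1 : expR (- 8) <= 1 :> R by rewrite expR_le1; lra.
by rewrite /c_dense; split; lra.
Qed.

(** The vertices of a graph with few non-edges contain a set of linear size that
    is dense at every vertex. *)
Lemma dense_core (r : nat) (eps : R) : (2 <= r)%N -> 0 < eps -> eps < 1 ->
  exists sig x0 rr : R, [/\ 0 < sig, 0 <= rr, r%:R * rr <= 2 * eps /\ r%:R * rr <= 1 - (1 - eps) / 2 &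
  forall n (G : sgraph 'I_n), (0 < n)%N -> x0 <= ln n%:R ->
    (1 - eps / r%:R) * n%:R ^+ 2 / 2 <= #|edges G|%:R ->
    exists S : {set 'I_n}, sig * n%:R <= #|S|%:R /\ forall v, v \in S -> (codeg G S v)%:R <= rr * #|S|%:R].
Proof.
move=> r2 e0 e1; have rp : 2 <= r%:R :> R by rewrite ler_nat.
pose m := Num.min eps ((1 - eps) / 2).
have m0 : 0 < m by rewrite lt_min e0; lra.
have m1 : m <= eps by rewrite ge_min lexx.
have m2 : m <= (1 - eps) / 2 by rewrite ge_min lexx orbT.
pose kap := m / r%:R; have kap0 : 0 < kap by rewrite divr_gt0 //; lra.
have kapr : r%:R * kap = m by rewrite /kap mulrC divfK //; apply: lt0r_neq0; lra.
have kap2 : kap <= 2^-1 by nra.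
pose q := eps / r%:R; have qr : r%:R * q = eps by rewrite /q mulrC divfK //; apply: lt0r_neq0; lra.
have q0 : 0 <= q by nra.
have q1 : q <= 1 by nra.
exists (expR (- kap^-1)), (ln kap^-1 + kap^-1), (q + kap); split.
- exact: expR_gt0.
- by lra.
- by rewrite mulrDr qr kapr; split; lra.
move=> n G n0 xn dens; have np : 0 < n%:R :> R by rewrite ltr0n.
have := @regular_core R 'I_n G kap q kap0 kap2; rewrite q0 q1 card_ord => /(_ isT n0) core.
have [||S [Ssz Sc]] := core.
- have := congr1 (fun n : nat => n%:R : R) (coedges_edges G).
  rewrite natrD natrM natrX card_ord => E.
  have -> : (coedges G [set: 'I_n] [set: 'I_n])%:R = n%:R ^+ 2 - 2 * #|edges G|%:R :> R by rewrite -E addrK.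
  by move: dens; rewrite -/q; lra.
- rewrite mulrC -ler_pdivrMr // div1r -[X in X <= _]lnK ?posrE ?invr_gt0 //.
  by rewrite -[n%:R]lnK ?posrE // -expRD ler_expR; lra.
by exists S; split => //; rewrite mulrC.
Qed.

Lemma ln_parts (r : nat) (l : R) : (2 <= r)%N -> ln r%:R <= l ->
  2^-1 <= l /\ ln (2 * r.+1)%:R <= 3 * l.
Proof.
move=> r2 lr; have rp : 0 < r%:R :> R by rewrite ltr0n; apply: leq_trans r2.
split; first by apply: le_trans lr; apply: le_trans (ln2_ge R) _; rewrite ler_ln ?posrE // ler_nat.
apply: (@le_trans _ _ (3 * ln r%:R)); last by rewrite ler_pM2l.
rewrite mulr_natl -lnXn // ler_ln ?posrE ?ltr0n ?exprn_gt0 //.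
by rewrite -natrX ler_nat double_succ_le_cube.
Qed.

(** The loss ln (1 / c) is proportional to eps, and ln (2k / c) to ln r. *)
Lemma rate_sparse (r : nat) (eps l : R) : (2 <= r)%N -> 0 < eps -> eps <= 8^-1 ->
  ln r%:R <= l ->
  ln (1 - 2 * (2 * eps))^-1 * ln ((2 * r.+1)%:R / (1 - 2 * (2 * eps))) <= 40 * (eps * l).
Proof.
move=> r2 e0 small /(ln_parts r2)[l2 lnk]; set c := 1 - _.
have cc : 2^-1 <= c by rewrite /c; lra.
have ci : c^-1 <= 2 by rewrite -[2]invrK lef_pV2 ?posrE //; lra.
have ci1 : 1 <= c^-1 by rewrite -invr1 lef_pV2 ?posrE // /c; lra.
have l1 : ln c^-1 <= 8 * eps.
  have h : -1 < c^-1 - 1 by lra.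
  have := le_ln1Dx h; rewrite addrC subrK => /le_trans; apply.
  have : c * c^-1 = 1 by rewrite divff // lt0r_neq0 //; lra.
  by rewrite {1}/c; nra.
have l0 : 0 <= ln c^-1 by rewrite ln_ge0.
have h2 : ln ((2 * r.+1)%:R / c) <= 5 * l.
  rewrite lnM ?posrE ?ltr0n ?invr_gt0 //; last by lra.
  have : ln c^-1 <= 1 by lra.
  by lra.
have h3 : 0 <= ln ((2 * r.+1)%:R / c).
  have n1 : 1 <= (2 * r.+1)%:R :> R by rewrite ler1n muln_gt0.
  rewrite ln_ge0 //; have : 1 * 1 <= (2 * r.+1)%:R / c by apply: ler_pM.
  by rewrite mulr1.
apply: (@le_trans _ _ (8 * eps * (5 * l))); first exact: ler_pM.
by rewrite le_eqVlt; apply/orP; left; apply/eqP; ring.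
Qed.

Lemma rate_dense (r : nat) (delta theta D : R) : (2 <= r)%N -> D = ln (c_dense R)^-1 -> 0 < theta -> 0 < delta ->
  delta <= theta -> ln r%:R <= ln delta^-1 ->
  ln (c_dense R)^-1 * ln ((2 * r.+1)%:R / c_dense R) + ln (c_dense R * theta / 4)^-1 <=
    (D * (3 + 2 * D) + 2 * D + 7) * ln delta^-1.
Proof.
move=> r2 DE th0 d0 thd lr; have [l2 lnk] := ln_parts r2 lr.
set l := ln delta^-1 in lr l2 lnk *.
have [cd0 cd1] := c_dense_bounds.
have D0 : 0 <= D.
  by rewrite DE ln_ge0 // -[X in X <= _]invr1 lef_pV2 ?posrE //; lra.
rewrite lnM ?posrE ?ltr0n ?invr_gt0 // -DE.
have -> : (c_dense R * theta / 4)^-1 = (c_dense R)^-1 * (theta^-1 * 4).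
  by field; rewrite !lt0r_neq0.
rewrite lnM ?posrE ?mulr_gt0 ?invr_gt0 // lnM ?posrE ?invr_gt0 // -DE.
have lt : ln theta^-1 <= l by rewrite /l ler_ln ?posrE ?invr_gt0 // lef_pV2 ?posrE.
have l4 : ln 4 <= 3 :> R.
  by have h : -1 < 3 :> R; [lra | have := le_ln1Dx h; rewrite (_ : 1 + 3 = 4 :> R) //; lra].
have t1 : D * (ln (2 * r.+1)%:R + D) <= D * ((3 + 2 * D) * l).
  apply: ler_wpM2l => //; have : D * 1 <= D * (2 * l) by rewrite ler_wpM2l //; lra.
  by lra.
have t2 : D * 1 <= D * (2 * l) by rewrite ler_wpM2l //; lra.
by lra.
Qed.

(** For eps at most 1/8 the rate of loss is of order eps l with l = ln (1 / delta);
    otherwise it is of order l, which is the same. *)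
Lemma lower_bound : exists c : R, 0 < c /\
  forall (r : nat) (delta : R), (2 <= r)%N -> 0 < delta -> delta < r%:R^-1 ->
  exists x0 : R, forall n : nat, (0 < n)%N -> x0 <= ln n%:R ->
  exists b : nat, [/\ (0 < b)%N, forces_blowup n r delta b &
    c * (ln n%:R / ((r%:R^-1 - delta) * r%:R * ln delta^-1)) <= b%:R].
Proof.
have [cd0 cd1] := c_dense_bounds.
pose D : R := ln (c_dense R)^-1; pose KD := 8 * (D * (3 + 2 * D) + 2 * D + 7).
have D0 : 0 <= D.
  by rewrite /D ln_ge0 // -[X in X <= _]invr1 lef_pV2 ?posrE //; lra.
have KD0 : 56 <= KD.
  by have : 0 <= D * (3 + 2 * D); [apply: mulr_ge0; lra | rewrite /KD; lra].
have KDE : D * (3 + 2 * D) + 2 * D + 7 = 8^-1 * KD by rewrite /KD; field.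
have KDp : 0 < KD by lra.
clearbody KD.
pose c0 : R := (2 * KD)^-1; have c00 : 0 < c0 by rewrite invr_gt0; lra.
have c0K : c0 * KD = 2^-1 by rewrite /c0; field; lra.
pose t0 : R := tau (c_dense R); have t00 : 0 < t0 by apply: tau_gt0.
exists (c0 * t0 / 4); split; first by rewrite divr_gt0 // mulr_gt0.
move=> r delta r2 d0 dr; have rp : 2 <= r%:R :> R by rewrite ler_nat.
have r0 : 0 < r%:R :> R by lra.
pose eps := (r%:R^-1 - delta) * r%:R; pose l : R := ln delta^-1.
have epsE : eps = 1 - r%:R * delta by rewrite /eps mulrBl mulVf ?lt0r_neq0 // mulrC.
have e0 : 0 < eps by rewrite /eps mulr_gt0 // subr_gt0.
have e1 : eps < 1 by rewrite epsE gtrBl mulr_gt0.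
have rd : r%:R < delta^-1 by rewrite -[r%:R]invrK ltf_pV2 ?posrE ?invr_gt0.
have lr : ln r%:R <= l by rewrite /l ler_ln ?posrE ?invr_gt0 // ltW.
have l2 : 2^-1 <= l.
  by apply: le_trans lr; apply: le_trans (ln2_ge R) _; rewrite ler_ln ?posrE.
have el : 0 < eps * l by rewrite mulr_gt0 //; lra.
have [sig [x1 [rr [sig0 rr0 [rr2 rr1] core]]]] := dense_core r2 e0 e1.
pose Q := c0 / (eps * l); have Q0 : 0 <= Q by rewrite divr_ge0 // ltW.
pose Xof x := x / (eps * l).
(* The part sizes found below are at least t0 times the integer part of c0 X. *)
suff [x2 found] : exists x2 : R, forall n (G : sgraph 'I_n), (0 < n)%N -> x2 <= ln n%:R ->
    (1 - eps / r%:R) * n%:R ^+ 2 / 2 <= #|edges G|%:R ->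
    complete_parts G r.+1 (t0 * (Num.truncn (c0 * Xof (ln n%:R)))%:R).
  exists (Num.max x2 (4 / (c0 * t0) * (eps * l))) => n n0.
  rewrite ge_max => /andP[xn2 xn3].
  have X1 : 4 <= c0 * t0 * Xof (ln n%:R).
    rewrite /Xof mulrA ler_pdivlMr //; move: xn3; rewrite mulrAC ler_pdivrMr ?mulr_gt0 //.
    by rewrite [_ * (c0 * t0)]mulrC.
  have t01 : t0 <= 1.
    have : c_dense R ^+ 2 <= 1 by apply: exprn_ile1; lra.
    by rewrite /t0 /tau; lra.
  set X := Xof (ln n%:R) in X1 *.
  have X2 : 4 <= c0 * X.
    have tX : c0 * t0 * X = t0 * (c0 * X) by ring.
    have cX : 0 <= c0 * X by rewrite -(pmulr_rge0 _ t00) -tX; lra.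
    by apply: le_trans X1 _; rewrite tX ler_piMl.
  set B := Num.truncn (c0 * X).
  have hB : c0 * X / 2 <= B%:R by apply: truncn_half; lra.
  exists (Num.truncn (t0 * B%:R)).
  have tB : 1 <= t0 * B%:R by nra.
  split.
  - by rewrite truncn_gt0.
  - move=> G; have -> : 1 - r%:R^-1 + delta = 1 - eps / r%:R.
      by rewrite epsE; field; exact: lt0r_neq0.
    move=> dens; apply: copy_of_parts (found n G n0 xn2 dens) _.
    by rewrite truncn_le //; lra.
  - by have := truncn_half tB; rewrite -/(Xof (ln n%:R)) -/X; nra.
have cost x : c0 * Xof x * (KD * (eps * l)) = x / 2.
  by rewrite /Xof -[x / 2]mulrC -c0K; field; rewrite !lt0r_neq0 //; lra.
have wrap (c h eta L : R) : 0 < h -> 0 < eta -> 0 <= L ->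
    ln c^-1 * ln ((2 * r.+1)%:R / c) + ln h^-1 <= KD * (eps * l) ->
    (forall n (G : sgraph 'I_n) (S : {set 'I_n}) (B : nat), S != set0 ->
      (forall v, v \in S -> (codeg G S v)%:R <= rr * #|S|%:R) -> (0 < B)%N ->
      L * B%:R ^+ 2 <= eta * #|S|%:R * rho r.+1 B c * h ^+ B ->
      complete_parts G r.+1 (t0 * B%:R)) ->
    exists x2 : R, forall n (G : sgraph 'I_n), (0 < n)%N -> x2 <= ln n%:R ->
    (1 - eps / r%:R) * n%:R ^+ 2 / 2 <= #|edges G|%:R ->
    complete_parts G r.+1 (t0 * (Num.truncn (c0 * Xof (ln n%:R)))%:R).
  move=> h0 eta0 L0 rate parts.
  have [x2 [x20 room]] := room_enough r.+1 c h0 eta0 sig0 L0 Q0.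
  exists (Num.max (Num.max x1 x2) (4 / c0 * (eps * l))) => n G n0.
  rewrite !ge_max -andbA => /and3P[xn1 xn2 xn3] dens.
  have np : 0 < n%:R :> R by rewrite ltr0n.
  have [S [Ssz Sdeg]] := core n G n0 xn1 dens.
  set x := ln n%:R in xn1 xn2 xn3 *; set B := Num.truncn _.
  have X1 : 4 <= c0 * Xof x.
    rewrite /Xof mulrA ler_pdivlMr //; move: xn3; rewrite mulrAC ler_pdivrMr //.
    by rewrite [_ * c0]mulrC.
  have B0 : (0 < B)%N by rewrite truncn_gt0 (le_trans _ X1) // ler1n.
  have Ble : B%:R <= c0 * Xof x by rewrite truncn_le // (le_trans _ X1).
  have nE : n%:R = expR x by rewrite /x lnK.
  have S0 : S != set0.
    by rewrite -card_gt0 -(ltr0n R); apply: lt_le_trans Ssz; rewrite mulr_gt0.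
  apply: (parts n G S) => //; apply: room xn2 _ _ _.
  - by apply: le_trans Ble _; rewrite /Q /Xof mulrCA mulrC lexx.
  - by rewrite -nE.
  rewrite -(cost x); apply: (@le_trans _ _ (B%:R * (KD * (eps * l)))).
    by rewrite ler_wpM2l.
  by rewrite ler_wpM2r // mulr_ge0 // ltW.
have [small|large] := leP eps 8^-1.
- apply: (wrap (1 - 2 * (2 * eps)) 1 (2 * eps / 4) 1) => //; [lra | | ].
    rewrite invr1 ln1 addr0; apply: le_trans (rate_sparse r2 e0 small lr) _.
    by rewrite ler_pM2r //; lra.
  move=> n G S B S0 Sdeg B0; rewrite expr1n mulr1 mul1r => room.
  have [V [Vs VG]] : complete_parts G r.+1 (tau (1 - 2 * (2 * eps)) * B%:R).
    have x0 : 0 < 2 * eps by rewrite mulr_gt0.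
    have x4 : 2 * eps <= 4^-1 by clear -small; lra.
    apply: (parts_near_complete (ltn0Sn r) S0 x0 x4 Sdeg rr0 rr2 B0).
    by apply: le_trans room; rewrite expr2 ler_peMl // ler1n.
  exists V; split => // i; apply: le_trans (Vs i).
  rewrite ler_wpM2r // /t0 /tau; clear -small cd0 cd1.
  by rewrite ler_pM2r // lerXn2r ?nnegrE; lra.
pose theta := 1 - eps.
have th0 : 0 < theta by rewrite /theta; lra.
have th1 : theta <= 1 by rewrite /theta; lra.
have thd : delta <= theta.
  by rewrite /theta epsE subKr ler_peMl ?(ltW d0) // (le_trans _ rp) // ler1n.
have [eta [L [eta0 L0 parts]]] := @parts_dense R r.+1 theta isT th0 th1.
have h0 : 0 < c_dense R * theta / 4 by rewrite divr_gt0 // mulr_gt0.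
apply: (wrap (c_dense R) (c_dense R * theta / 4) eta L) => //; first exact: ltW.
  apply: le_trans (rate_dense r2 (erefl D) th0 d0 thd lr) _.
  rewrite -/l KDE (_ : 8^-1 * KD * l = KD * (8^-1 * l)); last by ring.
  by rewrite ler_pM2l // ler_wpM2r ?(ltW large) // (le_trans _ l2) // invr_ge0.
by move=> n G S B S0 Sdeg B0 room; apply: (parts _ G S rr B) => //; rewrite /theta; lra.
Qed.

End Lower.

(** * Random points in a product space *)

(** Every vertex is a random point of the grid with M values in D coordinates, and
    two vertices are adjacent when they differ in all coordinates.  The average
    number of non-neighbours is about n D / M, while a blow-up has to respect the
    pigeonhole principle in every coordinate separately. *)
Section RandomPoints.
Variables (n k b D M : nat).
Hypotheses (n1 : (1 < n)%N) (k1 : (1 < k)%N) (b0 : (0 < b)%N) (M0 : (0 < M)%N).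
Hypotheses (big_parts : (2 * M <= k * b)%N) (big_dim : (n ^ 4 <= k ^ D)%N).

Local Notation Omega := {ffun 'I_D * 'I_n -> 'I_M}.
Local Notation vert := ('I_k * 'I_b)%type.
Implicit Types (w : Omega) (f : {ffun vert -> 'I_n}).

Definition apart w : rel 'I_n :=
  fun u v => (u != v) && [forall d, w (d, u) != w (d, v)].

Lemma apart_sym w : symmetric (apart w).
Proof.
by move=> u v; rewrite /apart eq_sym; congr (_ && _); apply: eq_forallb => d; rewrite eq_sym.
Qed.

Lemma apart_irr w : irreflexive (apart w).
Proof. by move=> u; rewrite /apart eqxx. Qed.

Definition point_graph w : sgraph 'I_n := SGraph (apart_sym w) (apart_irr w).

Lemma prod_le_AGM (I : finType) (m : I -> nat) (s : nat) : (\sum_i m i <= s)%N ->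
  ((\prod_i m i) * #|I| ^ #|I| <= s ^ #|I|)%N.
Proof.
move=> ms; rewrite -[X in (_ * _ ^ X)%N]/#|I| -prod_nat_const -big_split /=.
apply: leq_trans (_ : (\sum_i m i) ^ #|I| <= _)%N; last exact: leq_expn2r.
have E0 : {in predT, forall i : I, 0 <= (m i)%:R *+ #|(predT : pred I)| :> int}.
  by move=> i _; rewrite mulrn_wge0.
have [le _] := leif_AGM_scaled E0.
rewrite -(ler_nat int) natr_prod natrX natr_sum.
apply: le_trans le; rewrite le_eqVlt; apply/orP; left; apply/eqP.
by apply: eq_bigr => i _; rewrite natrM mulr_natr.
Qed.

(** If a fixed family of vertices spans a blow-up, then in each coordinate every
    value is used by at most one part.  For a fixed assignment of the M values to
    the k parts the number of choices is largest when every part gets M / k of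
    them. *)
Lemma count_spread f : injective f ->
  (#|[set w : Omega | [forall p, forall q, (p.1 != q.1) ==> apart w (f p) (f q)]]|
     * k ^ (D * (k * b)) <= k ^ (D * M) * M ^ (D * n))%N.
Proof.
move=> injf; set S := [set w | _].
pose F (c : {ffun 'I_D * 'I_M -> 'I_k}) (x : 'I_D * 'I_n) : pred 'I_M :=
  [pred a | [forall p, (f p == x.2) ==> (c (x.1, a) == p.1)]].
have k0 : (0 < k)%N by apply: ltnW.
pose i0 := Ordinal k0.
have sub : S \subset \bigcup_(c : {ffun 'I_D * 'I_M -> 'I_k}) [set w : Omega | w \in family (F c)].
  apply/subsetP => w; rewrite inE => /forallP Hw.
  pose c : {ffun 'I_D * 'I_M -> 'I_k} := [ffun x =>
    if [pick p | w (x.1, f p) == x.2] is Some p then p.1 else i0].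
  apply/bigcupP; exists c => //; rewrite inE; apply/familyP => -[d v].
  rewrite inE; apply/forallP => p; apply/implyP => /= /eqP <-; rewrite ffunE /=.
  case: pickP => [q /eqP qE|/(_ p)]; last by rewrite eqxx.
  apply: contraT => qp; have /forallP/(_ p) := Hw q; rewrite qp /= => /andP[_ /forallP/(_ d)].
  by rewrite qE eqxx.
have famc (c : {ffun 'I_D * 'I_M -> 'I_k}) :
    (#|[set w : Omega | w \in family (F c)]| * k ^ (D * (k * b)) <= M ^ (D * n))%N.
  rewrite cardsE card_family foldrE big_map big_enum /=.
  pose P := [set x : 'I_D * 'I_n | x.2 \in f @: [set: vert]].
  rewrite (bigID (mem P)) /=.
  have outP : (\prod_(x | x \notin P) #|F c x| <= M ^ (D * n - D * (k * b)))%N.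
    have -> : (D * n - D * (k * b) = #|[predC P]|)%N.
      have := cardC P; rewrite card_prod !card_ord => <-.
      suff -> : (#|P| = D * (k * b))%N by rewrite addKn.
      have -> : P = setX [set: 'I_D] (f @: [set: vert]).
        by apply/setP => -[d v]; rewrite !inE.
      by rewrite cardsX cardsT card_ord card_imset // cardsT card_prod !card_ord.
    rewrite -prod_nat_const; apply: leq_prod => x _.
    by rewrite -[X in (_ <= X)%N]card_ord max_card.
  have inP : (\prod_(x | x \in P) #|F c x| =
     \prod_(d < D) \prod_(i < k) #|[pred a | c (d, a) == i]| ^ b)%N.
    rewrite (eq_bigl (fun x : 'I_D * 'I_n => xpredT x.1 && (x.2 \in f @: [set: vert]))); last first.
      by move=> x; rewrite inE.
    rewrite -(pair_big xpredT (fun v => v \in f @: [set: vert]) (fun d v => #|F c (d, v)|)) /=.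
    apply: eq_bigr => d _; rewrite big_imset /=; last by move=> p q _ _; apply: injf.
    rewrite (eq_bigl xpredT); last by move=> p; rewrite inE.
    rewrite (eq_bigr (fun p : vert => #|[pred a | c (d, a) == p.1]|)); last first.
      move=> p _; apply: eq_card => a; rewrite !inE /=.
      apply/forallP/eqP => [/(_ p)|cp q]; first by rewrite eqxx => /eqP.
      by apply/implyP => /eqP/injf ->; rewrite cp.
    rewrite -(pair_bigA _ (fun (i : 'I_k) (x : 'I_b) => #|[pred a | c (d, a) == i]|)) /=.
    by apply: eq_bigr => i _; rewrite prod_nat_const card_ord.
  have kbn : (k * b <= n)%N.
    by have := leq_card f injf; rewrite card_prod !card_ord.
  apply: (@leq_trans (M ^ (D * (k * b)) * M ^ (D * n - D * (k * b)))%N); last first.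
    by rewrite -expnD subnKC // leq_mul2l kbn orbT.
  rewrite mulnAC leq_mul // inP.
  have kE e : (e ^ (D * (k * b)) = \prod_(d < D) (e ^ k) ^ b)%N.
    by rewrite prod_nat_const card_ord -!expnM; congr (_ ^ _)%N; rewrite mulnC mulnA.
  rewrite !kE -big_split /=; apply: leq_prod => d _.
  rewrite -(big_morph (fun x => x ^ b)%N (fun x y => expnMn x y b) (exp1n b)) -expnMn.
  apply: leq_expn2r.
  have := @prod_le_AGM 'I_k (fun i => #|[pred a | c (d, a) == i]|) M; rewrite card_ord; apply.
  rewrite -[X in (_ <= X)%N](card_ord M) -sum1_card (partition_big (fun a => c (d, a)) xpredT) //=.
  by apply: leq_sum => i _; rewrite sum1_card.
apply: (@leq_trans (\sum_(c : {ffun 'I_D * 'I_M -> 'I_k}) (#|[set w : Omega | w \in family (F c)]| * k ^ (D * (k * b))))%N).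
  rewrite -big_distrl /= leq_mul2r; apply/orP; right.
  exact: leq_trans (subset_leq_card sub) (card_bigcup_le _ _).
apply: (@leq_trans (\sum_(c : {ffun 'I_D * 'I_M -> 'I_k}) M ^ (D * n))%N); first exact: leq_sum.
by rewrite sum_nat_const card_ffun card_prod !card_ord.
Qed.

(** In one coordinate, overwriting the value at u by an arbitrary one is injective
    on the configurations that agree at u and v. *)
Lemma count_close u v : u != v ->
  (#|[set w | ~~ apart w u v]| * M <= D * M ^ (D * n))%N.
Proof.
move=> uv.
have one d : (#|[set w : Omega | w (d, u) == w (d, v)]| * M <= M ^ (D * n))%N.
  set E := [set w | _].
  pose g (x : Omega * 'I_M) : Omega := [ffun y => if y == (d, u) then x.2 else x.1 y].
  have inj : {in setX E [set: 'I_M] &, injective g}.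
    move=> [w a] [w' a']; rewrite !inE /= !andbT => /eqP wE /eqP wE' /ffunP gE.
    have aE : a = a' by have := gE (d, u); rewrite !ffunE eqxx.
    congr (_, _) => //; apply/ffunP => y; have := gE y; rewrite !ffunE.
    case: eqP => [->|//] _; rewrite wE wE'; have := gE (d, v); rewrite !ffunE.
    by rewrite xpair_eqE eqxx /= eq_sym (negPf uv).
  have := card_in_imset inj; rewrite cardsX cardsT card_ord => <-.
  have -> : (M ^ (D * n) = #|[set: Omega]|)%N by rewrite cardsT card_ffun card_prod !card_ord.
  by apply: subset_leq_card; apply/subsetP => w; rewrite inE.
apply: (@leq_trans (\sum_(d < D) #|[set w : Omega | w (d, u) == w (d, v)]| * M)%N).
  rewrite -big_distrl leq_mul2r; apply/orP; right.
  apply: leq_trans (card_bigcup_le _ _); apply: subset_leq_card; apply/subsetP => w.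
  rewrite inE /apart uv /= negb_forall => /existsP[d]; rewrite negbK => h.
  by apply/bigcupP; exists d; rewrite // inE.
by rewrite -[X in (_ <= X * _)%N]card_ord -sum_nat_const; apply: leq_sum => d _; apply: one.
Qed.

Lemma sum_coedges :
  (\sum_(w : Omega) coedges (point_graph w) [set: 'I_n] [set: 'I_n] * M <=
   M ^ (D * n) * (n * M + n ^ 2 * D))%N.
Proof.
have tot : (#|[set: Omega]| = M ^ (D * n))%N by rewrite cardsT card_ffun card_prod !card_ord.
have -> : (\sum_(w : Omega) coedges (point_graph w) [set: 'I_n] [set: 'I_n] * M =
   \sum_u \sum_v #|[set w | ~~ apart w u v]| * M)%N.
  rewrite -big_distrl /= [RHS](eq_bigr (fun u => (\sum_v #|[set w | ~~ apart w u v]|) * M)%N); last first.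
    by move=> u _; rewrite -big_distrl.
  rewrite -big_distrl /=; congr (_ * _)%N; rewrite /coedges.
  rewrite exchange_big /=; apply: eq_big => [u|u _]; first by rewrite inE.
  rewrite exchange_big /=; apply: eq_big => [v|v _]; first by rewrite inE.
  rewrite -sum1dep_card [RHS]big_mkcond /=.
  by apply: eq_bigr => w _; case: (apart w u v).
apply: (@leq_trans (\sum_(u < n) (M ^ (D * n) * M + n * (D * M ^ (D * n))))%N); last first.
  rewrite sum_nat_const card_ord; apply: eq_leq; ring.
apply: leq_sum => u _; rewrite (bigD1 u) //= leq_add //.
  by rewrite leq_mul2r -tot subset_leq_card ?orbT //; apply/subsetP => w; rewrite inE.
apply: (@leq_trans (\sum_(v < n | v != u) D * M ^ (D * n))%N).
  by apply: leq_sum => v vu; rewrite count_close // eq_sym.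
by rewrite sum_nat_const leq_mul2r -[X in (_ <= X)%N]card_ord max_card orbT.
Qed.

(** A union bound.  The loss k^(DM) from choosing the owners of the values is at most
    the square root of the gain k^(Dkb), and the number n^(kb) of vertex families
    is at most its fourth root. *)
Lemma count_copies :
  (2 * #|[set w : Omega | [exists f : {ffun vert -> 'I_n}, injectiveb f &&
      [forall p, forall q, (p.1 != q.1) ==> apart w (f p) (f q)]]]| < M ^ (D * n))%N.
Proof.
set S := [set w | _]; pose Z := (k ^ (D * (k * b)))%N; pose A := (k ^ (D * M))%N.
pose N := (n ^ (k * b))%N; pose tot := (M ^ (D * n))%N; rewrite -/tot.
have k0 : (0 < k)%N by apply: ltnW.
have tot0 : (0 < tot)%N by rewrite expn_gt0 M0.
have Z0 : (0 < Z)%N by rewrite expn_gt0 k0.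
have A0 : (0 < A)%N by rewrite expn_gt0 k0.
have count : (#|S| * Z <= N * (A * tot))%N.
  pose Sf (f : {ffun vert -> 'I_n}) := [set w : Omega | [forall p, forall q, (p.1 != q.1) ==> apart w (f p) (f q)]].
  apply: (@leq_trans (\sum_(f : {ffun vert -> 'I_n} | injectiveb f) #|Sf f| * Z)%N).
    rewrite -big_distrl leq_mul2r; apply/orP; right.
    apply: leq_trans (card_bigcup_le _ _); apply: subset_leq_card; apply/subsetP => w.
    by rewrite inE => /existsP[f /andP[fi fS]]; apply/bigcupP; exists f; rewrite // inE.
  apply: (@leq_trans (\sum_(f : {ffun vert -> 'I_n} | injectiveb f) A * tot)%N).
    by apply: leq_sum => f /injectiveP fi; apply: count_spread.
  rewrite sum_nat_const leq_mul2r; apply/orP; right.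
  apply: leq_trans (max_card _) _; by rewrite card_ffun card_prod !card_ord.
have AZ : (A ^ 2 <= Z)%N.
  by rewrite /A /Z -expnM leq_exp2l // -mulnA leq_mul2l [(M * 2)%N]mulnC big_parts orbT.
have kb2 : (2 <= k * b)%N by apply: leq_trans k1 _; rewrite leq_pmulr.
have N4 : (4 <= N)%N.
  apply: (@leq_trans (2 ^ (k * b))%N); last exact: leq_expn2r.
  by rewrite -[4%N]/(2 ^ 2)%N leq_exp2l.
have NZ : (N ^ 4 <= Z)%N.
  rewrite /N /Z -expnM [(k * b * 4)%N]mulnC (expnM n 4) (expnM k D); exact: leq_expn2r.
have NA : (2 * (N * A) < Z)%N.
  rewrite -ltn_sqr !expnMn; apply: (@leq_ltn_trans (2 ^ 2 * N ^ 2 * Z)%N).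
    by rewrite mulnA leq_mul2l AZ orbT.
  rewrite [X in (_ < X)%N]expnS expn1 ltn_mul2r Z0 /=; apply: leq_trans NZ.
  rewrite -[4%N]/(2 + 2)%N expnD ltn_mul2r expn_gt0 (leq_trans _ N4) //=.
  by apply: (@leq_ltn_trans (2 ^ 2)%N) => //; rewrite ltn_sqr (leq_trans _ N4).
rewrite -(ltn_pmul2r Z0) -mulnA; apply: (@leq_ltn_trans (2 * (N * A) * tot)%N).
  by rewrite -!mulnA leq_mul2l.
by rewrite mulnC ltn_mul2l tot0.
Qed.

(** Markov for the number of non-edges, and the union bound for the copies: each
    excludes at most half of the configurations, the second one strictly less. *)
Lemma random_points : exists G : sgraph 'I_n, ~ contains_copy (blowup k b) G /\
  (coedges G [set: 'I_n] [set: 'I_n] * M <= 2 * (n * M + n ^ 2 * D))%N.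
Proof.
pose tot := (M ^ (D * n))%N; pose E := (n * M + n ^ 2 * D)%N.
have E0 : (0 < E)%N by rewrite addn_gt0 muln_gt0 M0 (ltnW n1).
pose co w := (coedges (point_graph w) [set: 'I_n] [set: 'I_n] * M)%N.
pose S1 := [set w : Omega | (2 * E < co w)%N].
have c1 : (2 * #|S1| <= tot)%N.
  rewrite -(leq_pmul2r E0); apply: leq_trans sum_coedges.
  apply: (@leq_trans (\sum_(w in S1) co w)%N).
    rewrite mulnAC mulnC -sum_nat_const; apply: leq_sum => w; rewrite inE; exact: ltnW.
  by rewrite [X in (_ <= X)%N](bigID (mem S1)) /= leq_addr.
have := count_copies; set S2 := [set w | _] => c2.
have : S1 :|: S2 != [set: Omega].
  apply/eqP => S12.
  have : (#|[set: Omega]| <= #|S1| + #|S2|)%N by rewrite -S12 (leq_of_leqif (leq_card_setU _ _)).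
  rewrite cardsT card_ffun card_prod !card_ord -/tot; rewrite -/tot in c2; lia.
rewrite eqEsubset subsetT /= => /subsetPn[w _]; rewrite in_setU negb_or => /andP[w1 w2].
exists (point_graph w); split; last by move: w1; rewrite inE -leqNgt.
move=> [f [fi fG]]; move: w2; rewrite inE => /negP; apply.
apply/existsP; exists [ffun p => f p]; apply/andP; split.
  by apply/injectiveP => p q; rewrite !ffunE => /fi.
apply/forallP => p; apply/forallP => q; apply/implyP => pq; rewrite !ffunE.
exact: fG.
Qed.

End RandomPoints.

(** * Random graphs inside one part of a complete multipartite graph *)

(** A complete r-partite graph with the classes modulo r, and inside class 0 a
    random graph in which each pair is present when its value in 'I_m is 0, that is
    with probability 1 / m. *)
Section RandomClass.
Variables (n r b m : nat).
Hypotheses (n1 : (1 < n)%N) (r0 : (0 < r)%N) (b0 : (0 < b)%N) (m0 : (0 < m)%N).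
Hypothesis sparse : (n ^ 4 <= m ^ b)%N.

Local Notation Omega := {ffun {set 'I_n} -> 'I_m}.
Implicit Types (w : Omega) (u v : 'I_n).

Definition sampled w : rel 'I_n :=
  fun u v => [&& u != v, u %% r == 0, v %% r == 0 & w [set u; v] == 0 :> nat]%N.

Definition class_adj w : rel 'I_n := fun u v => (u %% r != v %% r)%N || sampled w u v.

Lemma sampled_sym w : symmetric (sampled w).
Proof. by move=> u v; rewrite /sampled eq_sym setUC; congr (_ && _); rewrite andbCA. Qed.

Lemma class_adj_sym w : symmetric (class_adj w).
Proof. by move=> u v; rewrite /class_adj eq_sym sampled_sym. Qed.

Lemma class_adj_irr w : irreflexive (class_adj w).
Proof. by move=> u; rewrite /class_adj /sampled !eqxx. Qed.

Definition class_graph w : sgraph 'I_n := SGraph (class_adj_sym w) (class_adj_irr w).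

Definition total := (m ^ #|{set 'I_n}|)%N.

Lemma card_Omega : #|[set: Omega]| = total.
Proof. by rewrite cardsT card_ffun card_ord. Qed.

Lemma total_gt0 : (0 < total)%N. Proof. by rewrite expn_gt0 m0. Qed.

Lemma count_sampled (e : {set 'I_n}) : (total <= m * #|[set w : Omega | w e == 0 :> nat]|)%N.
Proof.
pose z := Ordinal m0.
pose g (w : Omega) : 'I_m * Omega := (w e, [ffun s => if s == e then z else w s]).
have inj : injective g.
  move=> w w' [we /ffunP wE]; apply/ffunP => s; have := wE s; rewrite !ffunE.
  by case: eqP => [->|].
rewrite -card_Omega -(card_imset [set: Omega] inj) -[X in (_ <= X * _)%N]card_ord -cardsT -cardsX.
apply: subset_leq_card; apply/subsetP => x /imsetP[w _ ->].
by rewrite !inE ffunE eqxx.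
Qed.

Definition sampled_pairs w := (\sum_u \sum_v sampled w u v)%N.

Definition class0 : {set 'I_n} := [set u : 'I_n | u %% r == 0]%N.

Lemma class0_large : (n %/ r <= #|class0|)%N.
Proof.
have ir (i : 'I_(n %/ r)) : (i * r < n)%N.
  apply: leq_trans (leq_divM n r); rewrite ltn_mul2r r0; exact: ltn_ord.
pose g i := Ordinal (ir i).
have inj : injective g.
  move=> i j [] /eqP; rewrite eqn_mul2r (negPf (lt0n_neq0 r0)) => /eqP; exact: val_inj.
rewrite -[X in (X <= _)%N]card_ord -cardsT -(card_imset [set: 'I_(n %/ r)] inj).
by apply: subset_leq_card; apply/subsetP => u /imsetP[i _ ->]; rewrite inE /= modnMl.
Qed.

Lemma class_small u : (#|[set v : 'I_n | v %% r == u %% r]%N| <= (n %/ r).+1)%N.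
Proof.
have ir (v : 'I_n) : (v %/ r < (n %/ r).+1)%N by rewrite ltnS leq_div2r // ltnW.
rewrite -[X in (_ <= X)%N]card_ord -cardsT.
rewrite -(card_in_imset (f := fun v => Ordinal (ir v)) (D := [set v : 'I_n | v %% r == u %% r]%N)).
  by apply: subset_leq_card; apply/subsetP.
move=> v v'; rewrite !inE => /eqP vu /eqP vu' [] vv; apply: val_inj => /=.
by rewrite (divn_eq v r) (divn_eq v' r) vv vu vu'.
Qed.

Lemma coedges_class w :
  (coedges (class_graph w) [set: 'I_n] [set: 'I_n] + sampled_pairs w <= n * (n %/ r).+1)%N.
Proof.
rewrite -[X in (_ <= X * _)%N]card_ord -sum_nat_const /coedges /sampled_pairs.
rewrite (eq_bigl xpredT) => [|u]; last by rewrite inE.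
rewrite -big_split /=; apply: leq_sum => u _.
rewrite (eq_bigl xpredT) => [|v]; last by rewrite inE.
rewrite -big_split /=; apply: leq_trans (class_small u).
rewrite -sum1dep_card [X in (_ <= X)%N]big_mkcond /=; apply: leq_sum => v _.
rewrite /class_adj [(u %% r == _)%N]eq_sym.
case: (boolP (v %% r == u %% r)%N) => [vu|vu] /=; first by case: (sampled w u v).
rewrite /sampled; case: (eqVneq (u %% r)%N 0%N) => [u0|_]; last by rewrite andbF.
case: (eqVneq (v %% r)%N 0%N) => [v0|_]; last by rewrite !andbF.
by rewrite u0 v0 in vu.
Qed.

Lemma sum_sampled :
  (total * (n %/ r * (n %/ r).-1) <= \sum_(w : Omega) m * sampled_pairs w)%N.
Proof.
apply: (@leq_trans (total * (#|class0| * #|class0|.-1))%N).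
  rewrite leq_mul2l leq_mul ?orbT ?class0_large //.
  by rewrite -!subn1 leq_sub2r // class0_large.
have -> : (\sum_(w : Omega) m * sampled_pairs w =
    \sum_u \sum_v m * #|[set w : Omega | sampled w u v]|)%N.
  rewrite -big_distrr /= /sampled_pairs exchange_big /= [RHS](eq_bigr (fun u => m * \sum_v #|[set w : Omega | sampled w u v]|)%N).
    rewrite -big_distrr /=; congr (_ * _)%N; apply: eq_bigr => u _.
    rewrite exchange_big /=; apply: eq_bigr => v _.
    by rewrite -sum1dep_card [RHS]big_mkcond /=; apply: eq_bigr => w _; case: (sampled w u v).
  by move=> u _; rewrite -big_distrr.
rewrite mulnCA -sum_nat_const [X in (_ <= X)%N](bigID (mem class0)) /=.
apply: leq_trans (leq_addr _ _); apply: leq_sum => u uC.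
have -> : #|class0|.-1 = #|class0 :\ u| by rewrite (cardsD1 u class0) uC.
rewrite mulnC -sum_nat_const [X in (_ <= X)%N](bigID (mem (class0 :\ u))) /=.
apply: leq_trans (leq_addr _ _); apply: leq_sum => v.
rewrite !inE => /andP[vu vC]; apply: leq_trans (count_sampled [set u; v]) _.
rewrite leq_mul2l subset_leq_card ?orbT //; apply/subsetP => w.
by move: uC; rewrite !inE /sampled [u == v]eq_sym vu vC => ->.
Qed.

Definition dense_pair w (f : {ffun bool * 'I_b -> 'I_n}) :=
  injectiveb f && [forall x, forall y, w [set f (true, x); f (false, y)] == 0 :> nat].

(** Only r - 1 parts of a blow-up of K_{r+1} can meet the r - 1 independent
    classes, so two parts lie inside the random class. *)
Lemma copy_dense_pair w : contains_copy (blowup r.+1 b) (class_graph w) ->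
  exists f : {ffun bool * 'I_b -> 'I_n}, dense_pair w f.
Proof.
move=> [f [fi fG]].
pose P := [set i : 'I_r.+1 | [forall x : 'I_b, f (i, x) %% r == 0]%N].
have [/card_gt1P[i [j [iP jP ij]]]|P1] := ltnP 1 #|P|.
  exists [ffun p => f (if p.1 then i else j, p.2)]; apply/andP; split.
    apply/injectiveP => -[s x] [t y]; rewrite !ffunE /= => /fi [].
    by case: s; case: t => /= e -> //; rewrite e eqxx in ij.
  apply/forallP => x; apply/forallP => y; rewrite !ffunE /=.
  have := fG (i, x) (j, y) ij; rewrite /= /class_adj.
  move: iP jP; rewrite !inE => /forallP/(_ x)/eqP -> /forallP/(_ y)/eqP ->.
  by rewrite eqxx /= => /and4P[].
exfalso; pose i0 := Ordinal b0.
pose g (i : 'I_r.+1) : 'I_r := Ordinal (ltn_pmod (f (i, odflt i0 [pick x | f (i, x) %% r != 0]%N)) r0).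
have gn i : i \notin P -> (g i != 0 :> nat)%N.
  rewrite inE negb_forall => /existsP[x xn] /=; case: pickP => [//|/(_ x)].
  by rewrite xn.
have inj : {in ~: P &, injective g}.
  move=> i j; rewrite in_setC => iP _ gE; apply/eqP; apply: contraT => ij.
  have := fG (i, odflt i0 [pick x | f (i, x) %% r != 0]%N) (j, odflt i0 [pick x | f (j, x) %% r != 0]%N) ij.
  have gE' := congr1 val gE; rewrite /= in gE'; rewrite /= /class_adj gE' eqxx /= /sampled.
  move=> /and4P[_ + _ _]; have := gn i iP; by rewrite /= => /negPf ->.
have c := card_in_imset inj.
have : (#|g @: ~: P| <= #|[set~ Ordinal r0]|)%N.
  apply: subset_leq_card; apply/subsetP => y /imsetP[i]; rewrite in_setC => iP ->.
  by rewrite !inE; apply: contraNneq (gn i iP) => ->.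
rewrite c cardsC1 card_ord; have := cardsC P; rewrite card_ord; lia.
Qed.

Lemma count_dense_pair (f : {ffun bool * 'I_b -> 'I_n}) :
  (#|[set w : Omega | dense_pair w f]| * m ^ (b * b) <= total)%N.
Proof.
have [/injectiveP fi|fn] := boolP (injectiveb f); last first.
  by rewrite eq_card0 // => w; rewrite inE /dense_pair (negPf fn).
pose h (xy : 'I_b * 'I_b) := [set f (true, xy.1); f (false, xy.2)].
have ne x y : f (true, x) != f (false, y) by apply/eqP => /fi.
have hi : injective h.
  move=> [x y] [x' y'] /eqP; rewrite /h /= set2_eq ?ne // => /orP[] /eqP[e1 e2].
    by have [->] := fi _ _ e1; have [->] := fi _ _ e2.
  by have := fi _ _ e1.
pose E := h @: [set: 'I_b * 'I_b].
have Ec : #|E| = (b * b)%N by rewrite card_imset // cardsT card_prod card_ord.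
pose F (e : {set 'I_n}) : pred 'I_m := [pred a : 'I_m | (e \in E) ==> (val a == 0)%N].
apply: (@leq_trans (#|family F| * m ^ (b * b))%N).
  rewrite leq_mul2r; apply/orP; right; apply: subset_leq_card; apply/subsetP => w.
  rewrite inE => /andP[_ /forallP Hw]; apply/familyP => e; rewrite inE.
  by apply/implyP => /imsetP[[x y] _ ->]; have /forallP := Hw x; apply.
rewrite card_family foldrE big_map big_enum /= (bigID (mem E)) /=.
have -> : total = (m ^ (#|{set 'I_n}| - b * b) * m ^ (b * b))%N.
  by rewrite -expnD subnK // -Ec max_card.
rewrite leq_mul2r; apply/orP; right; rewrite -[X in (_ <= X)%N]mul1n leq_mul //.
  rewrite -[X in (_ <= X)%N](exp1n #|E|) -prod_nat_const; apply: leq_prod => e eE.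
  rewrite -(card1 (Ordinal m0)); apply: subset_leq_card; apply/subsetP => a.
  by rewrite !inE eE /= => /eqP a0; apply/eqP/val_inj.
have -> : (#|{set 'I_n}| - b * b = #|[predC E]|)%N.
  by rewrite -Ec -(cardC E) addKn.
rewrite -prod_nat_const; apply: leq_prod => e _.
by rewrite -[X in (_ <= X)%N]card_ord max_card.
Qed.

(** The expected number of chosen pairs in class 0 is (1 / m) times their number.  The
    configurations with a dense pair are so rare (at most a proportion n^-2) that
    removing them costs at most one pair on average. *)
Lemma random_class : exists G : sgraph 'I_n, ~ contains_copy (blowup r.+1 b) G /\
  (m * coedges G [set: 'I_n] [set: 'I_n] + n %/ r * (n %/ r).-1 <=
   m * (n * (n %/ r).+1) + m)%N.
Proof.
pose S := (n %/ r * (n %/ r).-1)%N.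
pose Bad := [set w : Omega | [exists f, dense_pair w f]].
suff [w wB wS] : exists2 w, w \notin Bad & (S <= m * sampled_pairs w + m)%N.
  exists (class_graph w); split.
    move=> /copy_dense_pair[f fw]; move: wB; rewrite inE => /negP; apply.
    by apply/existsP; exists f.
  have := coedges_class w; set co := coedges _ _ _; rewrite -(leq_pmul2l m0) mulnDr.
  by rewrite -/S; lia.
have cB : (#|Bad| * n ^ 2 <= total)%N.
  have np : (0 < n ^ (2 * b))%N by rewrite expn_gt0 (ltnW n1).
  rewrite -(leq_pmul2r np) -mulnA -expnD.
  apply: (@leq_trans (#|Bad| * m ^ (b * b))%N).
    rewrite leq_mul2l; apply/orP; right; rewrite expnM.
    apply: leq_trans (leq_expn2r b sparse); rewrite -expnM leq_exp2l //; lia.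
  apply: (@leq_trans (\sum_(f : {ffun bool * 'I_b -> 'I_n}) #|[set w : Omega | dense_pair w f]| * m ^ (b * b))%N).
    rewrite -big_distrl leq_mul2r; apply/orP; right.
    apply: leq_trans (card_bigcup_le _ _); apply: subset_leq_card; apply/subsetP => w.
    by rewrite inE => /existsP[f fw]; apply/bigcupP; exists f; rewrite // inE.
  apply: (@leq_trans (\sum_(f : {ffun bool * 'I_b -> 'I_n}) total)%N).
    by apply: leq_sum => f _; apply: count_dense_pair.
  by rewrite sum_nat_const card_ffun card_prod card_bool !card_ord mulnC.
have [sm|ms] := leqP S m.
  have : Bad != [set: Omega].
    apply/eqP => BT; move: cB; rewrite BT card_Omega.
    have := total_gt0; have : (4 <= n ^ 2)%N by rewrite (leq_expn2r 2 n1).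
    by move=> *; nia.
  rewrite eqEsubset subsetT /= => /subsetPn[w _ wB]; exists w => //.
  by apply: leq_trans sm _; rewrite leq_addl.
have [/existsP[w /andP[wB wS]]|none] := boolP [exists w, (w \notin Bad) && (S <= m * sampled_pairs w + m)%N].
  by exists w.
exfalso; have := sum_sampled; rewrite -/S (bigID (mem Bad)) /=.
have h1 : (\sum_(w in Bad) m * sampled_pairs w <= m * total)%N.
  apply: (@leq_trans (\sum_(w in Bad) m * n ^ 2)%N).
    apply: leq_sum => w _; rewrite leq_mul2l; apply/orP; right.
    apply: (@leq_trans (\sum_(u < n) \sum_(v < n) 1)%N).
      by apply: leq_sum => u _; apply: leq_sum => v _; case: (sampled w u v).
    by rewrite !sum_nat_const !card_ord muln1.
  by rewrite sum_nat_const mulnCA leq_mul2l cB orbT.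
have h2 : (\sum_(w | w \notin Bad) (m * sampled_pairs w + m.+1) <= #|~: Bad| * S)%N.
  have -> : (#|~: Bad| * S = \sum_(w | w \notin Bad) S)%N.
    by rewrite -sum_nat_const; apply: eq_bigl => w; rewrite in_setC.
  apply: leq_sum => w wB; move: none; rewrite negb_exists => /forallP/(_ w).
  by rewrite wB /= -ltnNge addnS.
have h3 : (\sum_(w | w \notin Bad) (m * sampled_pairs w + m.+1) =
   \sum_(w | w \notin Bad) m * sampled_pairs w + #|~: Bad| * m.+1)%N.
  rewrite big_split /=; congr (_ + _)%N; rewrite -sum_nat_const.
  by apply: eq_bigl => w; rewrite in_setC.
have := cardsC Bad; rewrite -cardsT card_Omega.
move: h1 h2; rewrite h3; set s1 := (\sum_(w in Bad) _)%N; set s2 := (\sum_(w | _) _)%N.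
set p := #|Bad|; set q := #|~: Bad| => h1 h2 pq h4.
have h5 : (p * m.+1 <= p * S)%N by rewrite leq_mul2l ms orbT.
have := total_gt0; move: h4; rewrite -pq !mulnDl => h4 t0.
by move: h1 h2 h4 h5 t0; rewrite -pq; nia.
Qed.

End RandomClass.

(** * The upper bound *)

Section Upper.
Variable R : realType.

Lemma not_forced (n r b : nat) (delta : R) (G : sgraph 'I_n) :
  ~ contains_copy (blowup r.+1 b) G ->
  (coedges G [set: 'I_n] [set: 'I_n])%:R <= (r%:R^-1 - delta) * n%:R ^+ 2 ->
  ~ forces_blowup n r delta b.
Proof.
move=> nG co forced; apply/nG/forced.
have := congr1 (fun n : nat => n%:R : R) (coedges_edges G); rewrite natrD natrM natrX card_ord.
by move: co; lra.
Qed.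

Lemma powers_le (n a m d : nat) : (0 < n)%N -> (0 < m)%N ->
  a%:R * ln n%:R <= d%:R * ln m%:R :> R -> (n ^ a <= m ^ d)%N.
Proof.
move=> n0 m0 le; rewrite -(ler_nat R) !natrX -ler_ln ?posrE ?exprn_gt0 ?ltr0n //.
by rewrite !lnXn ?ltr0n // -[X in X <= _]mulr_natl -[X in _ <= X]mulr_natl.
Qed.

Lemma le_expR_ln (a y : R) : 0 < a -> ln a <= y -> a <= expR y.
Proof. by move=> a0 ay; rewrite -[a]lnK ?ler_expR. Qed.

(** For delta not too small compared with 1 / r the logarithms of 1 / delta and r are
    comparable.  Take D about 4 ln n / ln r and M about 4 D r / eps, so that the
    proportion of non-edges is at most eps / r; then M is of order
    r ln n / (eps ln r), and k b >= 2 M holds for b of order M / r. *)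
Lemma upper_points (r : nat) (delta : R) : (2 <= r)%N -> 0 < delta -> delta < r%:R^-1 ->
  ln delta^-1 <= 8 * ln r%:R ->
  exists x0 : R, forall n b : nat, (0 < n)%N -> x0 <= ln n%:R ->
   400 * (ln n%:R / ((r%:R^-1 - delta) * r%:R * ln delta^-1)) <= b%:R ->
   ~ forces_blowup n r delta b.
Proof.
move=> r2 d0 dr; set l := ln delta^-1 => lr; have rp : 2 <= r%:R :> R by rewrite ler_nat.
have r0 : 0 < r%:R :> R by lra.
have rd : r%:R < delta^-1 by rewrite -[r%:R]invrK ltf_pV2 ?posrE ?invr_gt0.
have lrl : ln r%:R <= l by rewrite /l ler_ln ?posrE ?invr_gt0 // ltW.
have [l2 _] := ln_parts r2 lrl.
pose eps := (r%:R^-1 - delta) * r%:R; rewrite -/eps.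
have e0 : 0 < eps by rewrite /eps mulr_gt0 // subr_gt0.
have e1 : eps < 1 by rewrite /eps mulrBl mulVf ?lt0r_neq0 // gtrBl mulr_gt0.
have epsr : r%:R^-1 - delta = eps / r%:R by rewrite /eps mulfK // lt0r_neq0.
pose lk : R := ln r.+1%:R.
have lkr : ln r%:R <= lk by rewrite ler_ln ?posrE // ler_nat.
have lkl : l <= 8 * lk by lra.
have lk0 : 0 < lk by lra.
have lkE : ln r.+1%:R = lk by [].
clearbody l lk eps.
exists (Num.max 1 (Num.max lk (ln (4 * r%:R / eps)))) => n b n0.
rewrite !ge_max => /and3P[x1 xlk xe]; set x := ln n%:R in x1 xlk xe * => big forced.
have nE : n%:R = expR x by rewrite /x lnK // posrE ltr0n.
have n1 : (1 < n)%N.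
  rewrite -(ltr_nat R) nE; have := expR_ge1Dx x; lra.
pose D := (Num.truncn (4 * x / lk)).+1.
have y0 : 0 <= 4 * x / lk by rewrite divr_ge0 ?(ltW lk0) //; lra.
have D1 : 4 * x <= D%:R * lk by rewrite -ler_pdivrMr // ltW // truncnS_gt.
have D2 : D%:R <= 5 * x / lk.
  rewrite /D -natr1; have : (Num.truncn (4 * x / lk))%:R <= 4 * x / lk by rewrite truncn_le.
  have : 1 <= x / lk by rewrite ler_pdivlMr // mul1r.
  by lra.
have Dp : 1 <= D%:R :> R by rewrite ler1n.
pose M := (Num.truncn (4 * D%:R * r%:R / eps)).+1.
have re : 1 <= r%:R / eps by rewrite ler_pdivlMr // mul1r; lra.
have z0 : 0 <= 4 * D%:R * r%:R / eps by rewrite -mulrA mulr_ge0 //; lra.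
have M1 : 4 * D%:R * r%:R <= M%:R * eps by rewrite -ler_pdivrMr // ltW // truncnS_gt.
have M2 : M%:R <= 5 * D%:R * r%:R / eps.
  rewrite /M -natr1; have : (Num.truncn (4 * D%:R * r%:R / eps))%:R <= 4 * D%:R * r%:R / eps by rewrite truncn_le.
  have : 1 * 1 <= D%:R * (r%:R / eps) by apply: ler_pM.
  by rewrite mulr1; lra.
have Mb : 50 * (x / (eps * lk)) <= b%:R.
  apply: le_trans big; have : x / (eps * lk) <= 8 * (x / (eps * l)).
    have l0 : 0 < l by lra.
    rewrite ler_pdivrMr ?mulr_gt0 //.
    have -> : 8 * (x / (eps * l)) * (eps * lk) = x * (8 * lk / l).
      by field; rewrite !lt0r_neq0.
    by rewrite ler_peMr ?ler_pdivlMr ?mul1r //; lra.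
  by lra.
have M3 : 2 * M%:R <= r%:R * b%:R :> R.
  apply: (@le_trans _ _ (r%:R * (50 * (x / (eps * lk))))); last by rewrite ler_pM2l.
  apply: (@le_trans _ _ (2 * (5 * (5 * x / lk) * r%:R / eps))).
    rewrite ler_pM2l //; apply: le_trans M2 _.
    by rewrite ler_pM2r ?invr_gt0 // ler_pM2r // ler_pM2l.
  by rewrite le_eqVlt; apply/orP; left; apply/eqP; field; rewrite !lt0r_neq0.
have b0 : (0 < b)%N.
  rewrite -(ltr0n R); apply: lt_le_trans Mb; rewrite mulr_gt0 // divr_gt0 ?mulr_gt0 //; lra.
have kb : (2 * M <= r.+1 * b)%N.
  apply: (@leq_trans (r * b)%N); last by rewrite leq_mul2r leqnSn orbT.
  by rewrite -(ler_nat R) !natrM.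
have dim : (n ^ 4 <= r.+1 ^ D)%N by apply: powers_le => //; rewrite lkE.
have k1 : (1 < r.+1)%N by rewrite ltnS; apply: leq_trans r2.
have [G [Gfree Gco]] := random_points n1 k1 b0 (ltn0Sn _ : (0 < M)%N) kb dim.
apply: (not_forced Gfree _ forced); rewrite epsr.
have np : 0 < n%:R :> R by rewrite ltr0n.
have Mp : 0 < M%:R :> R by rewrite ltr0n.
move: Gco; rewrite -(ler_nat R) natrM [(2 * _)%:R]natrM natrD [(n * M)%:R]natrM [(_ * D)%:R]natrM natrX; set co := (coedges _ _ _)%:R => Gco.
rewrite -(ler_pM2r Mp); apply: le_trans Gco _.
have n4 : 4 * r%:R <= eps * n%:R.
  by rewrite [eps * _]mulrC -ler_pdivrMr // nE le_expR_ln // divr_gt0 // mulr_gt0.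
have t1 : 2 * (n%:R * M%:R) <= eps / r%:R / 2 * n%:R ^+ 2 * M%:R.
  have -> : eps / r%:R / 2 * n%:R ^+ 2 * M%:R = (eps * n%:R) / (4 * r%:R) * (2 * (n%:R * M%:R)).
    by field; rewrite lt0r_neq0.
  by rewrite ler_peMl ?mulr_ge0 // ler_pdivlMr ?mul1r // mulr_gt0.
have t2 : 2 * (n%:R ^+ 2 * D%:R) <= eps / r%:R / 2 * n%:R ^+ 2 * M%:R.
  have -> : 2 * (n%:R ^+ 2 * D%:R) = n%:R ^+ 2 * ((2 * r%:R)^-1 * (4 * D%:R * r%:R)) :> R.
    by field; rewrite lt0r_neq0.
  have -> : eps / r%:R / 2 * n%:R ^+ 2 * M%:R = n%:R ^+ 2 * ((2 * r%:R)^-1 * (M%:R * eps)).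
    by field; rewrite lt0r_neq0.
  by rewrite ler_pM2l ?exprn_gt0 // ler_pM2l // invr_gt0 mulr_gt0.
by rewrite mulrDr; lra.
Qed.

(** For tiny delta only a class of n / r vertices is made denser, to a density of
    order r^2 delta; this is a power of delta, hence ln m has the order of
    ln (1 / delta). *)
Lemma upper_class (r : nat) (delta : R) : (2 <= r)%N -> 0 < delta -> delta < r%:R^-1 ->
  8 * ln r%:R <= ln delta^-1 ->
  exists x0 : R, forall n b : nat, (0 < n)%N -> x0 <= ln n%:R ->
   32 * (ln n%:R / ((r%:R^-1 - delta) * r%:R * ln delta^-1)) <= b%:R ->
   ~ forces_blowup n r delta b.
Proof.
move=> r2 d0 dr; set l := ln delta^-1 => lr; have rp : 2 <= r%:R :> R by rewrite ler_nat.
have r0 : 0 < r%:R :> R by lra.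
have ln2 := ln2_ge R.
have lr2 : ln 2 <= ln r%:R :> R by rewrite ler_ln ?posrE.
have l4 : 4 <= l by lra.
have ln16 : ln 16 = 4 * ln 2 :> R.
  by rewrite -[16]/(2 * 8)%:R; have -> : (2 * 8)%:R = 2 ^+ 4 :> R; [rewrite -natrX | rewrite lnXn // mulr_natl].
pose y := (16 * r%:R ^+ 2 * delta)^-1.
have y0 : 0 < y by rewrite invr_gt0 !mulr_gt0 // exprn_gt0.
have lny : ln y = l - 2 * ln r%:R - 4 * ln 2.
  rewrite /y lnV ?posrE ?mulr_gt0 ?exprn_gt0 // lnM ?posrE ?mulr_gt0 ?exprn_gt0 //.
  rewrite lnM ?posrE ?exprn_gt0 // lnXn // -[ln r%:R *+ 2]mulr_natl ln16 /l lnV ?posrE //; ring.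
have y1 : 1 <= y.
  by rewrite -[X in X <= _]expR0 -[X in _ <= X]lnK ?posrE // ler_expR lny; lra.
pose m := Num.truncn y.
have m0 : (0 < m)%N by rewrite truncn_gt0.
have my : m%:R <= y by rewrite truncn_le // ltW.
have m2 : y / 2 <= m%:R by apply: truncn_half.
have mp : 0 < m%:R :> R by rewrite ltr0n.
have lm : l <= 8 * ln m%:R.
  have : ln y - ln 2 <= ln m%:R.
    by rewrite -ln_div ?posrE // ler_ln ?posrE // divr_gt0.
  by rewrite lny; lra.
have my' : m%:R * (16 * r%:R ^+ 2 * delta) <= 1.
  rewrite -ler_pdivlMr ?div1r //; first by rewrite mulr_gt0 // mulr_gt0 // exprn_gt0.
pose eps := (r%:R^-1 - delta) * r%:R; rewrite -/eps.
have e0 : 0 < eps by rewrite /eps mulr_gt0 // subr_gt0.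
have e1 : eps <= 1 by rewrite /eps mulrBl mulVf ?lt0r_neq0 // gerBl mulr_ge0 // ltW.
clearbody l m; clear lny y1 y0 my m2 lr ln16.
exists (Num.max 1 (Num.max (ln (8 * r%:R)) (ln delta^-1))) => n b n0.
rewrite !ge_max => /and3P[x1 xr xd]; set x := ln n%:R in x1 xr xd * => big forced.
have nE : n%:R = expR x by rewrite /x lnK // posrE ltr0n.
have n1 : (1 < n)%N by rewrite -(ltr_nat R) nE; have := expR_ge1Dx x; lra.
have nr : 8 * r%:R <= n%:R :> R by rewrite nE le_expR_ln // mulr_gt0.
have nd : 1 <= delta * n%:R.
  by rewrite mulrC -ler_pdivrMr // div1r nE le_expR_ln // invr_gt0.
have xl : 32 * (x / l) <= b%:R.
  apply: le_trans big; have l0 : 0 < l by lra.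
  have el : 0 < eps * l by rewrite mulr_gt0.
  rewrite ler_pM2l // ler_wpM2l //; first by lra.
  by rewrite lef_pV2 ?posrE // ger_pMl.
have b0 : (0 < b)%N.
  by rewrite -(ltr0n R); apply: lt_le_trans xl; rewrite mulr_gt0 // divr_gt0 //; lra.
have sparse : (n ^ 4 <= m ^ b)%N.
  apply: powers_le => //; rewrite -/x.
  apply: (@le_trans _ _ (32 * (x / l) * ln m%:R)).
    have -> : 32 * (x / l) * ln m%:R = (32 * x * ln m%:R) / l by ring.
    by rewrite ler_pdivlMr; [nra | lra].
  by rewrite ler_wpM2r // ln_ge0 // ler1n.
have [G [Gfree Gco]] := random_class n1 (leq_trans (ltn0Sn 1) r2) b0 m0 sparse.
clear xl sparse lm l4 ln2 lr2 rp xr xd.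
apply: (not_forced Gfree _ forced).
have np : 0 < n%:R :> R by rewrite ltr0n.
set q := (n %/ r)%N in Gco.
have q1 : q%:R <= n%:R / r%:R :> R.
  by rewrite ler_pdivlMr // -natrM ler_nat leq_divM.
have q2 : n%:R / r%:R - 1 <= q%:R :> R.
  rewrite lerBlDr ler_pdivrMr // natr1 -natrM ler_nat; apply: ltnW; apply: ltn_ceil.
  exact: leq_trans r2.
have nr8 : 8 <= n%:R / r%:R :> R by rewrite ler_pdivlMr.
have qp : (0 < q)%N by rewrite -(ltr0n R); lra.
have Sq : 21 / 32 * (n%:R / r%:R) ^+ 2 <= q%:R * q.-1%:R :> R.
  have -> : q.-1%:R = q%:R - 1 :> R by rewrite -subn1 natrB.
  have : (n%:R / r%:R - 1) * (n%:R / r%:R - 2) <= q%:R * (q%:R - 1) :> R.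
    by apply: ler_pM; lra.
  by move: nr8; set z := n%:R / r%:R; rewrite expr2; nra.
move: Gco; rewrite -(ler_nat R) !natrD !natrM -natr1.
set co := (coedges _ _ _)%:R => Gco.
rewrite -(ler_pM2l mp); have {Gco} : m%:R * co <= m%:R * (n%:R * (q%:R + 1)) + m%:R - q%:R * q.-1%:R by lra.
move=> /le_trans; apply.
have t1 : m%:R * (n%:R * (q%:R + 1)) <= m%:R * (n%:R * (n%:R / r%:R + 1)) :> R.
  by rewrite ler_pM2l // ler_pM2l // lerD2r.
have t2 : m%:R * (10 * delta * n%:R ^+ 2) <= 21 / 32 * (n%:R / r%:R) ^+ 2.
  have := ler_wpM2r (sqr_ge0 (n%:R / r%:R)) my'.
  have -> : m%:R * (16 * r%:R ^+ 2 * delta) * (n%:R / r%:R) ^+ 2 = m%:R * (16 * delta * n%:R ^+ 2).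
    by field; rewrite lt0r_neq0.
  by have := sqr_ge0 (n%:R / r%:R : R); lra.
have t3 : n%:R + 1 <= 9 * delta * n%:R ^+ 2.
  have : n%:R <= delta * n%:R ^+ 2 by rewrite expr2 mulrA ler_peMl // ltW.
  by have : 1 <= n%:R :> R; [rewrite ler1n | lra].
have := ler_wpM2l (ltW mp) t3.
have E : m%:R * (n%:R * (n%:R / r%:R + 1)) = m%:R * (n%:R ^+ 2 / r%:R) + m%:R * n%:R :> R by ring.
rewrite {}E in t1.
have -> : m%:R * ((r%:R^-1 - delta) * n%:R ^+ 2) = m%:R * (n%:R ^+ 2 / r%:R) - m%:R * (delta * n%:R ^+ 2).
  by ring.
by rewrite mulrDr; lra.
Qed.

Lemma upper_bound : exists C : R, 0 < C /\ forall (r : nat) (delta : R),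
  (2 <= r)%N -> 0 < delta -> delta < r%:R^-1 ->
  exists x0 : R, forall n b : nat, (0 < n)%N -> x0 <= ln n%:R ->
   forces_blowup n r delta b ->
   b%:R <= C * (ln n%:R / ((r%:R^-1 - delta) * r%:R * ln delta^-1)).
Proof.
exists 400; split=> [|r delta r2 d0 dr]; first by rewrite ltr0n.
have [h|h] := leP (ln delta^-1) (8 * ln r%:R).
  have [x0 H] := upper_points r2 d0 dr h; exists x0 => n b n0 xn forced.
  by rewrite leNgt; apply/negP => /ltW big; apply: (H n b).
have [x0 H] := upper_class r2 d0 dr (ltW h); exists (Num.max 0 x0) => n b n0.
rewrite ge_max => /andP[x1 xn] forced.
rewrite leNgt; apply/negP => /ltW big; apply: (H n b) => //; apply: le_trans big.
have rp : 1 <= r%:R :> R by rewrite ler1n; apply: leq_trans r2.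
rewrite ler_wpM2r ?ler_nat // divr_ge0 // mulr_ge0 // ?mulr_ge0 ?subr_ge0 ?(ltW dr) //.
apply: le_trans (ltW h); rewrite mulr_ge0 // ln_ge0 //.
Qed.

End Upper.

(** By the upper bound the forced values are bounded, and by the lower bound one of
    them is positive, so that there is a largest one. *)
Theorem corollary3 (R : realType) :
  exists c C : R, [/\ 0 < c, 0 < C &
    forall (r : nat) (delta : R), (2 <= r)%N -> 0 < delta -> delta < r%:R^-1 ->
    exists n0 : nat, forall n : nat, (n0 < n)%N ->
    exists b : nat, [/\ is_blowup_number n r delta b,
      c * (ln n%:R / ((r%:R^-1 - delta) * r%:R * ln delta^-1)) <= b%:R &
      b%:R <= C * (ln n%:R / ((r%:R^-1 - delta) * r%:R * ln delta^-1))]].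
Proof.
have [c [c0 lower]] := lower_bound R; have [C [C0 upper]] := upper_bound R.
exists c, C; split => // r delta r2 d0 dr.
have [x1 low] := lower r delta r2 d0 dr; have [x2 up] := upper r delta r2 d0 dr.
exists (Num.truncn (expR (Num.max x1 x2))) => n nn.
have n0 : (0 < n)%N by apply: leq_ltn_trans nn.
have : Num.max x1 x2 <= ln n%:R.
  rewrite -[X in X <= _]expRK ler_ln ?posrE ?expR_gt0 ?ltr0n //.
  by apply: ltW; rewrite -truncn_lt_nat ?expR_ge0.
rewrite ge_max => /andP[xn1 xn2].
have [b0 [b0p b0f b0c]] := low n n0 xn1.
set X := ln n%:R / _ in b0c *.
have ex : exists b, `[< forces_blowup n r delta b >] by exists b0; apply/asboolP.
have ub b : `[< forces_blowup n r delta b >] -> (b <= Num.truncn (C * X))%N.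
  move=> /asboolP /(up n b n0 xn2) bX; rewrite truncn_ge_nat //.
  exact: le_trans bX.
case: (ex_maxnP ex ub) => b /asboolP bf bmax; exists b.
have b0b : (b0 <= b)%N by apply: bmax; apply/asboolP.
split; last exact: up.
- split => //; first exact: leq_trans b0p b0b.
  by move=> b' /asboolP; apply: bmax.
- by apply: le_trans b0c _; rewrite ler_nat.
Qed.
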